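(* Let $I\simeq (C_2)^4$ be the elementary abelian $2$-group of rank $4$ generated by $a_1,a_2,a_3,a_4$, and let $H$ be a cyclic group of order $8$ generated by $h$. Let $\omega$ be the action of $H$ on $I$ by automorphisms for which $\omega(h)$ fixes $a_1$ and sends $a_2\mapsto a_3$, $a_3\mapsto a_4$, $a_4\mapsto a_2a_3a_4$. Let $G=I\rtimes_{\omega} H$ be the corresponding split extension $1\to I\to G\to H\to 1$. Then the local-global principle fails for $(G,I,2)$: there is a subgroup $D$ of $G$ containing $I$ such that $(D,I)$ is $\mathbb{Q}_2$-realizable, but $(G,I,2)$ is not $\mathbb{Q}$-realizable.
   Context: $C_2$ is the cyclic group of order $2$. For a finite group $G$, a subgroup $I\le G$ and a prime $p$, the triple $(G,I,p)$ is $\mathbb{Q}$-realizable if there is a Galois extension $L/\mathbb{Q}$ with an identification $\mathrm{Gal}(L/\mathbb{Q})\cong G$ under which the inertia subgroup at $p$ is $I$ (taken at some prime of $L$ above $p$). A pair $(D,I)$ with $I\le D$ finite groups is $\mathbb{Q}_p$-realizable if there is a Galois extension of $\mathbb{Q}_p$ with Galois group identified with $D$ and inertia subgroup $I$. The local-global principle for $(G,I,p)$ is the assertion: $(G,I,p)$ is $\mathbb{Q}$-realizable if there exists a subgroup $D$ of $G$ containing $I$ such that $(D,I)$ is $\mathbb{Q}_p$-realizable. *)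

(* Defs.v *)
From HB Require Import structures.
From mathcomp Require Import all_boot all_order all_algebra all_fingroup
  all_solvable all_field.
From mathcomp Require Import boolp.

Set Implicit Arguments.
Unset Strict Implicit.
Unset Printing Implicit Defensive.

Import Order.TTheory GRing.Theory Num.Theory.

Local Open Scope ring_scope.

(** * p-adic integers and p-adic numbers

    [padic_int p_pr] is the inverse limit of the rings Z/p^n: an element is a
    compatible sequence of residues, the n-th one being represented by an
    integer in [0, p^n).  The compatibility condition also forces the
    residues to be reduced. *)

Definition padic_coherent (p : nat) : pred (nat -> int) :=
  fun u => `[< forall n, (u n.+1 %% (p ^ n)%N)%Z = u n >].

Record padic_int (p : nat) (p_pr : prime p) := PadicInt {
  residue :> nat -> int;
  _ : padic_coherent p residue
}.

HB.instance Definition _ (p : nat) (p_pr : prime p) :=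
  [isSub for @residue p p_pr].
HB.instance Definition _ (p : nat) (p_pr : prime p) :=
  [Choice of padic_int p_pr by <:].

Section PadicInt.
Variables (p : nat) (p_pr : prime p).
Implicit Types x y z : padic_int p_pr.

Let pX_neq0 n : ((p ^ n)%N : int) != 0.
Proof. by rewrite eqz_nat -lt0n expn_gt0 prime_gt0. Qed.

Lemma residueS x n : (x n.+1 %% (p ^ n)%N)%Z = x n.
Proof. by case: x => u /= /asboolP. Qed.

Lemma residue_mod x n : (x n %% (p ^ n)%N)%Z = x n.
Proof. by rewrite -(residueS x n) modz_mod. Qed.

Lemma modz_pX m n k : (n <= m)%N ->
  ((k %% (p ^ m)%N)%Z %% (p ^ n)%N)%Z = (k %% (p ^ n)%N)%Z.
Proof.
move=> le_nm; rewrite {2}(divz_eq k (p ^ m)%N) -(subnK le_nm) expnD PoszM mulrA.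
by rewrite modzMDl.
Qed.

Lemma residue_le x m n : (n <= m)%N -> (x m %% (p ^ n)%N)%Z = x n.
Proof.
elim: m => [|m IHm]; first by rewrite leqn0 => /eqP->; apply: residue_mod.
rewrite leq_eqVlt => /predU1P[->|]; first exact: residue_mod.
by rewrite ltnS => le_nm; rewrite -(modz_pX (x m.+1) le_nm) residueS IHm.
Qed.

Lemma residueP x y : (forall n, x n = y n) -> x = y.
Proof. by move=> eq_xy; apply/val_inj/funext. Qed.

Lemma padic_of_subproof (u : nat -> int) :
  (forall n, (u n.+1 = u n %[mod (p ^ n)%N])%Z) ->
  padic_coherent p (fun n => (u n %% (p ^ n)%N)%Z).
Proof. by move=> uP; apply/asboolP => n; rewrite modz_pX. Qed.

Definition padic_of u uP : padic_int p_pr :=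
  PadicInt p_pr (@padic_of_subproof u uP).

Lemma padic_add_subproof x y n :
  (x n.+1 + y n.+1 = x n + y n %[mod (p ^ n)%N])%Z.
Proof. by rewrite -modzDm !residueS. Qed.

Lemma padic_opp_subproof x n : (- x n.+1 = - x n %[mod (p ^ n)%N])%Z.
Proof. by rewrite -modzNm residueS. Qed.

Lemma padic_mul_subproof x y n :
  (x n.+1 * y n.+1 = x n * y n %[mod (p ^ n)%N])%Z.
Proof. by rewrite -modzMm !residueS. Qed.

Definition padic_zero := padic_of (fun n => erefl (0 %% (p ^ n)%N)%Z).
Definition padic_one := padic_of (fun n => erefl (1 %% (p ^ n)%N)%Z).
Definition padic_add x y := padic_of (padic_add_subproof x y).
Definition padic_opp x := padic_of (padic_opp_subproof x).
Definition padic_mul x y := padic_of (padic_mul_subproof x y).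

Lemma padic_addA : associative padic_add.
Proof.
by move=> x y z; apply: residueP => n; rewrite /= modzDml modzDmr addrA.
Qed.

Lemma padic_addC : commutative padic_add.
Proof. by move=> x y; apply: residueP => n; rewrite /= addrC. Qed.

Lemma padic_add0 : left_id padic_zero padic_add.
Proof.
by move=> x; apply: residueP => n; rewrite /= modzDml add0r residue_mod.
Qed.

Lemma padic_addN : left_inverse padic_zero padic_opp padic_add.
Proof. by move=> x; apply: residueP => n; rewrite /= modzDml addNr. Qed.

HB.instance Definition _ := GRing.isZmodule.Build (padic_int p_pr)
  padic_addA padic_addC padic_add0 padic_addN.

Lemma padic_mulA : associative padic_mul.
Proof.
by move=> x y z; apply: residueP => n; rewrite /= modzMml modzMmr mulrA.
Qed.

Lemma padic_mulC : commutative padic_mul.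
Proof. by move=> x y; apply: residueP => n; rewrite /= mulrC. Qed.

Lemma padic_mul1 : left_id padic_one padic_mul.
Proof.
by move=> x; apply: residueP => n; rewrite /= modzMml mul1r residue_mod.
Qed.

Lemma padic_mulDl : left_distributive padic_mul +%R.
Proof.
by move=> x y z; apply: residueP => n; rewrite /= modzMml modzDm mulrDl.
Qed.

Lemma padic_one_neq0 : padic_one != 0.
Proof.
apply/eqP => /(congr1 (fun x : padic_int p_pr => x 1%N)) /=.
by rewrite expn1 !modz_nat !modn_small ?prime_gt0 ?prime_gt1.
Qed.

HB.instance Definition _ := GRing.Zmodule_isComNzRing.Build (padic_int p_pr)
  padic_mulA padic_mulC padic_mul1 padic_mulDl padic_one_neq0.

Definition padic_unit : {pred padic_int p_pr} :=
  fun x => `[< exists y, y * x = 1 >].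

Definition padic_inv x : padic_int p_pr :=
  if pselect (exists y, y * x = 1) is left ex_y then projT1 (cid ex_y) else x.

Lemma padic_mulV : {in padic_unit, left_inverse 1 padic_inv *%R}.
Proof.
by move=> x /asboolP x_unit; rewrite /padic_inv; case: pselect => // ?; case: cid.
Qed.

Lemma padic_unitPl x y : y * x = 1 -> padic_unit x.
Proof. by move=> yx1; apply/asboolP; exists y. Qed.

Lemma padic_inv_out : {in [predC padic_unit], padic_inv =1 id}.
Proof.
by move=> x /asboolPn x_nunit; rewrite /padic_inv; case: pselect.
Qed.

HB.instance Definition _ := GRing.ComNzRing_hasMulInverse.Build
  (padic_int p_pr) padic_mulV padic_unitPl padic_inv_out.

Lemma padic_neq0P x : x != 0 -> exists n, x n != 0.
Proof.
move=> x_neq0; apply: contrapT => /forallNP x0; case/eqP: x_neq0.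
by apply: residueP => n /=; rewrite mod0z; apply/eqP/negPn/negP/x0.
Qed.

Lemma dvdn_mul_pX (a b m n : nat) :
  (p ^ (m + n) %| a * b)%N -> (p ^ m %| a)%N || (p ^ n %| b)%N.
Proof.
case: (posnP a) => [->|a_gt0]; first by rewrite dvdn0.
case: (posnP b) => [->|b_gt0]; first by rewrite dvdn0 orbT.
rewrite !pfactor_dvdn ?muln_gt0 ?a_gt0 // lognM //.
apply: contraTT; rewrite negb_or -!ltnNge => /andP[lt_am lt_bn].
by rewrite -addSn leq_add // ltnW.
Qed.

Lemma padic_idomain : GRing.integral_domain_axiom (padic_int p_pr).
Proof.
move=> x y xy0; apply: contraPT xy0; rewrite negb_or => /andP[].
move=> /padic_neq0P[m xm] /padic_neq0P[n yn].
move=> /(congr1 (fun z : padic_int p_pr => z (m + n)%N)) /=; rewrite mod0z.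
move/dvdz_mod0P; rewrite dvdzE abszM => /dvdn_mul_pX /orP[p_x | p_y].
  by case/eqP: xm; rewrite -(residue_le x (leq_addr n m)); apply/dvdz_mod0P.
by case/eqP: yn; rewrite -(residue_le y (leq_addl m n)); apply/dvdz_mod0P.
Qed.

HB.instance Definition _ :=
  GRing.ComUnitRing_isIntegral.Build (padic_int p_pr) padic_idomain.

End PadicInt.

Definition padic (p : nat) (p_pr : prime p) : fieldType :=
  {fraction padic_int p_pr}.

(** * Realizability *)

(** For [iota : R -> L], the primes above [p] of the integral closure of [R]
    in [L], seen as subsets of [L].  For R = Z or Z_p and p prime, containing
    [p] amounts to lying above the ideal (p) of [R]. *)
Record prime_above (R : nzRingType) (L : fieldType) (iota : R -> L) (p : nat)
    (P : L -> Prop) : Prop := {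
  prime_above_integral : forall x, P x -> integralOver iota x;
  prime_above0 : P 0;
  prime_aboveD : forall x y, P x -> P y -> P (x + y);
  prime_aboveM : forall x y, integralOver iota x -> P y -> P (x * y);
  prime_above1 : ~ P 1;
  prime_above_prime : forall x y, integralOver iota x -> integralOver iota y ->
    P (x * y) -> P x \/ P y;
  prime_above_p : P p%:R
}.

(** [s x - x \in P] for all integral x forces [s] to stabilize [P], so the
    decomposition group needs no separate mention. *)
Definition inertia (R : nzRingType) (F : fieldType) (L : splittingFieldType F)
    (iota : R -> L) (P : L -> Prop) : {set gal_of {:L}} :=
  [set s in 'Gal({:L} / 1)%g
         | `[< forall x : L, integralOver iota x -> P (s x - x) >]].

(** [iota] is the inclusion Z -> Q or Z_p -> Q_p.  Every prime above p of L is
    allowed; in the local case there is only one. *)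
Definition realizable_over (R : nzRingType) (F : fieldType) (iota : R -> F)
    (p : nat) (gT : finGroupType) (G I : {group gT}) : Prop :=
  exists L : splittingFieldType F,
    galois 1 {:L} /\
    exists2 P : L -> Prop, prime_above (fun r => (iota r)%:A) p P &
    exists2 f : {morphism 'Gal({:L} / 1)%g >-> gT},
      isom 'Gal({:L} / 1)%g G f &
      (f @: inertia (fun r => (iota r)%:A) P) = I :> {set gT}.

Definition Q_realizable (gT : finGroupType) (G I : {group gT}) (p : nat) :=
  realizable_over (fun n : int => n%:~R : rat) p G I.

Definition Qp_realizable (p : nat) (p_pr : prime p) (gT : finGroupType)
    (D I : {group gT}) :=
  realizable_over (@tofrac (padic_int p_pr) : _ -> padic p_pr) p D I.

(* Main.v *)
Require Import Defs.
From HB Require Import structures.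
From mathcomp Require Import all_boot all_order all_algebra all_fingroup
  all_solvable all_field.
From mathcomp Require Import boolp.
From mathcomp Require classical_sets mxabelem.
From mathcomp Require Import ring zify.
Import Defs.

Set Implicit Arguments.
Unset Strict Implicit.
Unset Printing Implicit Defensive.

Import Order.TTheory GRing.Theory Num.Theory.
Local Open Scope ring_scope.

(** Suppose that L/Q realizes (G, I, 2), and let F = Q(sqrt d), with d
    squarefree, be the field fixed by I<h^2>.  As I is the whole inertia group at
    2, d = 1 mod 4.  At an odd prime p dividing d, the square roots generating
    the two upper steps of the cyclic octic field fixed by I give an n with
    n^4 = -1 mod p, so p = 1 mod 8.  Hence d = 1 mod 8 and 2 splits in F.  The
    middle step also gives theta in F with theta h(theta) = -1, from which
    nonzero elements of F have the form 2^k e at 2 with e = 1 or -1 mod 4.  The 8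
    characters chi of I with chi(a_2) = chi(a_4) are h^2-invariant, and each
    extends to I<h^2> trivially on h^2, so it is given by the square root of an
    element of F.  There are 4 classes of 2^k e modulo squares and factors 1 mod
    4, so two characters fall in the same class; their quotient is given by the
    square root of an element that is 1 mod 4, and is nontrivial on inertia,
    a contradiction.

    Over Q_2, let z be a root of unity of order 17, K = Q_2(z), which is
    unramified of degree 8, and u_k = (z^(2^k) + z^(-2^k)) (z^(2^(k+1)) +
    z^(-2^(k+1))), so that u_0 u_2 = u_1 u_3 = -1.  No nontrivial product of
    -1, u_0, u_1 is a square modulo 4, hence K(sqrt 2, sqrt -1, sqrt u_0,
    sqrt u_1) is totally ramified over K, of group (C_2)^4, and a lift of the
    Frobenius acts on the signs of the four roots as h does on I. *)

(** The element theta does its work at the odd primes dividing d, where it makes -1 a square. The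
    form 2^k e at 2 rests on the splitting of 2 alone: the completion of F is then Q_2, whose units
    are 1 or -1 modulo 4. No valuation or completion is built. L is kept whole, with its integral
    closure localized at P, and the elements of a suitable subfield are written pi^k e with e a
    unit, so that valuation arguments become statements on k. This form is proved by hand in three
    cases: F at an odd p with pi = sqrt d, F at 2 with pi = 2, and K over Q_2 with pi = 2. Inertia
    and Frobenius elements come from a single fact: two ring morphisms into a domain that agree on
    the invariants of a finite group are conjugate under it. The number 17 is chosen because 2 has
    order 8 modulo 17, so that the Frobenius of K has the order of h. As u_2 = -1/u_0, the Frobenius
    sends sqrt u_0 to sqrt u_1 and sqrt u_1 to sqrt(-1)/sqrt u_0, up to sign. The factor sqrt(-1)
    ties the three signs together as the relation for a_4 requires, while sqrt 2 accounts for
    a_1. *)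

Local Notation Z2 := (padic_int (isT : prime 2)).
Local Notation Q2 := (padic (isT : prime 2)).

(** * Inertia and localization at a prime *)

Section TwoMorphisms.
Variables (A : comNzRingType) (k : idomainType) (phi psi : {rmorphism A -> k}).
Variables (gT : finGroupType) (H : {group gT}) (act : gT -> {rmorphism A -> A}).
Hypothesis act1 : act 1%g =1 id.
Hypothesis actM : {in H &, forall g h x, act (g * h)%g x = act h (act g x)}.
Hypothesis eq_fix :
  forall x, {in H, forall g, act g x = x} -> phi x = psi x.

(* If no [g] works, each [g] has a witness; a polynomial whose coefficients
   are these witnesses is a root of a polynomial with invariant coefficients
   on which [phi] and [psi] agree. *)
Lemma rmorph_conjugate : exists2 g, g \in H & forall x, psi x = phi (act g x).
Proof.
apply: contrapT => /forall2NP noG.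
have /choice[w wP] (g : gT) : exists x, g \in H -> psi x <> phi (act g x).
  case: (noG g) => [gH|/existsNP[x ?]]; last by exists x.
  by exists 0 => /gH.
pose f : {poly A} := \sum_g w g *: 'X^(enum_rank g).
have coef_f g : f`_(enum_rank g) = w g.
  rewrite coef_sum (bigD1 g) //= coefZ coefXn eqxx mulr1 big1 ?addr0 // => h.
  by rewrite coefZ coefXn eq_sym (inj_eq val_inj) (inj_eq enum_rank_inj)
    => /negPf->; rewrite mulr0.
pose F : {poly {poly A}} := \prod_(g in H) ('X - (map_poly (act g) f)%:P).
have mapXsubC (B C : nzRingType) (u : {rmorphism B -> C}) (b : B) :
    map_poly u ('X - b%:P) = 'X - (u b)%:P.
  by rewrite rmorphB /= map_polyX map_polyC.
have F_fix h : h \in H -> map_poly (map_poly (act h)) F = F.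
  move=> hH; rewrite rmorph_prod [RHS](reindex_inj (mulIg h)) /=.
  apply: eq_big => [g|g gH]; first by rewrite groupMr.
  rewrite mapXsubC; congr ('X - _%:P); apply/polyP=> i.
  by rewrite !coef_map /= actM.
have phi_psiF : map_poly (map_poly phi) F = map_poly (map_poly psi) F.
  apply/polyP=> i; apply/polyP=> j; rewrite !coef_map; apply: eq_fix => g gH.
  by rewrite -[in RHS](F_fix g gH) !coef_map.
have F_f : F.[f] = 0.
  have map1 : map_poly (act 1%g) f = f by apply: map_poly_id => x _; rewrite act1.
  by rewrite horner_prod (bigD1 1%g) //= hornerXsubC map1 subrr mul0r.
have : \prod_(g in H) (map_poly psi f - map_poly phi (map_poly (act g) f)) = 0.
  transitivity (map_poly (map_poly phi) F).[map_poly psi f].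
    rewrite rmorph_prod horner_prod; apply: eq_bigr => g _ /=.
    by rewrite mapXsubC hornerXsubC.
  by rewrite phi_psiF horner_map F_f rmorph0.
move/eqP; rewrite prodf_seq_eq0 => /hasP[g _ /andP[gH]].
rewrite subr_eq0 => /eqP/(congr1 (fun p : {poly k} => p`_(enum_rank g))).
by rewrite !coef_map /= coef_f; apply: (wP g gH).
Qed.

End TwoMorphisms.

(** The inverse on the quotient is picked classically; it gives access to [idomainType], the
    structure that [rmorph_conjugate] asks of its target. *)
Lemma residue_domain (A : comNzRingType) (I : prime_idealr A) :
  exists (k : idomainType) (pi : {rmorphism A -> k}),
    forall x, (pi x == 0) = (x \in I).
Proof.
pose Q := {ideal_quot I}.
pose unitQ : {pred Q} := fun x => `[< exists y, y * x = 1 >].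
pose invQ (x : Q) : Q :=
  if pselect (exists y, y * x = 1) is left ex_y then projT1 (cid ex_y) else x.
have mulV : {in unitQ, left_inverse 1 invQ *%R}.
  by move=> x /asboolP x_unit; rewrite /invQ; case: pselect => // ?; case: cid.
have unitP x y : y * x = 1 -> unitQ x by move=> yx1; apply/asboolP; exists y.
have inv_out : {in [predC unitQ], invQ =1 id}.
  by move=> x /asboolPn x_nunit; rewrite /invQ; case: pselect.
pose uM := GRing.ComNzRing_hasMulInverse.Build Q mulV unitP inv_out.
pose uQ : comUnitRingType := HB.pack Q uM.
pose iM := GRing.ComUnitRing_isIntegral.Build uQ (@Quotient.rquot_IdomainAxiom A I).
pose k : idomainType := HB.pack uQ iM.
exists k, (\pi_Q%qT : {rmorphism A -> Q}) => x.
by rewrite -[x in RHS]subr0 Quotient.idealrBE -(rmorph0 (\pi_Q%qT : {rmorphism A -> Q})).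
Qed.

(** * The integral closure as a ring, and its residue domain at a prime *)

Section IntegralClosure.
Variables (R : comNzRingType) (L : fieldType) (iota : {rmorphism R -> L}).

Definition integral_closure : {pred L} := fun x => `[< integralOver iota x >].

Lemma integral_closureP x : reflect (integralOver iota x) (x \in integral_closure).
Proof. exact: asboolP. Qed.

Lemma integral_closure_subring : subring_closed integral_closure.
Proof.
split=> [|x y /integral_closureP xP /integral_closureP yP|x y /integral_closureP xP
  /integral_closureP yP].
- by apply/integral_closureP/integral1.
- by apply/integral_closureP/integral_sub.
- by apply/integral_closureP/integral_mul.
Qed.
HB.instance Definition _ :=
  GRing.isSubringClosed.Build L integral_closure integral_closure_subring.

Record intring := IntRing {intring_val :> L; _ : intring_val \in integral_closure}.
HB.instance Definition _ := [isSub for intring_val].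
HB.instance Definition _ := [Choice of intring by <:].
HB.instance Definition _ := [SubChoice_isSubComNzRing of intring by <:].

Lemma intringP (x : intring) : integralOver iota (val x).
Proof. exact/integral_closureP/(valP x). Qed.

Definition to_intring x (xP : integralOver iota x) : intring :=
  IntRing (introT (integral_closureP x) xP).

Section Prime.
Variables (p : nat) (P : L -> Prop) (abvP : prime_above iota p P).

(** The primality proof is an argument so that the ideal structure, which rests on it, can be
    inferred from the predicate. *)
Definition prime_pred of prime_above iota p P : {pred intring} :=
  fun x => `[< P (val x) >].
Let I := prime_pred abvP.

Lemma prime_predP x : reflect (P (val x)) (x \in I).
Proof. exact: asboolP. Qed.

Lemma prime_aboveN x : P x -> P (- x).
Proof.
move=> Px; rewrite -mulN1r; exact: (prime_aboveM abvP (integral_opp (integral1 iota)) Px).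
Qed.

Lemma prime_aboveB x y : P x -> P y -> P (x - y).
Proof. by move=> Px /prime_aboveN; apply: (prime_aboveD abvP). Qed.

Lemma prime_pred_ideal : idealr_closed I.
Proof.
split; first exact/prime_predP/(prime_above0 abvP).
  exact/prime_predP/(prime_above1 abvP).
move=> a x y /prime_predP Px /prime_predP Py; apply/prime_predP => /=.
exact: (prime_aboveD abvP (prime_aboveM abvP (intringP a) Px) Py).
Qed.
Lemma prime_pred_prime : prime_idealr_closed I.
Proof.
move=> x y /prime_predP /(prime_above_prime abvP (intringP x) (intringP y)).
by case=> ?; apply/orP; [left|right]; apply/prime_predP.
Qed.
HB.instance Definition _ := isIdealr.Build intring (prime_pred abvP) prime_pred_ideal.
HB.instance Definition _ := isPrimeIdealrClosed.Build intring (prime_pred abvP) prime_pred_prime.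

Lemma prime_residue : exists (k : idomainType) (pi : {rmorphism intring -> k}),
  forall x, pi x = 0 <-> P (val x).
Proof.
have [k [pi piP]] := residue_domain (prime_pred abvP).
exists k, pi => x; split=> [/eqP|/prime_predP Px]; first by rewrite piP => /prime_predP.
by apply/eqP; rewrite piP.
Qed.
End Prime.
End IntegralClosure.

(** * Galois action on integers: lifting to inertia and to Frobenius *)

Section GaloisAction.
Variables (R : comNzRingType) (F : fieldType) (L : splittingFieldType F).
Variable iota0 : {rmorphism R -> F}.
Local Notation iota := (in_alg L \o iota0).
Local Notation Gamma := 'Gal({:L} / 1)%g.
Local Notation O := (intring iota).

Lemma gal_integral (g : gal_of {:L}) x :
  integralOver iota x -> integralOver iota (g x).
Proof.
move=> /(integral_rmorph g).
suff: integralOver (g \o iota) (g x) = integralOver iota (g x) by move->.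
rewrite /integralOver; congr ex2; apply: funext => q /=.
by congr (is_true (root _ _)); apply: eq_map_poly => a /=; rewrite rmorph_alg.
Qed.

Definition gal_intring (g : gal_of {:L}) (x : O) : O :=
  to_intring (gal_integral g (intringP x)).

Lemma gal_intring_additive g : zmod_morphism (gal_intring g).
Proof. by move=> x y; apply: val_inj; rewrite /= rmorphB. Qed.
Lemma gal_intring_multiplicative g : monoid_morphism (gal_intring g).
Proof.
by split=> [|x y]; apply: val_inj; rewrite /= ?rmorph1 ?rmorphM.
Qed.
HB.instance Definition _ g :=
  GRing.isZmodMorphism.Build O O (gal_intring g) (gal_intring_additive g).
HB.instance Definition _ g :=
  GRing.isMonoidMorphism.Build O O (gal_intring g) (gal_intring_multiplicative g).

Variables (p : nat) (P : L -> Prop) (abvP : prime_above iota p P).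

Lemma gal_conj_residue (H : {group gal_of {:L}}) (k : idomainType)
    (pi psi : {rmorphism O -> k}) :
  (forall x : O, {in H, forall h : gal_of {:L}, h (val x) = val x} -> pi x = psi x) ->
  exists2 h, h \in H & forall x, psi x = pi (gal_intring h x).
Proof.
move=> fixH; apply: (@rmorph_conjugate _ _ pi psi _ H gal_intring).
- by move=> x; apply: val_inj; rewrite /= gal_id.
- by move=> g h _ _ x; apply: val_inj; rewrite /= galM ?memvf.
- move=> x xH; apply: fixH => h hH.
  by rewrite -[RHS](congr1 val (xH h hH)).
Qed.

(** [pi] and [pi \o tau] agree on the invariants of [H], hence are conjugate by some [h] in [H], and
    [h] then differs from [tau] by inertia. Triviality on the residues of a subfield thus becomes a
    statement about inertia elements of the whole group. *)
Lemma gal_lift_inertia (H : {group gal_of {:L}}) (tau : gal_of {:L}) :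
    (forall x, integralOver iota x -> {in H, forall h : gal_of {:L}, h x = x} ->
       P (tau x - x)) ->
  exists2 h, h \in H &
    forall x, integralOver iota x -> P ((h^-1 * tau)%g x - x).
Proof.
move=> tau_fix; have [k [pi piP]] := prime_residue abvP.
have [|h hH hP] := @gal_conj_residue H k pi (pi \o gal_intring tau).
  move=> x xH; apply/esym/eqP; rewrite /= -subr_eq0 -rmorphB; apply/eqP/piP => /=.
  exact: tau_fix (intringP x) xH.
exists h => // x xO; rewrite galM ?memvf //.
have /eqP := hP (to_intring (gal_integral h^-1%g xO)).
rewrite /= -subr_eq0 -rmorphB => /eqP/piP /=.
by rewrite -[h (_ x)]galM ?memvf // mulVg gal_id.
Qed.

(** By the second hypothesis, [pi] followed by the p-power map of the residue domain agrees with
    [pi] on the Galois invariants, so the two are conjugate. *)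
Lemma exists_frobenius : prime p ->
    (forall x, integralOver iota x -> {in Gamma, forall h : gal_of {:L}, h x = x} ->
       P (x ^+ p - x)) ->
  exists2 tau, tau \in Gamma &
    forall x, integralOver iota x -> P (tau x - x ^+ p).
Proof.
move=> p_pr fix_p; have [k [pi piP]] := prime_residue abvP.
have chp : p \in [pchar k].
  rewrite inE p_pr -(rmorph_nat pi); apply/eqP/piP.
  by rewrite rmorph_nat; apply: prime_above_p abvP.
have [|h hH hP] := @gal_conj_residue 'Gal({:L} / 1)%G k pi (pFrobenius_aut chp \o pi).
  move=> x xH /=; apply/esym/eqP; rewrite pFrobenius_autE -rmorphXn -subr_eq0 -rmorphB.
  by apply/eqP/piP; rewrite rmorphB rmorphXn; apply: fix_p (intringP x) xH.
exists h => // x xO.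
have /eqP := hP (to_intring xO).
rewrite /= pFrobenius_autE -rmorphXn eq_sym -subr_eq0 -rmorphB => /eqP/piP.
by rewrite rmorphB rmorphXn.
Qed.
End GaloisAction.

(** * Existence of primes above p *)

Section PrimeExistence.
Variables (R : comNzRingType) (L : fieldType) (iota : {rmorphism R -> L}).

Lemma exists_prime_above (p : nat) :
    (forall x, integralOver iota x -> p%:R * x <> 1) ->
  exists P, prime_above iota p P.
Proof.
move=> p_nunit.
pose O := integralOver iota.
pose ideal (A : L -> Prop) := [/\ forall x, A x -> O x, A p%:R,
  forall x y, A x -> A y -> A (x + y), forall x y, O x -> A y -> A (x * y) & ~ A 1].
(* Vacuous on the empty set, which is the union of the empty chain. Maximality rules the empty set
   out below, since the multiples of p form a larger ideal. *)
pose Q (A : L -> Prop) := forall x, A x -> ideal A.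
have [F FQ totF|A [QA maxA]] := @classical_sets.Zorn_bigcup L Q.
  move=> z [Z FZ Zz]; have [ZO Zp ZD ZM Z1] := FQ Z FZ z Zz.
  split=> [x [X FX Xx]||x y [X FX Xx] [Y FY Yy]|x y Ox [Y FY Yy]|[X FX X1]].
  - by have [+ _ _ _ _] := FQ X FX x Xx; apply.
  - by exists Z.
  - have [sXY|sYX] := totF X Y FX FY.
      by exists Y => //; have [_ _ + _ _] := FQ Y FY y Yy; apply=> //; apply: sXY.
    by exists X => //; have [_ _ + _ _] := FQ X FX x Xx; apply=> //; apply: sYX.
  - by exists Y => //; have [_ _ _ + _] := FQ Y FY y Yy; apply.
  - by have [_ _ _ _] := FQ X FX 1 X1; apply.
have OM x y : O x -> O y -> O (x * y) by apply: integral_mul.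
have OD x y : O x -> O y -> O (x + y) by apply: integral_add.
have Op : O p%:R by apply: integral_nat.
have O1 : O 1 by apply: integral1.
have O0 : O 0 by apply: integral0.
have [z Az] : exists z, A z.
  apply: contrapT => A0; pose B x := exists2 c, O c & x = p%:R * c.
  apply: (maxA B).
    split=> [x Ax|sBA]; first by case: A0; exists x.
    by apply: A0; exists p%:R; apply: sBA; exists 1; rewrite ?mulr1.
  move=> _ _; split.
  - by move=> _ [c Oc ->]; apply: OM.
  - by exists 1; rewrite ?mulr1.
  - by move=> _ _ [c Oc ->] [d Od ->]; exists (c + d); rewrite ?mulrDr //; apply: OD.
  - by move=> x _ Ox [d Od ->]; exists (x * d); rewrite 1?mulrCA //; apply: OM.
  - by case=> c Oc /esym; apply: p_nunit.
have [AO Ap AD AM A1] := QA z Az.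
have A0 : A 0 by rewrite -(mul0r z); apply: AM.
(* Adjoining [x] to a maximal ideal that does not contain it must produce 1. *)
have max1 x : O x -> ~ A x -> exists a c, [/\ A a, O c & 1 = a + c * x].
  move=> Ox nAx; apply: contrapT => no1.
  pose B y := exists a c, [/\ A a, O c & y = a + c * x].
  apply: (maxA B).
    split=> [a Aa|sBA]; first by exists a, 0; rewrite mul0r addr0.
    by apply: nAx; apply: sBA; exists 0, 1; rewrite mul1r add0r.
  move=> _ _; split.
  - by move=> _ [a [c [Aa Oc ->]]]; apply: OD; [apply: AO | apply: OM].
  - by exists p%:R, 0; rewrite mul0r addr0.
  - move=> _ _ [a [c [Aa Oc ->]]] [b [d [Ab Od ->]]]; exists (a + b), (c + d).
    by split; [apply: AD | apply: OD | rewrite mulrDl addrACA].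
  - move=> y _ Oy [a [c [Aa Oc ->]]]; exists (y * a), (y * c).
    by split; [apply: AM | apply: OM | rewrite mulrDr mulrA].
  - by move=> [a [c [Aa Oc ?]]]; apply: no1; exists a, c.
exists A; split=> // x y Ox Oy Axy.
apply: contrapT => /not_orP[/(max1 x Ox)[a [c [Aa Oc e1]]] /(max1 y Oy)[b [d [Ab Od e2]]]].
apply: A1; rewrite -[1]mulr1 {1}e1 e2.
rewrite (_ : _ * _ = (b + d * y) * a + (c * x * b + c * d * (x * y))); last by ring.
rewrite -e2 mul1r; apply: (AD _ _ Aa); apply: (AD); apply/AM => //; exact: OM.
Qed.

(** A monic equation of degree n for x = 1/p, multiplied by p^n, has leading term 1 and all other
    terms multiples of p in [R]; so p would be invertible in [R]. *)
Lemma natr_integral_nonunit (p : nat) : injective iota ->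
    (forall r : R, p%:R * r <> 1) ->
  forall x, integralOver iota x -> p%:R * x <> 1.
Proof.
move=> inj_iota p_nunit x [q mon_q /rootP qx0] px1.
have [n sz_q] : exists n, size q = n.+1.
  by exists (size q).-1; rewrite prednK // size_poly_gt0 monic_neq0.
have q_n : q`_n = 1 by rewrite -(monicP mon_q) lead_coefE sz_q.
apply: (p_nunit (- \sum_(i < n) q`_i * p%:R ^+ (n.-1 - i))); apply: inj_iota.
rewrite rmorph1 rmorphM rmorph_nat rmorphN mulrN rmorph_sum mulr_sumr /=.
apply/eqP; rewrite eq_sym -addr_eq0; apply/eqP.
rewrite -[RHS](mulr0 (p%:R ^+ n)) -[in RHS]qx0 (@horner_coef_wide _ n.+1); last first.
  by rewrite -sz_q; apply: size_poly.
rewrite big_ord_recr coef_map /= q_n rmorph1 mul1r mulrDr -exprMn px1 expr1n [RHS]addrC /=.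
congr (_ + _); rewrite [RHS]mulr_sumr; apply: eq_bigr => i _.
rewrite coef_map rmorphM rmorphXn rmorph_nat /= mulrCA [RHS]mulrCA; congr (_ * _).
have /(congr1 (GRing.exp (p%:R : L))) : (n = i + (n.-1 - i).+1)%N by have := ltn_ord i; lia.
move=> ->; rewrite exprD mulrAC -exprMn px1 expr1n mul1r -exprS.
by congr (_ ^+ _); have := ltn_ord i; lia.
Qed.
End PrimeExistence.

(** * The local ring of L at P and its maximal ideal *)

Section Localization.
Variables (R : comNzRingType) (L : fieldType) (iota : {rmorphism R -> L}).
Variables (p : nat) (P : L -> Prop) (abvP : prime_above iota p P).
Local Notation isint := (integralOver iota).

(** Localizing makes everything outside the maximal ideal invertible, so that residues can be
    compared after division. The proof argument again serves to attach the subring structure. *)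
Definition local_ring of prime_above iota p P : {pred L} := fun x =>
  `[< exists a b, [/\ isint a, isint b, ~ P b & x = a / b] >].
Definition local_max of prime_above iota p P : {pred L} := fun x =>
  `[< exists a b, [/\ P a, isint b, ~ P b & x = a / b] >].
Local Notation O := (local_ring abvP).
Local Notation M := (local_max abvP).

Lemma not_prime_neq0 b : ~ P b -> b != 0.
Proof. by move=> nPb; apply/eqP=> b0; apply: nPb; rewrite b0; case: abvP. Qed.

Lemma not_primeM a b : isint a -> isint b -> ~ P a -> ~ P b -> ~ P (a * b).
Proof. by move=> aZ bZ nPa nPb /(prime_above_prime abvP aZ bZ)[]. Qed.

Lemma primeM a b : P a -> isint b -> P (a * b).
Proof. by move=> Pa bZ; rewrite mulrC; apply: (prime_aboveM abvP). Qed.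

Lemma local_ringP x :
  reflect (exists a b, [/\ isint a, isint b, ~ P b & x = a / b]) (x \in O).
Proof. exact: asboolP. Qed.
Lemma local_maxP x :
  reflect (exists a b, [/\ P a, isint b, ~ P b & x = a / b]) (x \in M).
Proof. exact: asboolP. Qed.

Lemma local_ring_subring : subring_closed O.
Proof.
split=> [|_ _ /local_ringP[a [b [aZ bZ nPb ->]]] /local_ringP[c [d [cZ dZ nPd ->]]]
  |_ _ /local_ringP[a [b [aZ bZ nPb ->]]] /local_ringP[c [d [cZ dZ nPd ->]]]].
- apply/local_ringP; exists 1, 1; rewrite divr1; split=> //; try exact: integral1.
  exact: (prime_above1 abvP).
- have b0 := not_prime_neq0 nPb; have d0 := not_prime_neq0 nPd.
  apply/local_ringP; exists (a * d - c * b), (b * d); split.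
  + by apply: integral_sub; apply: integral_mul.
  + exact: integral_mul.
  + exact: not_primeM.
  + by field; rewrite b0 d0.
- have b0 := not_prime_neq0 nPb; have d0 := not_prime_neq0 nPd.
  apply/local_ringP; exists (a * c), (b * d); split.
  + exact: integral_mul.
  + exact: integral_mul.
  + exact: not_primeM.
  + by field; rewrite b0 d0.
Qed.
HB.instance Definition _ :=
  GRing.isSubringClosed.Build L (local_ring abvP) local_ring_subring.

Lemma local_maxW x : x \in M -> x \in O.
Proof.
move/local_maxP=> [a [b [Pa bZ nPb ->]]]; apply/local_ringP; exists a, b; split=> //.
exact: (prime_above_integral abvP).
Qed.

Lemma local_maxM x y : x \in O -> y \in M -> x * y \in M.
Proof.
move=> /local_ringP[a [b [aZ bZ nPb ->]]] /local_maxP[c [d [Pc dZ nPd ->]]].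
have b0 := not_prime_neq0 nPb; have d0 := not_prime_neq0 nPd.
apply/local_maxP; exists (a * c), (b * d); split.
- exact: (prime_aboveM abvP).
- exact: integral_mul.
- exact: not_primeM.
- by field; rewrite b0 d0.
Qed.

Lemma local_maxMl x y : x \in M -> y \in O -> x * y \in M.
Proof. by move=> xM yO; rewrite mulrC local_maxM. Qed.

Lemma local_maxD x y : x \in M -> y \in M -> x + y \in M.
Proof.
move=> /local_maxP[a [b [Pa bZ nPb ->]]] /local_maxP[c [d [Pc dZ nPd ->]]].
have b0 := not_prime_neq0 nPb; have d0 := not_prime_neq0 nPd.
apply/local_maxP; exists (a * d + c * b), (b * d); split.
- by apply: (prime_aboveD abvP); apply: primeM.
- exact: integral_mul.
- exact: not_primeM.
- by field; rewrite b0 d0.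
Qed.

Lemma local_maxN x : x \in M -> - x \in M.
Proof. by move=> xM; rewrite -mulN1r local_maxM ?rpredN1. Qed.

Lemma local_maxB x y : x \in M -> y \in M -> x - y \in M.
Proof. by move=> xM /local_maxN; apply: local_maxD. Qed.

Lemma integral_local x : isint x -> x \in O.
Proof.
move=> xZ; apply/local_ringP; exists x, 1; rewrite divr1; split=> //; first exact: integral1.
exact: (prime_above1 abvP).
Qed.

Lemma integral_local_max x : isint x -> x \in M <-> P x.
Proof.
move=> xZ; split=> [/local_maxP[a [b [Pa bZ nPb eq_x]]]|Px].
  have : P (x * b) by rewrite eq_x divfK // not_prime_neq0.
  by case/(prime_above_prime abvP xZ bZ).
apply/local_maxP; exists x, 1; rewrite divr1; split=> //; first exact: integral1.
exact: (prime_above1 abvP).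
Qed.

Lemma local_max1 : 1 \notin M.
Proof.
by apply/negP=> /(integral_local_max (integral1 iota)).1; apply: (prime_above1 abvP).
Qed.

Lemma local_max0 : 0 \in M.
Proof. exact/(integral_local_max (integral0 iota))/(prime_above0 abvP). Qed.

Lemma local_max_p : p%:R \in M.
Proof. exact/(integral_local_max (integral_nat iota p))/(prime_above_p abvP). Qed.

Lemma local_ringV x : x \in O -> x \notin M -> x^-1 \in O.
Proof.
move=> /local_ringP[a [b [aZ bZ nPb ->]]] nM.
apply/local_ringP; exists b, a; split=> //; last by rewrite invf_div.
by move=> Pa; case/negP: nM; apply/local_maxP; exists a, b.
Qed.

Definition local_unit : {pred L} := [pred x | (x \in O) && (x \notin M)].

Lemma local_unitO x : x \in local_unit -> x \in O. Proof. by case/andP. Qed.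
Lemma local_unit_max x : x \in local_unit -> x \notin M. Proof. by case/andP. Qed.
Lemma local_unit_neq0 x : x \in local_unit -> x != 0.
Proof. by case/andP=> _; apply: contraNneq => ->; apply: local_max0. Qed.

Lemma local_unitP x : reflect [/\ x != 0, x \in O & x^-1 \in O] (x \in local_unit).
Proof.
apply: (iffP idP) => [xU|[x0 xO xVO]].
  by have /andP[xO xM] := xU; rewrite local_unit_neq0 // local_ringV.
rewrite inE xO; apply: contraNN local_max1 => xM.
by rewrite -(divff x0) local_maxMl.
Qed.

Lemma local_unit1 : 1 \in local_unit. Proof. by rewrite inE rpred1 local_max1. Qed.
Lemma local_unitV x : x \in local_unit -> x^-1 \in local_unit.
Proof. by case/local_unitP=> *; apply/local_unitP; rewrite invr_eq0 invrK. Qed.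
Lemma local_unitM x y : x \in local_unit -> y \in local_unit -> x * y \in local_unit.
Proof.
move=> /local_unitP[x0 xO xV] /local_unitP[y0 yO yV]; apply/local_unitP.
by rewrite mulf_neq0 // invfM !rpredM.
Qed.
Lemma local_unitN x : x \in local_unit -> - x \in local_unit.
Proof. by case/local_unitP=> *; apply/local_unitP; rewrite oppr_eq0 invrN !rpredN. Qed.
Lemma local_unitX x n : x \in local_unit -> x ^+ n \in local_unit.
Proof.
move=> xU; elim: n => [|n IHn]; first exact: local_unit1.
by rewrite exprS local_unitM.
Qed.

Lemma local_max_unit x y : y \in local_unit -> (x * y \in M) = (x \in M).
Proof.
move=> yU; apply/idP/idP => [|xM]; last by rewrite local_maxMl // local_unitO.
move/local_maxMl => /(_ _ (local_unitO (local_unitV yU))).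
by rewrite mulfK // local_unit_neq0.
Qed.

Lemma local_max_prime x y : x \in O -> y \in O -> x * y \in M -> (x \in M) || (y \in M).
Proof.
move=> xO yO xyM; case: (boolP (y \in M)) => [_|yM]; first by rewrite orbT.
by rewrite -(@local_max_unit x y) ?xyM // inE yO.
Qed.

Lemma local_max_sqr x : x \in O -> x ^+ 2 \in M -> x \in M.
Proof. by move=> xO /(local_max_prime xO xO); rewrite orbb. Qed.

Lemma local_unit_congr x y : x \in local_unit -> y - x \in M -> y \in local_unit.
Proof.
move=> /andP[xO xM] yxM; have yO : y \in O by rewrite -[y](subrK x) rpredD // local_maxW.
rewrite inE yO /=.
apply: contra xM => yM; by rewrite -[x](subKr y) local_maxB.
Qed.

Lemma local_max_expz (pi : L) (k : int) : pi \in M -> 0 < k -> pi ^ k \in M.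
Proof.
case: k => [[|k]|] // piM _; rewrite -exprnP exprS local_maxMl // rpredX //.
exact: local_maxW.
Qed.

(** This replaces the valuation: once an element is written [pi ^ k * e], its position with respect
    to [O], [M] and the units is read off [k]. *)
Lemma local_unit_expz (pi e : L) (k : int) : pi != 0 -> pi \in M -> e \in local_unit ->
  [/\ (pi ^ k * e \in O) = (0 <= k), (pi ^ k * e \in M) = (0 < k)
    & (pi ^ k * e \in local_unit) = (k == 0)].
Proof.
move=> pi0 piM eU; have eO := local_unitO eU.
have pO n : pi ^+ n \in O by rewrite rpredX // local_maxW.
have [k_gt0|k_lt0|->] := ltrgt0P k; last first.
- by rewrite expr0z mul1r eO eU (negPf (local_unit_max eU)).
- have k'M : pi ^ (- k) \in M by rewrite local_max_expz // oppr_gt0.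
  suff nO : pi ^ k * e \notin O.
    by rewrite inE (negPf nO) (contraNF (@local_maxW _)).
  apply: contra (local_unit_max eU) => kO.
  by rewrite -[e]mul1r -(expr0z pi) -(addNr k) exprzDr ?unitfE // -mulrA local_maxMl.
- have kM : pi ^ k \in M by rewrite local_max_expz.
  have keM : pi ^ k * e \in M by rewrite local_maxMl.
  by rewrite keM inE keM local_maxW //= andbF gt_eqF // ltW.
Qed.

(** With denominators [b] and [d] of the coefficients, [b * d * x] is a root of a monic quadratic
    with integral coefficients. Integral closedness is needed only for square roots and for elements
    (1 + w) / 2. *)
Lemma local_monic2 x t c : t \in O -> c \in O -> x ^+ 2 - t * x - c = 0 -> x \in O.
Proof.
move=> /local_ringP[a [b [aZ bZ nPb eq_t]]] /local_ringP[c1 [d [cZ dZ nPd eq_c]]] eq_x.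
have b0 := not_prime_neq0 nPb; have d0 := not_prime_neq0 nPd.
apply/local_ringP; exists (b * d * x), (b * d); split; last 1 first.
- by rewrite mulrC mulKf // mulf_neq0.
- pose q : {poly L} := 'X^2 - (a * d) *: 'X - (b ^+ 2 * d * c1)%:P.
  have sz : (size (- ((a * d) *: 'X) - (b ^+ 2 * d * c1)%:P)%R < 3)%N.
    rewrite (leq_ltn_trans (size_polyD _ _)) // gtn_max !size_polyN.
    by rewrite (leq_ltn_trans (size_scale_leq _ _)) ?size_polyX //
      (leq_ltn_trans (size_polyC_leq1 _)).
  apply: (@integral_root_monic _ _ iota _ q).
  + by rewrite monicE /q -addrA lead_coefDl ?size_polyXn // lead_coefXn.
  + rewrite /root /q !hornerE /=; apply/eqP.
    transitivity (b ^+ 2 * d ^+ 2 * (x ^+ 2 - t * x - c)); last by rewrite eq_x mulr0.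
    by rewrite eq_t eq_c /=; field; rewrite b0 d0.
  + apply/(integral_poly iota q) => i; rewrite /q !coefB coefXn coefZ coefX coefC.
    have i0 := integral0 iota; have i1 := integral1 iota.
    apply: integral_sub; first apply: integral_sub.
    * by case: eqP.
    * by apply: integral_mul; [apply: integral_mul | case: eqP].
    * by case: eqP => // _; rewrite expr2; do !apply: integral_mul.
- exact: integral_mul.
- exact: not_primeM.
Qed.

Variable g : {rmorphism L -> L}.
Hypothesis g_int : forall x, isint x -> isint (g x).

Lemma local_inertia : (forall x, isint x -> P (g x - x)) ->
  {in O, forall x, g x - x \in M}.
Proof.
move=> gP _ /local_ringP[a [b [aZ bZ nPb ->]]].
have nPgb : ~ P (g b).
  by move=> Pgb; apply: nPb; rewrite -(subKr (g b) b); apply: prime_aboveB abvP _ _ Pgb (gP _ bZ).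
have b0 := not_prime_neq0 nPb; have gb0 := not_prime_neq0 nPgb.
apply/local_maxP; exists ((g a - a) * b - (g b - b) * a), (g b * b); split.
- by apply: (prime_aboveB abvP); apply: primeM => //; apply: gP.
- by apply: integral_mul => //; apply: g_int.
- by apply: not_primeM => //; apply: g_int.
- by rewrite fmorph_div; field; rewrite b0 gb0.
Qed.

Lemma local_stable : (forall x, isint x -> P (g x) <-> P x) ->
  {in O, forall x, g x \in O}.
Proof.
move=> gP _ /local_ringP[a [b [aZ bZ nPb ->]]].
apply/local_ringP; exists (g a), (g b); split; rewrite ?fmorph_div //; try exact: g_int.
by move/(gP _ bZ).
Qed.
End Localization.

(** * The group *)

Section GroupModel.
Local Open Scope group_scope.

(** Bundles the hypotheses so that they can be moved between [G] and Galois groups: into Gal(L/Q)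
    for the nonexistence, and matched with Gal(L/Q_2) for the existence. *)
Record wang_model (gT : finGroupType) (G I : {group gT}) (a1 a2 a3 a4 h : gT) :
    Prop := WangModel {
  wang_abelem : 2.-abelem I;
  wang_card : #|I| = 16;
  wang_gen : I = <<[set a1; a2; a3; a4]>> :> {set gT};
  wang_order : #[h] = 8;
  wang_sdprod : I ><| <[h]> = G;
  wang_a1 : h * a1 * h^-1 = a1;
  wang_a2 : h * a2 * h^-1 = a3;
  wang_a3 : h * a3 * h^-1 = a4;
  wang_a4 : h * a4 * h^-1 = a2 * a3 * a4
}.

Lemma abelem_coordinates (gT : finGroupType) (I : {group gT}) (a1 a2 a3 a4 : gT) :
    2.-abelem I -> #|I| = 16 -> I = <<[set a1; a2; a3; a4]>> :> {set gT} ->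
  exists2 psi : {morphism [set: 'rV['F_2]_4] >-> gT}, isom [set: 'rV['F_2]_4] I psi &
    [/\ psi (delta_mx 0 0) = a1, psi (delta_mx 0 (inord 1)) = a2,
        psi (delta_mx 0 (inord 2)) = a3 & psi (delta_mx 0 (inord 3)) = a4].
Proof.
move=> abI cardI genI; have [_ cII expI] := and3P abI.
have sq x : x \in I -> x ^+ 2 = 1 by move/(exponentP expI).
have aI : [/\ a1 \in I, a2 \in I, a3 \in I & a4 \in I].
  by rewrite genI; split; apply: mem_gen; rewrite !inE eqxx ?orbT.
have [a1I a2I a3I a4I] := aI.
pose a (i : 'I_4) := nth 1 [:: a1; a2; a3; a4] i.
have aiI i : a i \in I by case: i; do 4!case=> //.
pose f (v : 'rV['F_2]_4) := \prod_(i < 4) a i ^+ v 0 i.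
have fI v : f v \in I by apply: group_prod => i _; rewrite groupX.
have fM : {in [set: 'rV['F_2]_4] &, {morph f : u v / u * v}}.
  move=> u v _ _; rewrite /f !big_ord_recl !big_ord0 !mulg1.
  have cI x y : x \in I -> y \in I -> commute x y by move=> xI yI; apply: (centsP cII).
  have eD i : a i ^+ ((u + v)%R 0%R i) = a i ^+ (u 0%R i) * a i ^+ (v 0%R i).
    rewrite -expgD !mxE /=.
    by rewrite -[RHS](expg_mod _ (sq _ (aiI i))).
  have swap x y z t : x \in I -> y \in I -> z \in I -> t \in I -> x * y * (z * t) = x * z * (y * t).
    by move=> *; rewrite -!mulgA; congr (_ * _); rewrite !mulgA (cI y z).
  rewrite !eD.
  do 3!(rewrite [RHS]swap ?groupM ?groupX ?aiI //; congr (_ * _)).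
pose psi := Morphism fM.
have psi_delta i : psi (delta_mx 0 i) = a i.
  rewrite -[LHS]/(f (delta_mx 0 i)%R) /f !big_ord_recl big_ord0 !mxE -!val_eqE /= /bump /=.
  by case: i => [[|[|[|[|//]]]] lti]; rewrite /= ?mulg1 ?mul1g.
have im_psi : psi @* setT = I.
  apply/eqP; rewrite eqEsubset; apply/andP; split.
    by apply/subsetP=> _ /morphimP[v _ _ ->]; apply: fI.
  rewrite genI gen_subG; apply/subsetP=> x; rewrite !inE -!orbA.
  have imd i : a i \in psi @* setT by rewrite -psi_delta mem_morphim ?inE.
  case/or4P=> /eqP->; [exact: (imd (Ordinal (isT : 0 < 4)%N))
    |exact: (imd (Ordinal (isT : 1 < 4)%N))|exact: (imd (Ordinal (isT : 2 < 4)%N))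
    |exact: (imd (Ordinal (isT : 3 < 4)%N))].
exists psi.
  apply/isomP; split=> //; apply/injmP/imset_injP.
  by rewrite -morphimEdom im_psi cardI cardsT card_mx card_Fp.
by split; rewrite psi_delta /a ?inordK.
Qed.

Lemma abelem_isom (gT rT : finGroupType) (I : {group gT}) (J : {group rT})
    (a1 a2 a3 a4 : gT) (b1 b2 b3 b4 : rT) :
    2.-abelem I -> #|I| = 16 -> I = <<[set a1; a2; a3; a4]>> :> {set gT} ->
    2.-abelem J -> #|J| = 16 -> J = <<[set b1; b2; b3; b4]>> :> {set rT} ->
  exists2 f : {morphism I >-> rT}, isom I J f &
    [/\ f a1 = b1, f a2 = b2, f a3 = b3 & f a4 = b4].
Proof.
move=> abI cI gI abJ cJ gJ.
have [phi /isomP[inj_phi im_phi] [<- <- <- <-]] := abelem_coordinates abI cI gI.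
have [psi /isomP[inj_psi im_psi] [<- <- <- <-]] := abelem_coordinates abJ cJ gJ.
pose f := [morphism of psi \o invm inj_phi].
have dI : I = phi @* setT :> {set gT} by rewrite im_phi.
have sI : I \subset 'dom f.
  by rewrite /dom /= dI; apply/subsetP=> _ /morphimP[x _ xT ->]; rewrite !inE mem_morphim //= invmE.
exists [morphism of restrm sI f].
  apply/isomP; split.
    by rewrite injm_restrm // injm_comp ?injm_invm.
  rewrite im_restrm morphim_comp dI im_invm; exact: im_psi.
by split; rewrite /= /restrm /= invmE ?inE.
Qed.

Lemma morph_conj_gen (gT rT : finGroupType) (I : {group gT}) (A : {set gT})
    (f : {morphism I >-> rT}) (t : gT) (s : rT) :
    I = <<A>> :> {set gT} -> t \in 'N(I) ->
    {in A, forall x, f (x ^ t) = f x ^ s} ->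
  forall n, {in I, forall x, f (x ^ (t ^+ n)) = f x ^ (s ^+ n)}.
Proof.
move=> genI nIt fA.
have nI x : x \in I -> x ^ t \in I by move=> xI; rewrite memJ_norm.
have step x : x \in I -> f (x ^ t) = f x ^ s.
  suff sI : I \subset [set x in I | f (x ^ t) == f x ^ s].
    by move/(subsetP sI); rewrite inE => /andP[_ /eqP].
  clear x; have grp : group_set [set x in I | f (x ^ t) == f x ^ s].
    apply/group_setP; split; first by rewrite inE group1 conj1g morph1 conj1g eqxx.
    move=> x y; rewrite !inE => /andP[xI /eqP ex] /andP[yI /eqP ey].
    rewrite groupM // conjMg (morphM f (nI x xI) (nI y yI)).
    by rewrite (morphM f xI yI) conjMg ex ey eqxx.
  apply: (@subset_trans _ _ (mem <<A>>)); first by rewrite -genI.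
  rewrite (gen_subG _ (Group grp)) /=; apply/subsetP=> x xA.
  by rewrite inE (fA x xA) eqxx andbT genI mem_gen.
elim=> [|n IHn] x xI; first by rewrite !expg0 !conjg1.
by rewrite !expgS !conjgM IHn ?nI // step.
Qed.

(** Matching the bases gives an isomorphism of the normal factors, the four relations make it
    equivariant on generators, and both extensions split. *)
Lemma wang_model_isom (gT rT : finGroupType) (G I : {group gT}) (G' I' : {group rT})
    a1 a2 a3 a4 h b1 b2 b3 b4 k :
    wang_model G I a1 a2 a3 a4 h -> wang_model G' I' b1 b2 b3 b4 k ->
  exists2 f : {morphism G >-> rT}, isom G G' f & f @: I = I' :> {set rT}.
Proof.
move=> [abI cI gI oh sdG ha1 ha2 ha3 ha4] [abJ cJ gJ ok sdG' kb1 kb2 kb3 kb4].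
have [fI /isomP[inj_fI im_fI] [f1 f2 f3 f4]] := abelem_isom abI cI gI abJ cJ gJ.
have [_ _ nIh _] := sdprodP sdG; have [_ _ nJk _] := sdprodP sdG'.
(* The conjugate [x ^ t] is [t^-1 * x * t], so the relations describe conjugation by [h^-1]; the
   cyclic factor is therefore generated by [h^-1]. *)
have ohV : #[h^-1] = 8 by rewrite orderV.
have okV : #[k^-1] = 8 by rewrite orderV.
have dvd : (#[k^-1] %| #[h^-1])%N by rewrite ohV okV.
pose fH := eltm dvd.
have [a1I a2I a3I a4I] : [/\ a1 \in I, a2 \in I, a3 \in I & a4 \in I].
  by rewrite gI; split; apply: mem_gen; rewrite !inE eqxx ?orbT.
have stepX n x : x \in I -> fI (x ^ (h^-1 ^+ n)) = fI x ^ (k^-1 ^+ n).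
  apply: (morph_conj_gen gI) => [|u uA]; first by rewrite groupV -cycle_subG.
  have aP x' y : h * x' * h^-1 = y -> k * fI x' * k^-1 = fI y -> fI (x' ^ h^-1) = fI x' ^ k^-1.
    by move=> hx kx; rewrite !conjgE !invgK !mulgA hx kx.
  move: uA => /setUP[/setUP[/setUP[|]|]|] /set1P->.
  - by apply: aP ha1 _; rewrite f1.
  - by apply: aP ha2 _; rewrite f2 f3.
  - by apply: aP ha3 _; rewrite f3 f4.
  - by apply: aP ha4 _; rewrite !morphM ?groupM // f2 f3 f4.
have sdV : I ><| <[h^-1]> = G by rewrite cycleV.
have actf : {in I & <[h^-1]>, morph_act 'J 'J fI fH}.
  by move=> x _ xI /cycleP[n ->]; rewrite /= stepX // /fH eltmE.
pose f := sdprodm sdV actf.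
have im_fH : fH @* <[h^-1]> = <[k^-1]> by rewrite im_eltm.
exists f.
  apply/isomP; split.
    rewrite injm_sdprodm inj_fI injm_eltm ohV okV dvdnn /= im_fI im_fH cycleV.
    by have [_ _ _ ->] := sdprodP sdG'.
  rewrite im_sdprodm im_fI im_fH cycleV; by have [_ <- _ _] := sdprodP sdG'.
rewrite -im_fI morphimEdom; apply: eq_in_imset => x xI.
exact: sdprodmEl.
Qed.
End GroupModel.

(** * Nonexistence over Q *)

Section Arithmetic.

(** The class of [n] has order exactly 8 modulo p, its fourth power being -1, which differs from 1;
    hence 8 divides p - 1. *)
Lemma prime_dvd_biquadratic_succ (p : nat) (n : int) : prime p -> odd p ->
  (p %| n ^+ 4 + 1)%Z -> (p %% 8)%N = 1%N.
Proof.
move=> p_pr p_odd dvd_p; pose x : 'F_p := n%:~R.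
have x4 : x ^+ 4 = -1.
  apply/eqP; rewrite -subr_eq0 opprK; apply/eqP.
  have /dvdzP[m] := dvd_p; move/(congr1 (fun z : int => z%:~R : 'F_p)).
  rewrite rmorphD rmorphXn /= rmorph1 => ->.
  by rewrite intrM -pmulrn pchar_Fp_0 // mulr0.
have two0 : (2%:R : 'F_p) != 0.
  rewrite -(dvdn_pcharf (pchar_Fp p_pr)) dvdn_prime2 //.
  by apply: contraTneq p_odd => ->.
have x8 : x ^+ 8 = 1 by rewrite (exprM x 4 2) x4 sqrrN expr1n.
have [m m_prim m_dvd] := prim_order_exists (isT : (0 < 8)%N) x8.
have m4 : ~~ (m %| 4)%N.
  rewrite (prim_order_dvd m_prim) x4; apply: contra two0.
  by rewrite eq_sym -addr_eq0 -mulr2n.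
have {m_dvd m4} m8 : m = 8%N.
  have : m \in divisors 8 by rewrite -dvdn_divisors.
  by rewrite !inE => /or4P[]/eqP m_eq //; rewrite m_eq in m4.
rewrite m8 in m_prim; have x0 : x != 0.
  by apply/eqP=> x0; move/eqP: x8; rewrite x0 expr0n /= eq_sym oner_eq0.
have : x ^+ p.-1 = 1.
  apply: (mulIf x0); rewrite -exprSr prednK ?prime_gt0 // mul1r.
  by have := expf_card x; rewrite card_Fp.
move/eqP; rewrite -(prim_order_dvd m_prim) => /dvdnP[k def_p].
by rewrite -(prednK (prime_gt0 p_pr)) def_p; lia.
Qed.

Lemma prime_divisors_mod8 (m : nat) : (0 < m)%N ->
  (forall p, prime p -> (p %| m)%N -> (p %% 8)%N = 1%N) -> (m %% 8)%N = 1%N.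
Proof.
have [n] := ubnP m; elim: n m => // n IHn m le_mn m_gt0 mP.
have [m_gt1|] := ltnP 1 m; last by case: m m_gt0 {mP le_mn} => [|[]].
have /dvdnP[k def_m] := pdiv_dvd m; have q_pr := pdiv_prime m_gt1.
have q1 := mP _ q_pr (pdiv_dvd m); have q_gt1 := prime_gt1 q_pr.
have k1 : (k %% 8)%N = 1%N.
  apply: IHn => [||p p_pr p_k]; [nia | nia |].
  by apply: mP => //; rewrite def_m dvdn_mulr.
by rewrite def_m -modnMm k1 q1.
Qed.

(** The prime divisors only determine the absolute value modulo 8; the residue of [d] modulo 4
    settles its sign. *)
Lemma prime_divisors_intmod8 (d : int) : d != 0 -> (d %% 4)%Z = 1 ->
  (forall p : nat, prime p -> odd p -> (p %| d)%Z -> (p %% 8)%N = 1%N) ->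
  (d %% 8)%Z = 1.
Proof.
move=> d0 d4 dP.
have : (`|d| %% 8)%N = 1%N.
  apply: prime_divisors_mod8 => [|p p_pr p_d]; first by rewrite absz_gt0.
  apply: dP => //; apply: contraLR p_d; rewrite -dvdn2 => p2.
  have -> : p = 2%N by apply/eqP; rewrite eq_sym -dvdn_prime2.
  lia.
lia.
Qed.

(** Modulo 4 the odd square [B ^+ 2] is 1, so [d] is congruent to a square, that is to 0 or 1, and 0
    is excluded. *)
Lemma squarefree_mod4 (A B d : int) : ~~ (4 %| d)%Z -> ~~ (2 %| B)%Z ->
  (4 %| A ^+ 2 - B ^+ 2 * d)%Z -> (d %% 4)%Z = 1.
Proof.
move=> d4 B2 /dvdzP[q eq_q].
have [b eq_B] : exists b, B = b * 2 + 1 by exists (B %/ 2)%Z; lia.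
have : exists a, A = a * 2 \/ A = a * 2 + 1 by exists (A %/ 2)%Z; lia.
case=> a [] eq_A; rewrite eq_A eq_B in eq_q; clear -eq_q d4;
  [suff : d = 4 * (a ^+ 2 - q - (b ^+ 2 + b) * d) by lia | suff : d = 4
  * (a ^+ 2 + a - q - (b ^+ 2 + b) * d) + 1 by lia].
- by rewrite !expr2 in eq_q *; lia.
- by rewrite !expr2 in eq_q *; lia.
Qed.

End Arithmetic.

(** * Fixed fields and square roots generating quadratic steps *)

Section GaloisTools.
Variables (F : fieldType) (L : splittingFieldType F).
Implicit Types (g h : gal_of {:L}) (x : L).

Lemma gal_comp g h x : h (g x) = (g * h)%g x.
Proof. by rewrite galM ?memvf. Qed.

Lemma fixedP (A : {set gal_of {:L}}) x :
  reflect {in A, forall g, g x = x} (x \in fixedField A).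
Proof. by apply: fixedFieldP; rewrite memvf. Qed.

Lemma fixed_scalar x : galois 1 {:L} -> x \in fixedField 'Gal({:L} / 1)%g ->
  exists a, x = a%:A.
Proof. by move/galois_fixedField->; move/vlineP. Qed.

Lemma fixedField_join (I : {group gal_of {:L}}) g x :
  (x \in fixedField (I <*> <[g]>)%g) = (x \in fixedField I) && (g x == x).
Proof.
apply/fixedP/andP=> [xP|[/fixedP xI /eqP gx]].
  split; first by apply/fixedP => h hI; apply: xP; rewrite (subsetP (joing_subl _ _)).
  by apply/eqP/xP; rewrite (subsetP (joing_subr _ _)) ?cycle_id.
have stab : group_set [set h : gal_of {:L} | h x == x].
  apply/group_setP; split=> [|u v]; first by rewrite inE gal_id.
  by rewrite !inE galM ?memvf // => /eqP-> /eqP->.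
suff /subsetP sub : (I <*> <[g]> \subset Group stab)%g by move=> h /sub; rewrite inE => /eqP.
rewrite join_subG cycle_subG /= inE gx eqxx andbT.
by apply/subsetP=> h /xI hx; rewrite inE hx.
Qed.

Lemma fixedField_stable (A : {set gal_of {:L}}) g x :
  g \in 'N(A)%g -> x \in fixedField A -> g x \in fixedField A.
Proof.
move=> nAg /fixedP xA; apply/fixedP=> a aA.
have ag : (g * a * g^-1)%g \in A by rewrite -{1}[g]invgK -mulgA -conjgE memJ_norm ?groupV.
by rewrite gal_comp -[(g * a)%g](mulgKV g) -gal_comp xA.
Qed.

(** If [z] is fixed by [M] and moved by [j] in [J], then [z - j z] changes sign under [j], because
    [j ^+ 2] lies in [M]; the rest of [J :\: M] is a coset of [M]. *)
Lemma galois_quadratic (M J : {group gal_of {:L}}) :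
    M \subset J -> #|J : M|%g = 2%N ->
  exists y, [/\ y != 0, y \in fixedField M & {in J :\: M, forall g, g y = - y}].
Proof.
move=> sMJ idx; have nMJ := index2_normal sMJ idx.
have [z zM [j jJ jz]] : exists2 z, z \in fixedField M & exists2 j, j \in J & j z != z.
  apply: contrapT => noz.
  have : J \subset M.
    rewrite -(gal_fixedField M).
    apply: subset_trans (galois_connection_subset J) _; apply: galS.
    apply/subvP=> z zM; apply/fixedP=> j jJ.
    by apply/eqP/negPn/negP=> jz; apply: noz; exists z => //; exists j.
  by rewrite -indexg_eq1 idx.
have zP := fixedP _ _ zM.
have jM : j \notin M by apply: contra jz => /zP->.
have nMj : j \in 'N(M)%g by apply: (subsetP (normal_norm nMJ)).
have jzM : j z \in fixedField M by apply: fixedField_stable.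
have yM : z - j z \in fixedField M by rewrite rpredB.
have jJM : j \in J :\: M by rewrite inE jM.
have j2M : (j * j)%g \in M.
  apply: contraT => j2M; have : (j * j)%g \in J :\: M by rewrite inE j2M groupM.
  by rewrite -(rcoset_index2 sMJ idx jJM) mem_rcoset mulgK (negPf jM).
exists (z - j z); split=> // [|g]; first by rewrite subr_eq0 eq_sym.
rewrite -(rcoset_index2 sMJ idx jJM) => /rcosetP[m mM ->].
by rewrite -gal_comp (fixedP _ _ yM m mM) rmorphB /= gal_comp (zP _ j2M) opprB.
Qed.
End GaloisTools.

Section WangModelFacts.
Local Open Scope group_scope.
Variables (gT : finGroupType) (G I : {group gT}) (a1 a2 a3 a4 h : gT).
Hypothesis mG : wang_model G I a1 a2 a3 a4 h.

Lemma wang_norm : h \in 'N(I).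
Proof.
by have [_ _ + _] := sdprodP (wang_sdprod mG); rewrite cycle_subG.
Qed.

Lemma wang_card_join k : (k %| 8)%N -> #|I <*> <[h ^+ k]>| = (16 * (8 %/ k))%N.
Proof.
move=> k8; have sub : <[h ^+ k]> \subset <[h]> by apply: cycleX.
by rewrite -(sdprod_card (sdprod_subr (wang_sdprod mG) sub)) (wang_card mG)
  -orderE orderXdiv (wang_order mG).
Qed.

Lemma wang_G : I <*> <[h]> = G.
Proof.
by have [_ defG nIh tiIh] := sdprodP (wang_sdprod mG); rewrite -sdprodEY // (wang_sdprod mG).
Qed.

(** For k = 1, 2, 4 these are the three quadratic steps of the cyclic octic field fixed by [I]. *)
Lemma wang_chain k : (k %| 4)%N ->
  [/\ I <*> <[h ^+ k.*2]> \subset I <*> <[h ^+ k]>,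
      #|(I <*> <[h ^+ k]>)%G : (I <*> <[h ^+ k.*2]>)%G| = 2
    & h ^+ k \in (I <*> <[h ^+ k]>) :\: (I <*> <[h ^+ k.*2]>)].
Proof.
move=> k4; have k_gt0 : (0 < k)%N by apply: dvdn_gt0 k4.
have kk : k \in [:: 1; 2; 4]%N by rewrite -[_ :: _]/(divisors 4) -dvdn_divisors.
have k28 : (k.*2 %| 8)%N by move: kk; rewrite !inE => /or3P[]/eqP->.
have k8 : (k %| 8)%N by apply: dvdn_trans k4 _.
have sub : I <*> <[h ^+ k.*2]> \subset I <*> <[h ^+ k]>.
  by rewrite genS ?setUS // -muln2 expgM cycleX.
split=> //.
  rewrite -divgS //= !wang_card_join //.
  by move: kk; rewrite !inE => /or3P[]/eqP->.
apply/setDP; split; first by rewrite mem_gen // inE cycle_id orbT.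
apply/negP=> hk; have : I <*> <[h ^+ k]> \subset I <*> <[h ^+ k.*2]>.
  by rewrite join_subG joing_subl cycle_subG.
move/subset_leq_card; rewrite !wang_card_join //.
by move: kk; rewrite !inE => /or3P[]/eqP->.
Qed.

End WangModelFacts.

Local Notation int_alg L := (in_alg L \o (intmul (1 : rat) : {rmorphism int -> rat})).

Section RationalExtension.
Variable L : splittingFieldType rat.
Local Notation iota := (int_alg L).

Lemma int_algE n : iota n = n%:~R.
Proof. by rewrite [LHS]rmorph_int. Qed.

Lemma rat_algE (a : rat) : a%:A = (numq a)%:~R / (denq a)%:~R :> L.
Proof. by rewrite -[a in LHS]divq_num_den -[_%:A]/(in_alg L _) fmorph_div !rmorph_int. Qed.

Lemma intr_integral (n : int) : integralOver iota (n%:~R : L).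
Proof. by rewrite -int_algE; apply: integral_id. Qed.

Lemma intr_ext_inj : injective (fun n : int => n%:~R : L).
Proof.
by move=> m n; rewrite -!int_algE => /(fmorph_inj (in_alg L))/eqP; rewrite eqr_int => /eqP.
Qed.

Lemma intr_ext_eq0 (n : int) : (n%:~R == 0 :> L) = (n == 0).
Proof. by rewrite -[0]/(0%:~R) (inj_eq intr_ext_inj). Qed.

Variables (p : nat) (p_pr : prime p) (P : L -> Prop) (abvP : prime_above iota p P).
Local Notation O := (local_ring abvP).
Local Notation M := (local_max abvP).
Local Notation U := (local_unit abvP).

Lemma intr_local (n : int) : n%:~R \in O.
Proof. exact/integral_local/intr_integral. Qed.

Lemma intr_local_max (n : int) : (n%:~R \in M) = (p %| n)%Z.
Proof.
apply/idP/idP=> [nM|/dvdzP[q ->]]; last first.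
  by rewrite intrM local_maxM ?intr_local // -pmulrn local_max_p.
apply: contraT => pn; have : coprimez p n by rewrite coprimezE absz_nat prime_coprime // -dvdzE.
case/coprimezP=> -[u v] /= uv1.
case/negP: (local_max1 abvP); rewrite -[1]/(1%:~R) -uv1 intrD !intrM.
by rewrite local_maxD // local_maxM ?intr_local // -pmulrn local_max_p.
Qed.
End RationalExtension.

Section LocalUnits.
Variables (R : comNzRingType) (L : fieldType) (iota : {rmorphism R -> L}).
Variables (p : nat) (P : L -> Prop) (abvP : prime_above iota p P).
Local Notation U := (local_unit abvP).

Lemma local_unit_exprz x (k : int) : x \in U -> x ^ k \in U.
Proof.
by case: k => n xU; rewrite ?NegzE ?exprNz -?exprnP ?local_unitV ?local_unitX.
Qed.
End LocalUnits.

(** * The field Q(sqrt d) at an odd prime dividing d *)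

Section RamifiedPrime.
Variable L : splittingFieldType rat.
Local Notation iota := (int_alg L).
Variables (p : nat) (P : L -> Prop) (abvP : prime_above iota p P).
Hypotheses (p_pr : prime p) (p_odd : odd p).
Local Notation O := (local_ring abvP).
Local Notation M := (local_max abvP).
Local Notation U := (local_unit abvP).
Variables (h : gal_of {:L}) (y : L) (d : int).
Hypotheses (y0 : y != 0) (y2 : y ^+ 2 = d%:~R) (hy : h y = - y).
Hypotheses (p_d : (p %| d)%Z) (p2_d : ~~ (p * p %| d)%Z).

(** Since p ramifies in F = Q(y), a unit of F has its residue in F_p and is fixed by [h] modulo [M].
    These consequences are recorded instead of membership in F; they pass to products and
    inverses. *)
Definition tame_unit (e : L) :=
  [/\ e \in U, h e - e \in M & exists n : int, e - n%:~R \in M].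

Lemma tame_unitM e f : tame_unit e -> tame_unit f -> tame_unit (e * f).
Proof.
move=> [eU he [m em]] [fU hf [n fn]]; split; first exact: local_unitM.
  have -> : h (e * f) - e * f = e * (h f - f) + (h e - e) * (h f - f) + f * (h e - e).
    by rewrite rmorphM; ring.
  by rewrite !local_maxD // local_maxM ?(local_unitO eU) ?(local_unitO fU) ?(local_maxW he).
exists (m * n); rewrite intrM.
have -> : e * f - m%:~R * n%:~R = e * (f - n%:~R) + n%:~R * (e - m%:~R) by ring.
by rewrite local_maxD // local_maxM ?(local_unitO eU) ?intr_local.
Qed.

Lemma tame_unit_int (n : int) : ~~ (p %| n)%Z -> tame_unit n%:~R.
Proof.
move=> pn; split; first by rewrite inE intr_local intr_local_max.
  by rewrite rmorph_int subrr local_max0.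
by exists n; rewrite subrr local_max0.
Qed.

Lemma tame_unit_conj e : tame_unit e -> h e \in U.
Proof. by case=> eU he _; apply: local_unit_congr eU he. Qed.

Lemma tame_unitV e : tame_unit e -> tame_unit e^-1.
Proof.
move=> eT; have hU := tame_unit_conj eT; have [eU he [n en]] := eT.
have e0 := local_unit_neq0 eU; have he0 := local_unit_neq0 hU.
split; first exact: local_unitV.
  have -> : h e^-1 - e^-1 = - ((e * h e)^-1 * (h e - e)).
    by rewrite fmorphV; field; rewrite e0 he0.
  by rewrite local_maxN // local_maxM // local_unitO // local_unitV // local_unitM.
have pn : ~~ (p %| n)%Z.
  rewrite -(intr_local_max p_pr abvP).
  apply: contra (local_unit_max eU) => nM.
  by rewrite -[e](subrK n%:~R) local_maxD.
have : coprimez p n by rewrite coprimezE absz_nat prime_coprime // -dvdzE.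
case/coprimezP=> -[u v] /= uv1; exists v.
have -> : e^-1 - v%:~R = e^-1 * ((u * p)%:~R - v%:~R * (e - n%:~R)).
  have : (u * p + v * n)%:~R = 1 :> L by rewrite uv1.
  rewrite intrD [(v * n)%:~R]intrM => /(canRL (addrK _))->.
  by field.
rewrite local_maxM ?local_unitO ?local_unitV //.
by rewrite local_maxB ?local_maxM ?intr_local // intr_local_max // dvdz_mull.
Qed.

Lemma y_local : y \in M.
Proof.
have y2M : y ^+ 2 \in M by rewrite y2 intr_local_max.
apply: local_max_sqr y2M; apply: (@local_monic2 _ _ _ _ _ abvP y 0 d%:~R).
- exact: rpred0.
- exact: intr_local.
- by rewrite mul0r subr0 y2 subrr.
Qed.

Lemma p_uniformizer : exists2 e, tame_unit e & p%:R = y ^ 2 * e.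
Proof.
have /dvdzP[d0 def_d] := p_d.
have d0p : ~~ (p %| d0)%Z.
  by apply: contra p2_d => /dvdzP[c def_c]; rewrite def_d def_c -mulrA dvdz_mull.
exists d0%:~R^-1; first exact/tame_unitV/tame_unit_int.
rewrite -exprnP y2 def_d intrM -pmulrn mulrAC divff ?mul1r // intr_ext_eq0.
by apply: contraNneq d0p => ->; rewrite dvdz0.
Qed.

(** If p does not divide [A], the sum is a unit congruent to [A]. If p divides [A] only, then p =
    y^2 f lets one factor y come out and leaves a unit congruent to [B]. If p divides both, it is
    taken out and the induction applies. *)
Lemma tame_int_combination (A B : int) : (A != 0) || (B != 0) ->
  exists (k : int) (e : L), tame_unit e /\ A%:~R + B%:~R * y = y ^ k * e.
Proof.
have [f fT p_f] := p_uniformizer; have yM := y_local.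
have lift e (n c : L) (m : int) : e = m%:~R + c * y -> ~~ (p %| m)%Z ->
    c \in O -> h c = c -> tame_unit e.
  move=> -> pm cO hc; have mT := tame_unit_int pm; split.
  - case: mT => + _ _ => /local_unit_congr; apply.
    by rewrite addrAC subrr add0r local_maxM.
  - rewrite rmorphD rmorph_int rmorphM /= hy hc.
    have -> : m%:~R + c * - y - (m%:~R + c * y) = - (2%:R * c * y) by ring.
    by rewrite local_maxN // local_maxM // rpredM // rpred_nat.
  - by exists m; rewrite addrAC subrr add0r local_maxM.
have [n] := ubnP (`|A| + `|B|)%N; elim: n A B => // n IHn A B leN AB0.
have [/dvdzP[A' defA]|pA] := boolP (p %| A)%Z; last first.
  exists 0, (A%:~R + B%:~R * y); rewrite expr0z mul1r; split=> //.
  by apply: (lift _ 0 B%:~R A); rewrite ?intr_local ?rmorph_int.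
have [/dvdzP[B' defB]|pB] := boolP (p %| B)%Z; last first.
  exists 1, (B%:~R + A'%:~R * f * y); split.
    have [_ _ _] := fT.
    apply: (lift _ 0 (A'%:~R * f) B); rewrite ?rpredM ?intr_local //.
      by case: fT => /local_unitO.
    rewrite rmorphM rmorph_int; congr (_ * _).
    have : f = p%:R / y ^ 2 by rewrite p_f mulrC mulKf // -exprnP expf_neq0.
    by move->; rewrite fmorph_div rmorph_nat -exprnP rmorphXn /= hy sqrrN.
  by rewrite defA intrM -pmulrn p_f -!exprnP; ring.
have p_gt1 := prime_gt1 p_pr.
have [||k [e [eT eq_e]]] := IHn A' B'.
- move: leN AB0; rewrite defA defB.
  case: (eqVneq A' 0) => [->|]; case: (eqVneq B' 0) => [->|]; rewrite ?mul0r ?eqxx //; nia.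
- by move: AB0; rewrite defA defB; apply: contraTT; rewrite negb_or !negbK =>
  /andP[/eqP-> /eqP->]; rewrite !mul0r eqxx.
exists (k + 2), (e * f); split; first exact: tame_unitM.
rewrite exprzDr ?unitfE // mulrACA -p_f -eq_e defA defB !intrM -pmulrn; ring.
Qed.

Lemma tame_decomposition (x : L) : x != 0 -> (exists a b : rat, x = a%:A + b%:A * y) ->
  exists (k : int) (e : L), tame_unit e /\ x = y ^ k * e.
Proof.
move=> x0 [a [b def_x]].
have da := denq_neq0 a; have db := denq_neq0 b.
have da' : (denq a)%:~R != 0 :> L by rewrite intr_ext_eq0.
have db' : (denq b)%:~R != 0 :> L by rewrite intr_ext_eq0.
have def_x' : x = ((numq a * denq b)%:~R + (numq b * denq a)%:~R * y)
    / ((denq a * denq b)%:~R + 0%:~R * y).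
  by rewrite def_x !rat_algE !intrM; field; rewrite da' db'.
have [|k [e [eT eq_e]]] := @tame_int_combination (numq a * denq b) (numq b * denq a).
  apply: contra_neqT x0; rewrite def_x' negb_or !negbK => /andP[/eqP-> /eqP->].
  by rewrite !mul0r addr0 mul0r.
have [|l [f [fT eq_f]]] := @tame_int_combination (denq a * denq b) 0.
  by rewrite mulf_neq0.
exists (k - l), (e / f); split; first exact/tame_unitM/tame_unitV.
have [fU _ _] := fT; have f0 := local_unit_neq0 fU.
rewrite def_x' eq_e eq_f exprzDr ?unitfE // -invr_expz.
by rewrite invfM mulrACA.
Qed.

End RamifiedPrime.

Lemma intD_self_eq0 (k : int) : k + k == 0 -> k = 0.
Proof. by lia. Qed.

Lemma int_parity (q : int) : exists r : int, q = r + r \/ q = r + r + 1.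
Proof. by exists (q %/ 2)%Z; lia. Qed.

Lemma int_odd_neq (r i : int) : i + i != r + r + 1.
Proof. by lia. Qed.

(** * Odd primes dividing d are 1 modulo 8 *)

Section WangCongruence.
Variable L : splittingFieldType rat.
Hypothesis galL : galois 1 {:L}.
Local Notation iota := (int_alg L).
Local Notation Gamma := ('Gal({:L} / 1)%G).
Variables (I : {group gal_of {:L}}) (a1 a2 a3 a4 h : gal_of {:L}).
Hypothesis mG : wang_model Gamma I a1 a2 a3 a4 h.

Lemma wang_fixed1 x : x \in fixedField I -> h x = x -> exists a : rat, x = a%:A.
Proof.
move=> xI hx; apply: fixed_scalar galL _.
by rewrite -[gval _]/(gval Gamma) -(wang_G mG) fixedField_join xI hx eqxx.
Qed.

Lemma wang_fixed_stable x : x \in fixedField I -> h x \in fixedField I.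
Proof. exact/fixedField_stable/wang_norm/mG. Qed.

Lemma wang_quadratic k : (k %| 4)%N -> exists y,
  [/\ y != 0, y \in fixedField I, (h ^+ k.*2)%g y = y & (h ^+ k)%g y = - y].
Proof.
move=> k4; have [sub idx hk] := wang_chain mG k4.
have [y [y0 yM yJ]] := galois_quadratic sub idx.
by move: yM; rewrite /= fixedField_join => /andP[yI /eqP hy]; exists y; rewrite (yJ _ hk).
Qed.

Variables (y : L) (d : int).
Hypotheses (y0 : y != 0) (yI : y \in fixedField I).
Hypotheses (y2 : y ^+ 2 = d%:~R) (hy : h y = - y).

Lemma wang_quadratic_field x : x \in fixedField I -> h (h x) = x ->
  exists a b : rat, x = a%:A + b%:A * y.
Proof.
move=> xI hhx; have hxI := wang_fixed_stable xI.
have two0 : (2%:R : L) != 0 by have := @intr_ext_eq0 L 2; rewrite -pmulrn => ->.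
have [||a def_a] := @wang_fixed1 ((x + h x) / 2%:R).
- by rewrite rpredM ?rpredD // rpredV rpred_nat.
- by rewrite fmorph_div rmorphD rmorph_nat /= hhx addrC.
have [||b def_b] := @wang_fixed1 ((x - h x) / (2%:R * y)).
- by rewrite rpredM ?rpredB // rpredV rpredM ?rpred_nat.
- rewrite fmorph_div rmorphB rmorphM rmorph_nat /= hhx hy.
  by field; rewrite oppr_eq0 y0 two0.
by exists a, b; rewrite -def_a -def_b; field; rewrite y0 two0.
Qed.

Variables (p : nat) (P : L -> Prop) (abvP : prime_above iota p P).
Hypotheses (p_pr : prime p) (p_odd : odd p).
Hypotheses (p_d : (p %| d)%Z) (p2_d : ~~ (p * p %| d)%Z).
Local Notation O := (local_ring abvP).
Local Notation M := (local_max abvP).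
Local Notation U := (local_unit abvP).
Local Notation tame := (tame_unit abvP h).

Lemma two_unit : 2%:R \in U.
Proof.
rewrite -[2%:R]/(2%:~R) inE intr_local intr_local_max // dvdzE /=.
by rewrite dvdn_prime2 //; apply: contraTneq p_odd => ->.
Qed.

Lemma wang_decomposition x : x != 0 -> x \in fixedField I -> h (h x) = x ->
  exists (k : int) (e : L), tame e /\ x = y ^ k * e.
Proof.
move=> x0 xI hx.
exact: (tame_decomposition abvP p_pr p_odd y0 y2 hy p_d p2_d x0 (wang_quadratic_field xI hx)).
Qed.

Lemma y_expz_conj (k : int) : h (y ^ k) = (-1) ^ k * y ^ k.
Proof. by rewrite fmorphXz /= hy -[- y]mulN1r expfzMl. Qed.

(** [x] and [h x] have the same exponent of [y], so it vanishes; then [h x] and [x] agree modulo [M]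
    and the norm equation reads n^2 = -1 modulo p. *)
Lemma wang_norm_neg1 x : x != 0 -> x \in fixedField I -> h (h x) = x ->
  x * h x = -1 -> tame x /\ exists2 n : int, x - n%:~R \in M & (p %| n ^+ 2 + 1)%Z.
Proof.
move=> x0 xI hx Nx; have [k [e [eT def_x]]] := wang_decomposition x0 xI hx.
have [eU he [n en]] := eT; have heU := tame_unit_conj eT.
have yM := y_local abvP p_pr y2 p_d.
have N1U : -1 \in U by rewrite local_unitN // local_unit1.
have k0 : k = 0.
  have : y ^ (k + k) * ((-1) ^ k * (e * h e)) \in U.
    suff -> : y ^ (k + k) * ((-1) ^ k * (e * h e)) = x * h x by rewrite Nx.
    by rewrite def_x rmorphM /= y_expz_conj exprzDr ?unitfE //; ring.
  have EU : (-1) ^ k * (e * h e) \in U by rewrite local_unitM ?local_unit_exprz // local_unitM.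
  by have [_ _ ->] := local_unit_expz (k + k) y0 yM EU; move/intD_self_eq0.
have ex : x = e by rewrite def_x k0 expr0z mul1r.
rewrite ex; split=> //; exists n => //.
rewrite -(intr_local_max p_pr abvP) rmorphD rmorphXn rmorph1 /=.
have -> : n%:~R ^+ 2 + 1 = - ((e - n%:~R) * (e + n%:~R)) - e * (h e - e) :> L.
  have : e * h e + 1 = 0 by rewrite -ex Nx addNr.
  by move=> E; apply/eqP; rewrite -subr_eq0 -E; apply/eqP; ring.
have eO := local_unitO eU.
apply: local_maxB; last exact: local_maxM.
by apply: local_maxN; apply: local_maxMl; rewrite ?rpredD ?intr_local.
Qed.

Lemma wang_congruence : (p %% 8)%N = 1%N.
Proof.
have yM := y_local abvP p_pr y2 p_d.
have hX k x : (h ^+ k.+1)%g x = h ((h ^+ k)%g x) by rewrite gal_comp expgSr.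
(* [w] generates the quartic field over F, and [z] the octic field over the quartic one. *)
have [w [w0 wI h4w h2w]] := wang_quadratic (isT : (2 %| 4)%N).
have [z [z0 zI _ h4z]] := wang_quadratic (isT : (4 %| 4)%N).
rewrite !hX !expg0 !gal_id in h4w h2w h4z.
have two0 := local_unit_neq0 two_unit.
have hK x : (h x == 0) = (x == 0) by rewrite fmorph_eq0.
have stab := wang_fixed_stable.
pose delta := h w / w.
have [||||deltaT [s delta_s s2]] := @wang_norm_neg1 delta.
- by rewrite mulf_neq0 ?invr_eq0 ?hK.
- by rewrite rpred_div ?stab.
- by rewrite /delta !fmorph_div /= h2w rmorphN /= invrN mulrNN.
- by rewrite /delta fmorph_div /= h2w; field; rewrite hK w0.
have [deltaU _ _] := deltaT.
have [|||q [g [gT def_g]]] := @wang_decomposition (w ^+ 2).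
- by rewrite expf_neq0.
- by rewrite rpredX.
- by rewrite !rmorphXn /= h2w sqrrN.
have [gU hg _] := gT.
have delta2 : delta ^+ 2 + 1 \in M.
  have -> : delta ^+ 2 + 1 = (delta - s%:~R) * (delta + s%:~R) + (s ^+ 2 + 1)%:~R.
    by rewrite intrD rmorphXn /=; ring.
  by rewrite local_maxD ?intr_local_max // local_maxMl // rpredD ?intr_local ?local_unitO.
(* The middle step is ramified at p: for even [q], comparing [h (w ^+ 2) = delta ^+ 2 * w ^+ 2] with
   [w ^+ 2 = y ^ q * g] would give g = -g modulo [M], while p is odd. *)
have q_odd : exists r, q = r + r + 1.
  have [r [def_q|]] := int_parity q; last by exists r.
  have yq : h (y ^ q) = y ^ q by rewrite y_expz_conj def_q exprzDr ?unitrN1 // -expfzMl mulrNN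
    mulr1 exp1rz mul1r.
  have hw2 : h (w ^+ 2) = delta ^+ 2 * w ^+ 2 by rewrite rmorphXn /= /delta; field.
  have : h g = delta ^+ 2 * g.
    move: hw2; rewrite def_g rmorphM /= yq mulrCA; apply: mulfI.
    by rewrite expfz_neq0.
  move=> eq_hg; case/negP: (local_unit_max (local_unitM two_unit gU)).
  have -> : 2%:R * g = (delta ^+ 2 + 1) * g - (h g - g) by rewrite eq_hg; ring.
  by rewrite local_maxB // local_maxMl // local_unitO.
have [r def_q] := q_odd.
(* [b] lies in the quartic field and has norm -1 down to Q. *)
pose b := h z / z.
have b0 : b != 0 by rewrite mulf_neq0 ?invr_eq0 ?hK.
have bI : b \in fixedField I by rewrite rpred_div ?stab.
have h4b : h (h (h (h b))) = b.
  by rewrite /b !fmorph_div /= h4z rmorphN /= invrN mulrNN.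
have Nb : b * h b * h (h b) * h (h (h b)) = -1.
  rewrite /b !fmorph_div /= h4z; field; by rewrite !hK z0.
clearbody b.
(* Coordinates of [b] over F in the basis 1, [w]: b = u + v w, as [h ^+ 2] changes the sign of
   [w]. *)
pose u := (b + h (h b)) / 2%:R; pose v := (b - h (h b)) / (2%:R * w).
have uI : u \in fixedField I by rewrite rpred_div ?rpred_nat // rpredD // !stab.
have vI : v \in fixedField I by rewrite rpred_div //;
  [rewrite rpredB // !stab | rewrite rpredM // rpred_nat].
have hu : h (h u) = u.
  by rewrite /u; do 2!rewrite fmorph_div rmorphD rmorph_nat /=; rewrite h4b addrC.
have hv : h (h v) = v.
  have h2E : h 2%:R = 2%:R by rewrite rmorph_nat.
  rewrite /v !fmorph_div !rmorphB !rmorphM /= !h2E h4b h2w.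
  by field; rewrite oppr_eq0 w0 two0.
(* The norm of [b] to F, itself of norm -1 to Q; so t = n modulo [M] with n^2 = -1. A square root of
   n modulo p is wanted. *)
pose t := u ^+ 2 - w ^+ 2 * v ^+ 2.
have def_t : t = b * h (h b) by rewrite /t /u /v; field; rewrite w0 two0.
have [|||| tT [n tn n2]] := @wang_norm_neg1 t.
- by rewrite def_t mulf_neq0 ?hK.
- by rewrite def_t rpredM // !stab.
- by rewrite def_t !rmorphM /= h4b mulrC.
- by rewrite def_t rmorphM /= -Nb; ring.
have [tU _ _] := tT.
(* If the second term of [t] vanishes modulo [M], then [u] is the required square root. Otherwise a
   parity contradiction follows. *)
have [b'M|b'M] := boolP (w ^+ 2 * v ^+ 2 \in M).
  have u2U : u ^+ 2 \in U by apply: local_unit_congr tU _; rewrite /t opprB addrCA subrr addr0.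
  have u0 : u != 0.
    by apply: contraTneq u2U => ->; rewrite expr0n /= inE local_max0 andbF.
  have [i [e [eT def_u]]] := wang_decomposition u0 uI hu.
  have [eU _ [m em]] := eT.
  have i0 : i = 0.
    move: u2U; rewrite def_u expr2 mulrACA -exprzDr ?unitfE //.
    by have [_ _ ->] := local_unit_expz (i + i) y0 yM (local_unitM eU eU); move/intD_self_eq0.
  rewrite i0 expr0z mul1r in def_u.
  apply: (@prime_dvd_biquadratic_succ p m p_pr p_odd).
  rewrite -(intr_local_max p_pr abvP); rewrite -(intr_local_max p_pr abvP) in n2.
  have uO := local_unitO eU; rewrite -def_u in uO em.
  have m2n : m%:~R ^+ 2 - n%:~R \in M.
    have -> : m%:~R ^+ 2 - n%:~R = w ^+ 2 * v ^+ 2 + (t - n%:~R) - (u - m%:~R) * (u + m%:~R).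
      by rewrite /t; ring.
    apply: local_maxB; first exact: local_maxD.
    by rewrite local_maxMl // rpredD ?intr_local.
  have -> : (m ^+ 4 + 1)%:~R = (m%:~R ^+ 2 - n%:~R) * (m%:~R ^+ 2 + n%:~R) + (n ^+ 2 + 1)%:~R :> L.
    by rewrite !intrD !rmorphXn /=; ring.
  by rewrite local_maxD // local_maxMl // rpredD ?rpredX ?intr_local.
have v0 : v != 0.
  by apply: contraNneq b'M => ->; rewrite expr0n mulr0 local_max0.
have [j [e [eT def_v]]] := wang_decomposition v0 vI hv.
have [eU _ _] := eT.
have def_b' : w ^+ 2 * v ^+ 2 = y ^ (q + (j + j)) * (g * e ^+ 2).
  by rewrite def_g def_v !exprzDr ?unitfE //; ring.
have e'U : g * e ^+ 2 \in U by rewrite local_unitM ?local_unitX.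
have b'0 : w ^+ 2 * v ^+ 2 != 0 by rewrite mulf_neq0 ?expf_neq0.
have [_ b'E _] := local_unit_expz (q + (j + j)) y0 yM e'U.
(* The exponent is odd, hence nonzero. Being negative, it makes [t] negligible, so u^2 and w^2 v^2
   have the same exponent; but the former is even and the latter odd. *)
have neg : q + (j + j) < 0.
  rewrite lt_neqAle leNgt -b'E -def_b' b'M andbT def_q addrAC addrACA eq_sym.
  exact: int_odd_neq (r + j) 0.
have bV : (w ^+ 2 * v ^+ 2)^-1 \in M.
  rewrite def_b' invfM invr_expz.
  by have [_ -> _] := local_unit_expz (- (q + (j + j))) y0 yM (local_unitV e'U); rewrite oppr_gt0.
have ratU : u ^+ 2 / (w ^+ 2 * v ^+ 2) \in U.
  apply: local_unit_congr (local_unit1 abvP) _.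
  have -> : u ^+ 2 / (w ^+ 2 * v ^+ 2) - 1 = t / (w ^+ 2 * v ^+ 2).
    by rewrite /t; field; rewrite w0 v0.
  by rewrite local_maxM // local_unitO.
have u0 : u != 0.
  by apply: contraTneq ratU => ->; rewrite expr0n mul0r inE local_max0 andbF.
have [i [f [fT def_u]]] := wang_decomposition u0 uI hu.
have [fU _ _] := fT.
move: ratU; have -> : u ^+ 2 / (w ^+ 2 * v ^+ 2) = y ^ (i + i - (q + (j + j)))
  * (f ^+ 2 / (g * e ^+ 2)).
  rewrite def_b' def_u invfM invr_expz exprzDr ?unitfE // exprzDr ?unitfE //; ring.
have f'U : f ^+ 2 / (g * e ^+ 2) \in U by rewrite local_unitM ?local_unitV ?local_unitX.
have [_ _ ->] := local_unit_expz (i + i - (q + (j + j))) y0 yM f'U.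
by rewrite subr_eq0 def_q addrAC addrACA (negPf (int_odd_neq _ _)).
Qed.

End WangCongruence.

Section RationalPrimes.
Variable L : splittingFieldType rat.
Local Notation iota := (int_alg L).

Lemma int_prime_exists (p : nat) : prime p -> exists P, prime_above iota p P.
Proof.
move=> p_pr; apply: exists_prime_above; apply: natr_integral_nonunit => [m n|r pr1].
  by move=> eq_mn; apply: (@intr_ext_inj L); rewrite -!int_algE.
have : (p %| p%:R * r)%Z by rewrite natz dvdz_mulr.
by rewrite pr1 dvdzE dvdn1 absz_nat => /eqP p1; rewrite p1 in p_pr.
Qed.

(** At a prime above a prime p of the denominator, the numerator is an integral element times the
    denominator, so p divides it too. *)
Lemma rat_integral_int (a : rat) : integralOver iota (a%:A : L) ->
  exists n : int, a%:A = n%:~R :> L.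
Proof.
move=> aZ; exists (numq a); rewrite rat_algE.
suff -> : denq a = 1 by rewrite divr1.
apply/eqP; rewrite -absz_denq eqz_nat; apply/eqP; apply: contrapT => den1.
have den_gt1 : (1 < `|denq a|)%N.
  by have := denq_gt0 a; move/eqP: den1; case: (denq a) => // -[|[]].
have p_pr := pdiv_prime den_gt1; set p := pdiv _ in p_pr.
have [P abvP] := int_prime_exists p_pr.
have p_den : (p %| denq a)%Z by rewrite dvdzE pdiv_dvd.
have : (numq a)%:~R \in local_max abvP.
  have den0 : (denq a)%:~R != 0 :> L by rewrite intr_ext_eq0 denq_neq0.
  rewrite -(divfK den0 (numq a)%:~R) -rat_algE local_maxM ?integral_local //.
  by rewrite intr_local_max.
rewrite intr_local_max // => p_num.
have := coprime_num_den a; apply/negP; rewrite /coprime.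
have : (p %| gcdn `|numq a| `|denq a|)%N by rewrite dvdn_gcd; move: p_num p_den;
  rewrite !dvdzE !absz_nat => -> ->.
by apply: contraL => /eqP->; rewrite dvdn1 neq_ltn prime_gt1 ?orbT.
Qed.
End RationalPrimes.

(** * The squarefree d of the quadratic subfield and its residue modulo 8 *)

Section Discriminant.
Variable L : splittingFieldType rat.
Hypothesis galL : galois 1 {:L}.
Local Notation iota := (int_alg L).
Local Notation Gamma := ('Gal({:L} / 1)%G).
Variables (I : {group gal_of {:L}}) (a1 a2 a3 a4 h : gal_of {:L}).
Hypothesis mG : wang_model Gamma I a1 a2 a3 a4 h.

Lemma wang_discriminant : exists (y : L) (d : int),
  [/\ y != 0, y \in fixedField I, y ^+ 2 = d%:~R, h y = - y
    & forall p : nat, prime p -> ~~ (p * p %| d)%Z].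
Proof.
have [y [y0 yI h2y hy]] := wang_quadratic mG (isT : (1 %| 4)%N).
rewrite expg1 in hy.
have [||a def_a] := wang_fixed1 galL mG (x := y ^+ 2).
- by rewrite rpredX.
- by rewrite rmorphXn /= hy sqrrN.
have den0 : (denq a)%:~R != 0 :> L by rewrite intr_ext_eq0 denq_neq0.
pose z : L := (denq a)%:~R * y.
have z0 : z != 0 by rewrite mulf_neq0.
have zI : z \in fixedField I by rewrite rpredM ?rpred_int.
have hz : h z = - z by rewrite rmorphM rmorph_int /= hy mulrN.
have z2 : z ^+ 2 = (numq a * denq a)%:~R.
  by rewrite exprMn def_a rat_algE intrM; field.
(* Induction on the absolute value of [d]: a factor p^2 is removed by dividing the root by p. *)
move: z z0 zI hz z2; move: (numq a * denq a) => d; move: {2}_.+1 (ltnSn `|d|%N) => n.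
elim: n d => // n IHn d lt_dn z z0 zI hz z2.
have [sqf|] := pselect (forall p : nat, prime p -> ~~ (p * p %| d)%Z).
  by exists z, d.
move=> /existsNP[p /not_implyP[p_pr /negP/negPn/dvdzP[d' def_d]]].
have p0 : p%:R != 0 :> L by have := @intr_ext_eq0 L p; rewrite -pmulrn => ->;
  rewrite eqz_nat -lt0n prime_gt0.
have d0 : d != 0.
  by apply: contraNneq z0 => d0; move: z2; rewrite d0 => /eqP; rewrite expf_eq0.
apply: (IHn d' _ (z / p%:R)).
- have p_gt1 := prime_gt1 p_pr.
  move: lt_dn d0; rewrite def_d !abszM !absz_nat mulf_eq0 negb_or -absz_gt0 => lt_dn
    /andP[d'_gt0 _].
  apply: leq_trans (ltnSE lt_dn).
  by rewrite ltn_Pmulr // (leq_trans p_gt1) // leq_pmulr // ltnW.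
- by rewrite mulf_neq0 ?invr_eq0.
- by rewrite rpred_div ?rpred_nat.
- by rewrite fmorph_div rmorph_nat /= hz mulNr.
- by rewrite expr_div_n z2 def_d !intrM -!pmulrn; field.
Qed.

Variables (P : L -> Prop) (abvP : prime_above iota 2 P).
Hypothesis inertia_sub : forall g : gal_of {:L},
  (forall x, integralOver iota x -> P (g x - x)) -> g \in I.
Variables (y : L) (d : int).
Hypotheses (y0 : y != 0) (yI : y \in fixedField I).
Hypotheses (y2 : y ^+ 2 = d%:~R) (hy : h y = - y).
Hypothesis sqf_d : forall p : nat, prime p -> ~~ (p * p %| d)%Z.

Lemma discriminant_neq0 : d != 0.
Proof.
by apply: contraNneq y0 => d0; move: y2; rewrite d0 => /eqP; rewrite expf_eq0.
Qed.

Lemma sqrt_discriminant_integral : integralOver iota y.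
Proof.
apply: (@integral_root_monic _ _ iota y ('X^2 - d%:~R%:P)).
- by rewrite monicXnsubC.
- by rewrite /root !hornerE /= y2 subrr.
- apply/(integral_poly iota) => i; rewrite coefB coefXn coefC.
  apply: integral_sub; first exact: integral_nat.
  by case: ifP => _; [apply: intr_integral | apply: integral0].
Qed.

(** Otherwise [gal_lift_inertia] would put [h] in the product of I<h^2> and inertia, which is
    I<h^2>. *)
Lemma inertia_moves_quadratic : exists x,
  [/\ integralOver iota x, x \in fixedField I, h (h x) = x & ~ P (h x - x)].
Proof.
apply: contrapT => noX.
have [sub idx /setDP[_ hJ]] := wang_chain mG (isT : (1 %| 4)%N).
case/negP: hJ; rewrite expg1.
have [|j jJ jP] := @gal_lift_inertia _ _ _ _ _ _ abvP (I <*> <[h ^+ 1.*2]>)%G h.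
  move=> x xZ xJ; apply: contrapT => nP; apply: noX; exists x.
  have : x \in fixedField (I <*> <[h ^+ 1.*2]>)%g by apply/fixedP.
  by rewrite fixedField_join -gal_comp => /andP[xI /eqP hx].
have := groupM jJ (subsetP (joing_subl I <[h ^+ 1.*2]>%G) _ (inertia_sub jP)).
by rewrite mulKVg.
Qed.

(** With trace A and norm N of the integer [x] just found, x - h x = b y gives b^2 d = A^2 - 4 N.
    Squarefreeness makes the rational b an integer, and b is odd because x - h x is not in [P]. *)
Lemma discriminant_mod4 : (d %% 4)%Z = 1.
Proof.
have [x [xZ xI hhx nP]] := inertia_moves_quadratic.
have hxI := wang_fixed_stable mG xI.
have hxZ : integralOver iota (h x) by apply: gal_integral.
have [||A0 def_A0] := wang_fixed1 galL mG (x := x + h x).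
- by rewrite rpredD.
- by rewrite rmorphD /= hhx addrC.
have [A def_A] : exists n : int, A0%:A = n%:~R :> L.
  by apply: rat_integral_int; rewrite -def_A0; apply: integral_add.
have [||N0 def_N0] := wang_fixed1 galL mG (x := x * h x).
- by rewrite rpredM.
- by rewrite rmorphM /= hhx mulrC.
have [N def_N] : exists n : int, N0%:A = n%:~R :> L.
  by apply: rat_integral_int; rewrite -def_N0; apply: integral_mul.
have [||b def_b] := wang_fixed1 galL mG (x := (x - h x) / y).
- by rewrite rpred_div ?rpredB.
- by rewrite fmorph_div rmorphB /= hhx hy invrN mulrN -mulNr opprB.
have eq_b : (numq b)%:~R ^+ 2 * d%:~R = (A ^+ 2 - 4 * N)%:~R * (denq b)%:~R ^+ 2 :> L.
  have den0 : (denq b)%:~R != 0 :> L by rewrite intr_ext_eq0 denq_neq0.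
  have num_b : (numq b)%:~R = (x - h x) / y * (denq b)%:~R :> L.
    by rewrite def_b rat_algE divfK.
  rewrite num_b -y2 intrB intrM rmorphXn /= -def_A -def_N -def_A0 -def_N0.
  by field.
have {}eq_b : numq b ^+ 2 * d = (A ^+ 2 - 4 * N) * denq b ^+ 2.
  apply: (@intr_ext_inj L) => /=.
  have E (u v : int) : (v * u ^+ 2)%:~R = v%:~R * u%:~R ^+ 2 :> L by rewrite intrM rmorphXn.
  by rewrite [LHS](congr1 _ (mulrC _ _)) !E mulrC.
have den1 : denq b = 1.
  apply/eqP; rewrite -absz_denq eqz_nat; apply/eqP; apply: contrapT => den1.
  have den_gt1 : (1 < `|denq b|)%N.
    by have := denq_gt0 b; move/eqP: den1; case: (denq b) => // -[|[]].
  have p_pr := pdiv_prime den_gt1; set p := pdiv _ in p_pr.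
  have p_den : (p %| denq b)%Z by rewrite dvdzE pdiv_dvd.
  case/negP: (sqf_d p_pr).
  have p_num : coprimez (p * p) (numq b ^+ 2).
    rewrite coprimezE absz_nat abszX -[(p * p)%R]/(p * p)%N coprimeMl andbb coprimeXr //.
    have p_denN : (p %| `|denq b|)%N by move: p_den; rewrite dvdzE absz_nat.
    by apply: (coprime_dvdl p_denN); rewrite coprime_sym coprime_num_den.
  rewrite -(Gauss_dvdzr d p_num) eq_b dvdz_mull // expr2 dvdzE absz_nat abszM.
  by apply: dvdn_mul.
rewrite den1 expr1n mulr1 in eq_b.
apply: (@squarefree_mod4 A (numq b)).
- exact: (@sqf_d 2).
- apply/negP=> /dvdzP[B def_B]; apply: nP.
  have -> : h x - x = - ((B%:~R * y) * 2%:R).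
    have := def_b; rewrite rat_algE den1 divr1 => /(canRL (divfK y0)).
    by move=> E; rewrite -opprB E def_B intrM; ring.
  apply: (prime_aboveN abvP); apply: (prime_aboveM abvP); last exact: prime_above_p abvP.
  by apply: integral_mul; [apply: intr_integral | apply: sqrt_discriminant_integral].
- by apply/dvdzP; exists N; rewrite eq_b; ring.
Qed.

Lemma discriminant_mod8 : (d %% 8)%Z = 1.
Proof.
apply: prime_divisors_intmod8 discriminant_neq0 discriminant_mod4 _.
move=> p p_pr p_odd p_d; have [Q abvQ] := int_prime_exists L p_pr.
exact: (wang_congruence galL mG y0 yI y2 hy abvQ p_pr p_odd p_d (sqf_d p_pr)).
Qed.
End Discriminant.

Lemma dvdz_pow_bound (v : nat) (n : int) : n != 0 -> ((2 ^ v)%N %| n)%Z -> (v < `|n|)%N.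
Proof.
rewrite dvdzE absz_nat -absz_gt0 => n_gt0 /dvdn_leq => /(_ n_gt0).
exact/leq_trans/ltn_expl.
Qed.

(** * The field Q(sqrt d) at 2 when d = 1 modulo 8 *)

Section SplitPrime.
Variable L : splittingFieldType rat.
Local Notation iota := (int_alg L).
Variables (P : L -> Prop) (abvP : prime_above iota 2 P).
Local Notation O := (local_ring abvP).
Local Notation M := (local_max abvP).
Local Notation U := (local_unit abvP).

Definition sign_mod4 (e : L) :=
  exists2 c, c \in O & e = 1 + 4%:R * c \/ e = -1 + 4%:R * c.

Lemma four_max : 4%:R \in M.
Proof. by rewrite -[4%:R]/(4%:~R) intr_local_max. Qed.

Lemma sign_mod4_unit e : sign_mod4 e -> e \in U.
Proof.
move=> [c cO eq_e]; have cM : 4%:R * c \in M by rewrite local_maxMl ?four_max.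
have U1 := local_unit1 abvP; have UN1 := local_unitN U1.
by case: eq_e => ->; [apply: local_unit_congr U1 _ | apply: local_unit_congr UN1 _];
  rewrite addrAC subrr add0r.
Qed.

Lemma sign_mod4M e f : sign_mod4 e -> sign_mod4 f -> sign_mod4 (e * f).
Proof.
move=> [c cO eq_e] [b bO eq_f]; have fO : f \in O by apply/local_unitO/sign_mod4_unit; exists b.
have cf : c * f \in O by rewrite rpredM.
case: eq_e => ->; case: eq_f => def_f.
- by exists (b + c * f); [rewrite rpredD | left; rewrite def_f; ring].
- by exists (b + c * f); [rewrite rpredD | right; rewrite def_f; ring].
- by exists (- b + c * f); [rewrite rpredD ?rpredN | right; rewrite def_f; ring].
- by exists (- b + c * f); [rewrite rpredD ?rpredN | left; rewrite def_f; ring].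
Qed.

Lemma sign_mod4V e : sign_mod4 e -> sign_mod4 e^-1.
Proof.
move=> eW; have eU := sign_mod4_unit eW; have e0 := local_unit_neq0 eU.
have eVO := local_unitO (local_unitV eU).
have [c cO [] def_e] := eW; rewrite def_e in e0 eVO *.
- by exists (- (c / (1 + 4%:R * c))); [rewrite rpredN rpredM | left; field].
- by exists (c / (-1 + 4%:R * c)); [rewrite rpredM | right; field].
Qed.

Lemma sign_mod4_int (n : int) : ~~ (2 %| n)%Z -> sign_mod4 n%:~R.
Proof.
move=> n2; have [k []def_n] : exists k, n = 1 + 4 * k \/ n = -1 + 4 * k.
- have : (n %% 4)%Z = 1 \/ (n %% 4)%Z = 3 by lia.
  by case=> n4; [exists (n %/ 4)%Z; left | exists ((n + 1) %/ 4)%Z; right]; lia.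
- by exists k%:~R; [apply: intr_local | left; rewrite def_n intrD intrM].
- by exists k%:~R; [apply: intr_local | right; rewrite def_n intrD intrM].
Qed.

Lemma sign_mod4D e c : sign_mod4 e -> c \in O -> sign_mod4 (e + 4%:R * c).
Proof.
move=> [b bO eq_e] cO; exists (b + c); first by rewrite rpredD.
by case: eq_e => ->; [left | right]; ring.
Qed.

Variables (h : gal_of {:L}) (y : L) (d : int).
Hypotheses (y0 : y != 0) (y2 : y ^+ 2 = d%:~R) (hy : h y = - y).
Hypothesis d8 : (d %% 8)%Z = 1.

Lemma two_neq0 : (2%:R : L) != 0.
Proof. by have := @intr_ext_eq0 L 2; rewrite -pmulrn => ->. Qed.

(** The element [t] lies in the chosen prime, its conjugate does not, and its norm is exactly
    divisible by 2: a uniformizer of F at [P] with integral trace and norm. *)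
Lemma split_generator : exists (t : L) (T n : int),
  [/\ t \in M, ~~ (2 %| T)%Z, ~~ (2 %| n)%Z, t * (T%:~R - t) = 2%:R * n%:~R &
    h t = T%:~R - t] /\
  exists s c : int, [/\ y = s%:~R + c%:~R * t, (c == 2) || (c == - 2%:Z) & d = T ^+ 2 - 8 * n].
Proof.
have [m def_d] : exists m, d = 8 * m + 1 by exists (d %/ 8)%Z; lia.
have two0 := two_neq0.
have four0 : (4%:R : L) != 0 by rewrite -[4%:R]/(4%:~R) intr_ext_eq0.
have E8 : (8 * m + 1)%:~R = 8%:R * m%:~R + 1 :> L by rewrite intrD intrM.
have E2 (k : int) : (2 * k)%:~R = 2%:R * k%:~R :> L by rewrite intrM.
have EN (k : int) : (- k)%:~R = - k%:~R :> L by rewrite mulrNz.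
have ET (k : int) : (2 * k + 1)%:~R = 2%:R * k%:~R + 1 :> L by rewrite intrD E2.
have half (z : L) : z ^+ 2 = d%:~R -> (1 + z) / 2%:R \in O.
  move=> z2; apply: (@local_monic2 _ _ _ _ _ abvP _ 1 (2 * m)%:~R); rewrite ?rpred1 ?intr_local //.
  transitivity ((z ^+ 2 - (8 * m + 1)%:~R) / 4%:R).
    by rewrite E8 E2; field; rewrite ?four0 two0.
  by rewrite z2 def_d subrr mul0r.
have [z [z2 hz zM yz]] : exists z, [/\ z ^+ 2 = d%:~R, h z = - z, (1 + z) / 2%:R \in M & y = z
  \/ y = - z].
  have y'2 : (- y) ^+ 2 = d%:~R by rewrite sqrrN.
  have prodM : ((1 + y) / 2%:R) * ((1 - y) / 2%:R) \in M.
    have -> : ((1 + y) / 2%:R) * ((1 - y) / 2%:R) = - (2 * m)%:~R.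
      transitivity ((1 - y ^+ 2) / 4%:R).
        by field; rewrite ?four0 two0.
      by rewrite y2 def_d E8 E2; field.
    by rewrite local_maxN // intr_local_max // dvdz_mulr.
  case/orP: (local_max_prime (half _ y2) (half _ y'2) prodM) => zM.
    by exists y; split=> //; left.
  by exists (- y); split=> //; [rewrite rmorphN /= hy | right; rewrite opprK].
(* The norm of s + (1 + z) / 2 is s^2 + s - 2 m; the even shift [s] is chosen to make half of it odd
   while staying in [M]. *)
pose s : int := if (2 %| m)%Z then 2 else 0.
pose n : int := if (2 %| m)%Z then 3 - m else - m.
have sn : s ^+ 2 + s - 2 * m = 2 * n by rewrite /s /n; case: ifP => _; ring.
have n_odd : ~~ (2 %| n)%Z by rewrite /n; case: ifP; lia.
have s_even : (2 %| s)%Z by rewrite /s; case: ifP.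
pose t : L := s%:~R + (1 + z) / 2%:R; pose T : int := 2 * s + 1.
exists t, T, n; split; last first.
  case: yz => ->; [exists (- T), 2 | exists T, (- 2%:Z)]; split=> //; rewrite /t /T.
  - by rewrite EN ET; field.
  - by clear -def_d sn; rewrite !expr2 in sn *; lia.
  - by rewrite ET EN; field.
  - by clear -def_d sn; rewrite !expr2 in sn *; lia.
split.
- by rewrite local_maxD // intr_local_max.
- by rewrite /T; lia.
- by [].
- rewrite -E2 -sn /t /T ET; transitivity (s%:~R ^+ 2 + s%:~R - (z ^+ 2 - 1) / 4%:R).
    by field; rewrite ?four0 two0.
  have -> : (s ^+ 2 + s - 2 * m)%:~R = s%:~R ^+ 2 + s%:~R - 2%:R * m%:~R :> L.
    by rewrite intrB intrD rmorphXn E2.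
  by rewrite z2 def_d E8; field.
- rewrite /t /T rmorphD rmorph_int fmorph_div rmorphD rmorph1 rmorph_nat /= hz ET.
  by field.
Qed.

(** As t = 2 mu with mu a local integer, T t = 2 n modulo 4; so for odd [A] the product T (A + B t)
    is an odd integer modulo 4. The other cases reduce to this one by extracting a 2, which lowers
    the power of 2 in the norm form [N]. *)
Lemma int_combination_sign (t : L) (T n : int) : t \in M -> ~~ (2 %| T)%Z ->
    ~~ (2 %| n)%Z -> t * (T%:~R - t) = 2%:R * n%:~R -> h t = T%:~R - t ->
    (forall A B : int, A%:~R + B%:~R * t = 0 -> A = 0 /\ B = 0) ->
  forall A B : int, (A != 0) || (B != 0) ->
  exists (k : int) (e : L), sign_mod4 e /\ A%:~R + B%:~R * t = 2%:R ^ k * e.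
Proof.
move=> tM T2 n2 Nt ht free A B AB0; pose N (A B : int) := A ^+ 2 + A * B * T + 2 * B ^+ 2 * n.
have two0 := two_neq0.
have TW := sign_mod4_int T2; have TU := sign_mod4_unit TW; have T0 := local_unit_neq0 TU.
have nO := intr_local abvP n.
pose t' := T%:~R - t.
have t'U : t' \in U.
  by apply: local_unit_congr TU _; rewrite /t' addrAC subrr add0r local_maxN.
have t'0 := local_unit_neq0 t'U; have t'VO := local_unitO (local_unitV t'U).
pose mu := n%:~R / t'; have muO : mu \in O by rewrite rpredM.
have def_t : t = 2%:R * mu by rewrite /mu mulrA -Nt mulfK.
have Tt : T%:~R * t = 2%:R * n%:~R + 4%:R * mu ^+ 2.
  have : T%:~R * t = t * (T%:~R - t) + t ^+ 2 by ring.
  by rewrite Nt => ->; rewrite {1}def_t; ring.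
have combW A' B' : ~~ (2 %| A')%Z -> sign_mod4 (A'%:~R + B'%:~R * t).
  move=> A2; have -> : A'%:~R + B'%:~R * t = T%:~R^-1 *
      ((T * A' + 2 * (B' * n))%:~R + 4%:R * (B'%:~R * mu ^+ 2)).
    apply: (mulfI T0); rewrite mulVKf // mulrDr mulrCA Tt intrD !intrM; ring.
  apply/sign_mod4M/sign_mod4D; last by rewrite rpredM ?rpredX ?intr_local.
    exact: sign_mod4V.
  have even : (2 %| 2 * (B' * n))%Z by rewrite dvdz_mulr.
  apply: sign_mod4_int; rewrite (rpredDr _ even).
  by rewrite dvdzE abszM Euclid_dvdM // negb_or; move: T2 A2; rewrite !dvdzE => -> ->.
have t'W : sign_mod4 t'.
  have -> : t' = T%:~R + (-1)%:~R * t by rewrite mulN1r.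
  exact: combW.
have N_neq0 A' B' : (A' != 0) || (B' != 0) -> N A' B' != 0.
  move=> AB'; apply/eqP => N0.
  have : (A'%:~R + B'%:~R * t) * h (A'%:~R + B'%:~R * t) = 0.
    rewrite rmorphD rmorphM !rmorph_int /= ht.
    have : (N A' B')%:~R = 0 :> L by rewrite N0.
    rewrite /N !expr2 !intrD !intrM => E.
    apply/eqP; rewrite -[X in _ == X]E; apply/eqP.
    transitivity (A'%:~R ^+ 2 + A'%:~R * B'%:~R * T%:~R + B'%:~R ^+ 2 * (t * (T%:~R - t)));
      first by ring.
    by rewrite Nt; ring.
  move/eqP; rewrite mulf_eq0 fmorph_eq0 orbb => /eqP/free[A0 B0].
  by move: AB'; rewrite A0 B0 eqxx.
suff main v A' B' : (A' != 0) || (B' != 0) -> ~~ ((2 ^ v)%N %| N A' B')%Z ->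
    exists (k : int) (e : L), sign_mod4 e /\ A'%:~R + B'%:~R * t = 2%:R ^ k * e.
  apply: (main `|N A B|%N _ _ AB0); apply/negP=> /(dvdz_pow_bound (N_neq0 _ _ AB0)).
  by rewrite ltnn.
elim: v A' B' => [|v IHv] A' B' AB' nv; first by rewrite expn0 dvd1z in nv.
have [/dvdzP[A1 def_A]|A2] := boolP (2 %| A')%Z; last first.
  by exists 0, (A'%:~R + B'%:~R * t); rewrite expr0z mul1r; split; first exact: combW.
have [/dvdzP[B1 def_B]|B2] := boolP (2 %| B')%Z.
  have [||k [e [eW eq_e]]] := IHv A1 B1.
  - by move: AB'; rewrite def_A def_B !mulf_eq0 !orbF.
  - apply: contra nv => /dvdzP[q def_N]; have -> : N A' B' = 2 * (2 * N A1 B1).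
      by rewrite /N def_A def_B; ring.
    by rewrite expnS PoszM dvdz_mul // def_N mulrCA dvdz_mull // dvdz_mull.
  exists (1 + k), e; split=> //; rewrite exprzDr ?unitfE // -mulrA -eq_e.
  by rewrite def_A def_B !intrM -exprnP; ring.
(* [A'] even and [B'] odd: multiplying by the unit [t'] gives 2 ((A1 T + B' n) - A1 t), since t t' =
   2 n, and the norm form of the new pair has one factor 2 less. *)
have [||k [e [eW eq_e]]] := IHv (A1 * T + B' * n) (- A1).
- rewrite -negb_and; apply/negP=> /andP[/eqP E1 /eqP E2].
  have A10 : A1 = 0 by apply/eqP; rewrite -oppr_eq0 E2.
  move: E1; rewrite A10 mul0r add0r => /eqP; rewrite mulf_eq0.
  by case/orP=> /eqP E3; [move: B2 | move: n2]; rewrite E3 dvdz0.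
- apply: contra nv => v_N; have : ((2 ^ v.+1)%N %| N A' B' * n)%Z.
    have -> : N A' B' * n = 2 * N (A1 * T + B' * n) (- A1).
      by rewrite /N def_A; ring.
    by rewrite expnS PoszM dvdz_mul.
  by rewrite Gauss_dvdzl // coprimezE absz_nat coprimeXl // prime_coprime //.
exists (1 + k), (e / t'); split; first exact/sign_mod4M/sign_mod4V.
have -> : 2%:R ^ (1 + k) * (e / t') = 2%:R * (2%:R ^ k * e) / t'.
  by rewrite exprzDr ?unitfE // expr1z !mulrA.
rewrite -eq_e.
apply: (mulIf t'0); rewrite mulfVK //.
have -> : 2%:R * ((A1 * T + B' * n)%:~R + (- A1)%:~R * t) =
   2%:R * A1%:~R * t' + B'%:~R * (2%:R * n%:~R) :> L.
  by rewrite /t' intrD !intrM rmorphN /=; ring.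
by rewrite -Nt def_A intrM /t'; ring.
Qed.

(** Clearing denominators reduces this to integer combinations of 1 and [t], which are linearly
    independent because [h] moves [y]. *)
Lemma quadratic_sign (x : L) : x != 0 -> (exists a b : rat, x = a%:A + b%:A * y) ->
  exists (k : int) (e : L), sign_mod4 e /\ x = 2%:R ^ k * e.
Proof.
have [t [T [n [[tM T2 n2 Nt ht] [s [c [def_y c2 def_d]]]]]]] := split_generator.
have two0 := two_neq0.
have free (A B : int) : A%:~R + B%:~R * t = 0 -> A = 0 /\ B = 0.
  move=> AB0; have := congr1 h AB0.
  rewrite rmorphD rmorphM !rmorph_int rmorph0 /= ht => hAB0.
  have B0 : B = 0.
    apply/eqP; apply: contraTT (y0) => B0; rewrite negbK.
    have : B%:~R * (t - (T%:~R - t)) = 0.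
      by rewrite -[RHS](subrr 0) -{1}AB0 -hAB0; ring.
    move/eqP; rewrite mulf_eq0 intr_ext_eq0 (negPf B0) /= => /eqP tt.
    have : h y = y.
      rewrite def_y rmorphD rmorphM !rmorph_int /= ht; congr (_ + _ * _).
      by apply/eqP; rewrite eq_sym -subr_eq0 tt.
    rewrite hy => /eqP; rewrite eq_sym -addr_eq0 -mulr2n -mulr_natl mulf_eq0.
    by rewrite (negPf two0).
  split=> //; move: AB0; rewrite B0 mul0r addr0 => /eqP.
  by rewrite intr_ext_eq0 => /eqP.
have comb := int_combination_sign tM T2 n2 Nt ht free.
move=> x0 [a [b def_x]].
have da := denq_neq0 a; have db := denq_neq0 b.
have da' : (denq a)%:~R != 0 :> L by rewrite intr_ext_eq0.
have db' : (denq b)%:~R != 0 :> L by rewrite intr_ext_eq0.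
pose A := numq a * denq b + numq b * denq a * s; pose B := numq b * denq a * c.
have def_x' : x = (A%:~R + B%:~R * t) / ((denq a * denq b)%:~R + 0%:~R * t).
  by rewrite def_x !rat_algE def_y /A /B intrD !intrM; field; rewrite da' db'.
have [|k [e [eW eq_e]]] := comb A B.
  apply: contra_neqT x0; rewrite def_x' negb_or !negbK => /andP[/eqP-> /eqP->].
  by rewrite !mul0r addr0 mul0r.
have [|l [f [fW eq_f]]] := comb (denq a * denq b) 0.
  by rewrite mulf_neq0.
exists (k - l), (e / f); split; first exact/sign_mod4M/sign_mod4V.
rewrite def_x' eq_e eq_f exprzDr ?unitfE // -invr_expz.
by rewrite invfM mulrACA.
Qed.

End SplitPrime.

(** * Characters of I that extend to I<h^2> *)

Section IndexTwo.
Local Open Scope group_scope.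

Lemma abelem_functional (gT : finGroupType) (I : {group gT}) (a1 a2 a3 a4 : gT)
    (c1 c2 c3 c4 : 'F_2) :
    2.-abelem I -> #|I| = 16 -> I = <<[set a1; a2; a3; a4]>> :> {set gT} ->
  exists f : {morphism I >-> 'F_2}, [/\ f a1 = c1, f a2 = c2, f a3 = c3 & f a4 = c4].
Proof.
move=> abI cI gI.
have [phi /isomP[inj_phi im_phi] [<- <- <- <-]] := abelem_coordinates abI cI gI.
pose c (j : 'I_4) := nth (0%R : 'F_2) [:: c1; c2; c3; c4] j.
pose ell (v : 'rV['F_2]_4) : 'F_2 := (\sum_j v 0 j * c j)%R.
have ellM : {in [set: 'rV['F_2]_4] &, {morph ell : u v / u * v}}.
  move=> u v _ _; rewrite /ell; transitivity (\sum_j (u 0 j * c j + v 0 j * c j))%R.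
    by apply: eq_bigr => j _; rewrite mxE mulrDl.
  by rewrite big_split.
have ell_delta j : ell (delta_mx 0 j)%R = c j.
  rewrite /ell (bigD1 j) //= mxE !eqxx mul1r big1 ?addr0 // => i ij.
  by rewrite mxE (negPf ij) andbF mul0r.
pose f := [morphism of Morphism ellM \o invm inj_phi].
have sI : I \subset 'dom f.
  by rewrite /dom /= -im_phi; apply/subsetP=> _ /morphimP[x _ xT ->];
    rewrite !inE mem_morphim //= invmE.
exists [morphism of restrm sI f].
by split; rewrite /= /restrm /= invmE ?inE // ell_delta /c ?inordK.
Qed.

Variables (gT : finGroupType) (G I : {group gT}) (a1 a2 a3 a4 h : gT).
Hypothesis mG : wang_model G I a1 a2 a3 a4 h.

Lemma wang_index2 (c1 c2 c3 : 'F_2) : [|| c1 != 0%R, c2 != 0%R | c3 != 0%R] ->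
  exists M : {group gT},
  [/\ M \subset I <*> <[h ^+ 2]>, #|(I <*> <[h ^+ 2]>)%G : M| = 2, h ^+ 2 \in M &
   [/\ (a1 \in M) = (c1 == 0%R), (a2 \in M) = (c2 == 0%R) & (a3 \in M) = (c3 == 0%R)]].
Proof.
move=> c0; have [abI cI gI oh sdG ha1 ha2 ha3 ha4] := mG.
(* The repeated value [c2] makes [f] invariant under h^2, which sends a2 to a4, a3 to a2 a3 a4 and
   a4 to a2; so [f] extends trivially on h^2, and [M] is the kernel. *)
have [f [f1 f2 f3 f4]] := abelem_functional c1 c2 c3 c2 abI cI gI.
have sub : <[h ^+ 2]> \subset <[h]> by apply: cycleX.
have sdJ := sdprod_subr sdG sub.
have [a1I a2I a3I a4I] : [/\ a1 \in I, a2 \in I, a3 \in I & a4 \in I].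
  by rewrite gI; split; apply: mem_gen; rewrite !inE eqxx ?orbT.
have nIh := wang_norm mG.
have E x y : h * x * h^-1 = y -> x ^ h^-1 = y by rewrite conjgE invgK mulgA.
have Et1 := E _ _ ha1; have Et2 := E _ _ ha2; have Et3 := E _ _ ha3; have Et4 := E _ _ ha4.
have ord2 : forall c : 'F_2, c = 0%R \/ c = 1%R.
  by case=> [[|[|//]] ?]; [left | right]; apply: val_inj.
have stepX n x : x \in I -> f (x ^ (h^-1 ^+ 2 ^+ n)) = f x ^ (1 ^+ n).
  apply: (morph_conj_gen gI) => [|u uA]; first by rewrite groupX // groupV.
  rewrite conjg1 expgS expg1 conjgM.
  move: uA => /setUP[/setUP[/setUP[|]|]|] /set1P->.
  - by rewrite !Et1.
  - by rewrite Et2 Et3 f2 f4.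
  - rewrite Et3 Et4 !morphM ?groupM // f2 f3 f4.
    by case: (ord2 c2) => ->; case: (ord2 c3) => ->; apply: val_inj.
  - rewrite Et4 !conjMg Et2 Et3 Et4 !morphM ?groupM // f2 f3 f4.
    by case: (ord2 c2) => ->; case: (ord2 c3) => ->; apply: val_inj.
have sdV : I ><| <[h^-1 ^+ 2]> = I <*> <[h ^+ 2]> by rewrite expVgn cycleV.
have actf : {in I & <[h^-1 ^+ 2]>, morph_act 'J 'J f (trivm <[h^-1 ^+ 2]>)}.
  by move=> x _ xI /cycleP[n ->]; rewrite /= stepX // /trivm expg1n.
pose chi := sdprodm sdV actf.
have chiI x : x \in I -> chi x = f x by move=> xI; apply: sdprodmEl.
have sIJ : I \subset I <*> <[h ^+ 2]> by apply: joing_subl.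
have inM x : x \in I -> (x \in 'ker chi) = (f x == 1).
  by move=> xI; rewrite -chiI //; apply/kerP/eqP => //; apply: (subsetP sIJ).
have h2J : h ^+ 2 \in I <*> <[h ^+ 2]> by rewrite mem_gen // inE cycle_id orbT.
exists ('ker chi)%G; split.
- exact: subsetIl.
- transitivity #|chi @* (I <*> <[h ^+ 2]>)|; first by rewrite card_morphim setIid.
  have le2 : (#|chi @* (I <*> <[h ^+ 2]>)| <= 2)%N.
    by rewrite (leq_trans (max_card _)) // card_Fp.
  apply/eqP; rewrite eqn_leq le2 cardG_gt1 /=.
  have nt x : x \in I -> f x != 1 -> chi @* (I <*> <[h ^+ 2]>) != 1.
    move=> xI fx; apply/trivgPn; exists (f x) => //.
    by rewrite -chiI // mem_morphim // (subsetP sIJ).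
  by case/or3P: c0 => ci; [apply: (nt a1) | apply: (nt a2) | apply: (nt a3)]; rewrite ?f1 ?f2 ?f3.
- have e : (h^-1 ^+ 2)^-1 = h ^+ 2 by rewrite expVgn invgK.
  have : chi (h^-1 ^+ 2)^-1 = 1 by rewrite /chi sdprodmEr ?groupV ?cycle_id.
  by rewrite e => ?; apply/kerP.
- by rewrite !inM // f1 f2 f3.
Qed.
End IndexTwo.

(** * The pigeonhole contradiction *)

Section NotRealizable.
Variable L : splittingFieldType rat.
Hypothesis galL : galois 1 {:L}.
Local Notation iota := (int_alg L).
Local Notation Gamma := ('Gal({:L} / 1)%G).
Variables (I : {group gal_of {:L}}) (a1 a2 a3 a4 h : gal_of {:L}).
Hypothesis mG : wang_model Gamma I a1 a2 a3 a4 h.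

Lemma wang_kummer (c1 c2 c3 : 'F_2) : [|| c1 != 0, c2 != 0 | c3 != 0] ->
  exists y : L, [/\ y != 0, y ^+ 2 \in fixedField I, h (h y) = y &
    [/\ a1 y = (-1) ^+ c1 * y, a2 y = (-1) ^+ c2 * y & a3 y = (-1) ^+ c3 * y]].
Proof.
move=> c0; have [M [sMJ idx hM [M1 M2 M3]]] := wang_index2 mG c0.
have [y [y0 yM yJ]] := galois_quadratic sMJ idx.
have yfix := fixedP _ _ yM.
have sIJ : {subset I <= (I <*> <[h ^+ 2]>)%g} by apply/subsetP/joing_subl.
have dich g : g \in I -> g y = if g \in M then y else - y.
  by move=> gI; case: ifP => gM; [apply: yfix | apply: yJ; rewrite inE gM sIJ].
have [a1I a2I a3I] : [/\ a1 \in I, a2 \in I & a3 \in I].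
  by rewrite (wang_gen mG); split; apply: mem_gen; rewrite !inE eqxx ?orbT.
have sgn (c : 'F_2) : (-1) ^+ c * y = if c == 0 then y else - y.
  by case: c => [[|[|//]] ?]; rewrite ?mul1r // expr1 mulN1r.
exists y; split=> //.
- by apply/fixedP=> g gI; rewrite rmorphXn /= dich //; case: ifP; rewrite ?sqrrN.
- by rewrite gal_comp -[(h * h)%g]/(h ^+ 2)%g yfix.
- by rewrite !dich // M1 M2 M3 !sgn.
Qed.

Lemma wang_not_inertia (P : L -> Prop) (abvP : prime_above iota 2 P) :
  (forall g : gal_of {:L}, g \in I <-> (forall x, integralOver iota x -> P (g x - x))) ->
  False.
Proof.
move=> inertiaE.
have [y [d [y0 yI y2 hy sqf]]] := wang_discriminant galL mG.
have d8 : (d %% 8)%Z = 1.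
  by apply: (discriminant_mod8 galL mG abvP _ y0 yI y2 hy sqf) => g /inertiaE.
have two0 := two_neq0 L.
have kum (c : 'F_2 * 'F_2 * 'F_2) : exists z : L,
    [/\ z != 0, z ^+ 2 \in fixedField I, h (h z) = z &
    [/\ a1 z = (-1) ^+ c.1.1 * z, a2 z = (-1) ^+ c.1.2 * z & a3 z = (-1) ^+ c.2 * z]].
  case: c => [[c1 c2] c3] /=.
  have [c0|] := boolP [|| c1 != 0, c2 != 0 | c3 != 0]; first exact: wang_kummer.
  rewrite !negb_or !negbK => /and3P[/eqP-> /eqP-> /eqP->].
  (* The trivial character is given by the square root 1. *)
  by exists 1; rewrite oner_neq0 expr1n rpred1 !rmorph1 !mul1r.
have cls (c : 'F_2 * 'F_2 * 'F_2) : exists b : bool * bool, exists z : L,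
    [/\ z != 0, a1 z = (-1) ^+ c.1.1 * z, a2 z = (-1) ^+ c.1.2 * z, a3 z = (-1) ^+ c.2 * z
      & exists (k : int) (b0 : L), b0 \in local_ring abvP /\
        z ^+ 2 = (2%:R ^ k) ^+ 2 * 2%:R ^+ b.1 * ((-1) ^+ b.2 * (1 + 4%:R * b0))].
  have [z [z0 zI hz [z1 z2 z3]]] := kum c.
  have [||k [e [eW def_z]]] := @quadratic_sign L P abvP h y d y0 y2 hy d8 (z ^+ 2).
  - by rewrite expf_neq0.
  - by apply: (wang_quadratic_field galL mG y0 yI hy) => //; rewrite !rmorphXn /= hz.
  have [b0 b0O eq_e] := eW.
  have [b2 [b1 [b1O def_e]]] : exists (s : bool) b1, b1 \in local_ring abvP /\ e = (-1) ^+ s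
    * (1 + 4%:R * b1).
    case: eq_e => ->; [exists false, b0 | exists true, (- b0)]; split; rewrite ?rpredN //.
      by rewrite mul1r.
    by rewrite expr1; ring.
  have [r def_k] := int_parity k.
  exists (k != r + r, b2), z; split=> //; exists r, b1; split=> //; rewrite def_z -def_e.
  case: def_k => ->; rewrite ?eqxx /=.
    by rewrite expr0 mulr1 expr2 -exprzDr ?unitfE.
  have -> : r + r + 1 != r + r by rewrite eq_sym int_odd_neq.
  by rewrite expr1 expr2 !exprzDr ?unitfE // expr1z.
have [bin binP] := choice cls.
(* Eight characters against four classes: the parity of k and the sign modulo 4. *)
have ninj : ~ injective bin.
  by move=> /leq_card; rewrite !card_prod card_bool card_Fp.
have [c [c' [cc' eq_bin]]] : exists c c', c <> c' /\ bin c = bin c'.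
  apply: contrapT => noc; apply: ninj => c c' eq_c.
  by apply: contrapT => cc'; apply: noc; exists c, c'.
have [z [z0 z1 z2 z3 [k [b [bO def_z]]]]] := binP c.
have [z' [z'0 z'1 z'2 z'3 [k' [b' [b'O def_z']]]]] := binP c'.
(* Equal classes make the parities add up to an even power of 2 and the signs cancel, so w^2 is 1
   modulo 4. *)
pose w := z * z' / (2%:R ^ k * 2%:R ^ k' * 2%:R ^+ (bin c).1).
have pow2 (i : int) : (2%:R : L) ^ i != 0 by rewrite expfz_neq0.
have pow2' (i : nat) : (2%:R : L) ^+ i != 0 by rewrite expf_neq0.
pose B := b + b' + 4%:R * b * b'.
have w2 : w ^+ 2 = 1 + 4%:R * B.
  have sgn2 : (-1) ^+ (bin c).2 * (-1) ^+ (bin c).2 = 1 :> L by rewrite -expr2 sqrr_sign.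
  transitivity (((-1) ^+ (bin c).2 * (-1) ^+ (bin c).2) * (1 + 4%:R * b) * (1 + 4%:R * b')).
    have := pow2 k; have := pow2 k'; have := pow2' (bin c).1.
    rewrite /w expr_div_n !exprMn def_z def_z' -eq_bin.
    move: (2%:R ^+ _) (2%:R ^ k) (2%:R ^ k') ((-1) ^+ _) => p q q' s p0 q0 q'0.
    by field; rewrite p0 q0 q'0.
  by rewrite sgn2 /B; ring.
have BO : B \in local_ring abvP.
  by rewrite /B !rpredD // !rpredM // rpred_nat.
have wO : w \in local_ring abvP.
  apply: (@local_monic2 _ _ _ _ _ abvP w 0 (1 + 4%:R * B)); rewrite ?rpred0 //.
    by rewrite rpredD ?rpred1 // rpredM ?rpred_nat.
  by rewrite mul0r subr0 w2 subrr.
(* (1 + w) / 2 is a root of X^2 - X - B. An inertia element [s] with s w = -w moves it by -w, which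
   would put the unit [w] in [M]. *)
have xO : (1 + w) / 2%:R \in local_ring abvP.
  apply: (@local_monic2 _ _ _ _ _ abvP _ 1 B); rewrite ?rpred1 //.
  transitivity ((w ^+ 2 - (1 + 4%:R * B)) / 4%:R).
    by field; rewrite two0 ?andbT -[4%:R]/(2 * 2)%:R ?natrM ?mulf_neq0.
  by rewrite w2 subrr mul0r.
have [s sI sw] : exists2 s : gal_of {:L}, s \in I & s w = - w.
  have flip (g : gal_of {:L}) (u u' : 'F_2) : g z = (-1) ^+ u * z -> g z' = (-1) ^+ u' * z' ->
      u <> u' -> g w = - w.
    move=> gz gz' uu'; rewrite /w fmorph_div !rmorphM !fmorphXz !rmorphXn /= !rmorph_nat gz gz'.
    have -> : (-1) ^+ u * z * ((-1) ^+ u' * z') = - (z * z').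
      move: u u' uu' {gz gz'} => [[|[|//]] ?] [[|[|//]] ?] //= uu'; rewrite ?expr0 ?expr1;
        try by case: uu'; apply: val_inj.
      - by ring.
      - by ring.
    by rewrite mulNr.
  have [a1I a2I a3I] : [/\ a1 \in I, a2 \in I & a3 \in I].
    by rewrite (wang_gen mG); split; apply: mem_gen; rewrite !inE eqxx ?orbT.
  have [c1|/eqP c1] := eqVneq c.1.1 c'.1.1; last by exists a1 => //; apply: flip z1 z'1 c1.
  have [c2|/eqP c2] := eqVneq c.1.2 c'.1.2; last by exists a2 => //; apply: flip z2 z'2 c2.
  exists a3 => //; apply: flip z3 z'3 _ => c3; apply: cc'.
  have ext (u v : 'F_2 * 'F_2 * 'F_2) : u.1.1 = v.1.1 -> u.1.2 = v.1.2 -> u.2 = v.2 -> u = v.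
    by case: u v => [[? ?] ?] [[? ?] ?] /= -> -> ->.
  exact: ext.
have sx := local_inertia (@gal_integral _ _ _ _ s) ((inertiaE s).1 sI) xO.
have wM : w \in local_max abvP.
  have -> : w = - (s ((1 + w) / 2%:R) - (1 + w) / 2%:R).
    by rewrite fmorph_div rmorphD rmorph1 rmorph_nat /= sw; field.
  exact: local_maxN.
case/negP: (local_max1 abvP); rewrite -[1](addrK (4%:R * B)) -w2.
by rewrite local_maxB // ?expr2 local_maxMl ?four_max.
Qed.

End NotRealizable.

Section Transport.
Local Open Scope group_scope.

Lemma wang_model_injm (gT rT : finGroupType) (G I : {group gT}) a1 a2 a3 a4 h
    (f : {morphism G >-> rT}) : 'injm f ->
    wang_model G I a1 a2 a3 a4 h ->
  wang_model (f @* G) (f @* I) (f a1) (f a2) (f a3) (f a4) (f h).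
Proof.
move=> injf [abI cI gI oh sdG ha1 ha2 ha3 ha4].
have [/andP[sIG _] sHG _ _ _] := sdprod_context sdG.
have hG : h \in G by rewrite -cycle_subG.
have [a1I a2I a3I a4I] : [/\ a1 \in I, a2 \in I, a3 \in I & a4 \in I].
  by rewrite gI; split; apply: mem_gen; rewrite !inE eqxx ?orbT.
have [a1G a2G a3G a4G] : [/\ a1 \in G, a2 \in G, a3 \in G & a4 \in G].
  by split; apply: (subsetP sIG).
have conj x y : x \in G -> h * x * h^-1 = y -> f h * f x * (f h)^-1 = f y.
  by move=> xG <-; rewrite !morphM ?groupM ?groupV // morphV.
split.
- by rewrite morphim_abelem.
- by rewrite card_injm.
- rewrite /= [in LHS]gI morphim_gen -?gI //; last first.
    by apply: subset_trans sIG; rewrite gI subset_gen.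
  congr <<_>>; rewrite !morphimU ?morphim_set1 //.
- by rewrite order_injm.
- by rewrite -morphim_cycle //; apply: injm_sdprod sdG.
- exact: conj.
- exact: conj.
- exact: conj.
- by rewrite (conj _ _ a4G ha4) !morphM ?groupM.
Qed.
End Transport.

Lemma mem_gal1 (F : fieldType) (L : splittingFieldType F) (g : gal_of {:L}) :
  g \in 'Gal({:L} / 1)%g.
Proof.
rewrite gal_kHom ?sub1v //; apply/kAHomP => _ /vlineP[a ->].
by rewrite linearZ /= rmorph1.
Qed.

Lemma wang_not_Q_realizable (gT : finGroupType) (G I : {group gT}) a1 a2 a3 a4 h :
  wang_model G I a1 a2 a3 a4 h -> ~ Q_realizable G I 2.
Proof.
move=> mG [L [galL [P abvP [f /isomP[injf im_f] f_inertia]]]].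
have defG : G = (f @* 'Gal({:L} / 1))%G by apply: val_inj; rewrite /= im_f.
rewrite defG in mG; have mGal := wang_model_injm (injm_invm injf) mG.
have defGal : (invm injf @* (f @* 'Gal({:L} / 1)))%G = 'Gal({:L} / 1)%G.
  by apply: val_inj; rewrite /= im_invm.
rewrite defGal in mGal; set J := (invm injf @* I)%G in mGal.
apply: (wang_not_inertia galL mGal (P := P) abvP) => g.
have -> : (g \in J) = (f g \in I).
  apply/idP/idP => [/morphimP[x xG xI ->]|fgI]; first by rewrite invmK.
  by rewrite -(invmE injf (mem_gal1 g)) mem_morphim // mem_morphim // mem_gal1.
rewrite -f_inertia; split=> [/imsetP[s]|gP].
  rewrite inE => /andP[sG /asboolP sP] /(injmP injf) -> //; exact: mem_gal1.
apply/imsetP; exists g => //; rewrite inE mem_gal1; exact/asboolP.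
Qed.

(** * Existence over Q_2 *)

Section TwoAdicIntegers.
Implicit Types x y z : Z2.

Lemma padic2_addE x y n : (x + y) n = ((x n + y n) %% (2 ^ n)%N)%Z.
Proof. by []. Qed.
Lemma padic2_mulE x y n : (x * y) n = ((x n * y n) %% (2 ^ n)%N)%Z.
Proof. by []. Qed.
Lemma padic2_oppE x n : (- x) n = ((- x n) %% (2 ^ n)%N)%Z.
Proof. by []. Qed.

Lemma padic2_zeroE n : (0 : Z2) n = 0.
Proof. by rewrite -[0 : Z2]/(padic_zero (isT : prime 2)) /= mod0z. Qed.

Lemma padic2_natE m n : (m%:R : Z2) n = (m %% (2 ^ n)%N)%Z.
Proof.
elim: m => [|m IHm]; first by rewrite padic2_zeroE mod0z.
by rewrite -natr1 padic2_addE IHm modzDmr modzDml -PoszD addn1.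
Qed.

Lemma padic2_nat_neq0 m : (0 < m)%N -> (m%:R : Z2) != 0.
Proof.
move=> m_gt0; apply/eqP => /(congr1 (fun x : Z2 => x m)).
rewrite padic2_natE [X in _ = X]padic2_zeroE => /dvdz_mod0P.
by rewrite dvdzE => /dvdn_leq - /(_ m_gt0); rewrite leqNgt ltn_expl.
Qed.

Lemma padic2_residue1 x : x 1%N = 0 \/ x 1%N = 1.
Proof.
rewrite -(residue_mod x 1) expn1.
have : 0 <= (x 1%N %% 2)%Z < 2 by rewrite modz_ge0 // ltz_mod.
by case: (x 1%N %% 2)%Z => [[|[|m]]|m] //; [left | right].
Qed.

Lemma padic2_even x : x 1%N = 0 -> exists y, x = 2%:R * y.
Proof.
move=> x1; have x_even n : (2 %| x n.+1)%Z.
  by apply/dvdz_mod0P; have := residue_le x (isT : (1 <= n.+1)%N); rewrite expn1 x1.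
(* Halving costs one digit, so the n-th residue of the half is read from the residue of index n +
   1. *)
have coh n : ((x n.+2 %/ 2)%Z = (x n.+1 %/ 2)%Z %[mod (2 ^ n)%N])%Z.
  have /dvdzP[q def_q] := x_even n.+1; have /dvdzP[r def_r] := x_even n.
  rewrite def_q def_r !mulzK //; apply/eqP.
  rewrite eqz_mod_dvd -(@dvdz_mul2r 2) // -PoszM -expnSr mulrBl -def_q -def_r.
  by rewrite -eqz_mod_dvd residueS residue_mod.
exists (padic_of (isT : prime 2) coh); apply: residueP => n.
rewrite padic2_mulE padic2_natE /= modzMml modzMmr.
by have /dvdzP[q def_q] := x_even n; rewrite def_q mulzK // mulrC -def_q residueS.
Qed.

Lemma padic2_decomposition x : x != 0 -> exists k y, x = 2%:R ^+ k * y /\ y 1%N = 1.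
Proof.
move/padic_neq0P=> [n]; elim: n x => [|n IHn] x xn.
  by move: xn; rewrite -(residue_mod x 0) expn0 modz1.
have [x1|x1] := padic2_residue1 x; last by exists 0%N, x; rewrite mul1r.
have [y def_x] := padic2_even x1.
have [|k [z [def_y z1]]] := IHn y.
  apply: contra xn => /eqP yn; rewrite def_x padic2_mulE padic2_natE modzMml.
  apply/eqP/dvdz_mod0P; rewrite expnS PoszM dvdz_mul2l //.
  by apply/dvdz_mod0P; rewrite residueS yn.
by exists k.+1, z; rewrite def_x def_y mulrA -exprS.
Qed.

Lemma padic2_odd x : x 1%N = 1 -> exists y, x = 1 + 2%:R * y.
Proof.
move=> x1; have [|y def_y] := @padic2_even (x - 1).
  by rewrite padic2_addE padic2_oppE x1.
by exists y; rewrite -def_y addrC subrK.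
Qed.

Lemma padic2_two_nonunit x : 2%:R * x <> 1.
Proof. by move/(congr1 (fun x : Z2 => x 1%N)); rewrite padic2_mulE padic2_natE mul0r. Qed.

(* A root of [w ^+ 2 + w - 4] gives a square root of 17; since the derivative
   is odd, [u - f u] is a Newton step. *)
Lemma padic2_sqrt17 : exists w : Z2, w ^+ 2 + w = 4%:R.
Proof.
pose f (u : int) := u * u + u - 4; pose u n := iter n (fun u => u - f u) 0.
have u_even n : (2 %| u n)%Z.
  elim: n => //= n /dvdzP[q ->]; apply/dvdzP.
  by exists (2 - 2 * q * q); rewrite /f; ring.
have fu n : ((2 ^ n)%N %| f (u n))%Z.
  elim: n => [|n IHn]; first by rewrite dvd1z.
  have -> : f (u n.+1) = f (u n) * (f (u n) - 2 * u n) by rewrite -[u n.+1]/(u n - f (u n));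
    move: (u n) => v; rewrite /f; ring.
  rewrite expnSr PoszM dvdz_mul //; apply/dvdzP.
  have /dvdzP[q ->] := u_even n; exists (2 * q * q - q - 2); rewrite /f; ring.
have coh n : (u n.+1 = u n %[mod (2 ^ n)%N])%Z.
  by apply/eqP; rewrite eqz_mod_dvd /= addrAC subrr add0r rpredN.
exists (padic_of (isT : prime 2) coh); apply: residueP => n.
rewrite padic2_addE expr2 padic2_mulE padic2_natE /=.
rewrite modzMml modzMmr modzDml modzDmr; apply/eqP.
by rewrite eqz_mod_dvd fu.
Qed.

End TwoAdicIntegers.

(** * Construction of splitting fields *)

Local Definition map_alg (F : fieldType) (L : fieldExtType F) :=
  map_poly (in_alg L) : {poly F} -> {poly L}.

Lemma exists_irreducible_factor (F : fieldType) (p : {poly F}) : (1 < size p)%N ->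
  exists2 r, r %| p & irreducible_poly r.
Proof.
have [n] := ubnP (size p); elim: n p => // n IHn p le_pn p_gt1.
have p0 : p != 0 by rewrite -size_poly_gt0 ltnW.
have [irr_p|] := pselect (irreducible_poly p); first by exists p; rewrite ?dvdpp.
move=> red_p; have [q [q1 qp nqp]] : exists q : {poly F}, [/\ size q != 1%N, q %| p & ~~ (q %= p)].
  apply: contrapT => noq; apply: red_p; split=> // q q1 qp.
  by apply: contrapT => /negP nqp; apply: noq; exists q.
have q0 : q != 0 by apply: contraTneq qp => ->; rewrite dvd0p.
have lt_qp : (size q < size p)%N.
  by rewrite ltn_neqAle dvdp_leq // andbT dvdp_size_eqp.
have [||r rq irr_r] := IHn q.
- by apply: leq_trans lt_qp _; rewrite -ltnS.
- by rewrite ltn_neqAle eq_sym q1 size_poly_gt0.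
by exists r => //; apply: dvdp_trans rq qp.
Qed.

Lemma exists_splitting_extension (F : fieldType) (p : {poly F}) : p != 0 ->
  exists (L : fieldExtType F) (zs : seq L), map_alg L p %= \prod_(z <- zs) ('X - z%:P).
Proof.
have [n] := ubnP (size p); elim: n F p => // n IHn F p lt_pn p0.
have [le_p1|gt_p1] := leqP (size p) 1.
  by exists F^o, nil; rewrite big_nil -size_poly_eq1 size_map_poly eqn_leq le_p1 size_poly_gt0.
have [r rp irr_r] := exists_irreducible_factor gt_p1.
have [K _ [x rx _]] := irredp_FAdjoin irr_r.
have px : root (map_alg K p) x.
  rewrite -dvdp_XsubCl; apply: (@dvdp_trans _ (map_alg K r)); first by rewrite dvdp_XsubCl.
  by rewrite dvdp_map.
have /factor_theorem[q def_p] := px.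
have q0 : q != 0.
  by apply: contra_neq p0 => q0; apply/eqP; rewrite -(map_poly_eq0 (in_alg K)) -/(map_alg K p)
    def_p q0 mul0r.
have lt_qn : (size q < n)%N.
  have := congr1 (fun f : {poly K} => size f) def_p.
  rewrite size_map_poly size_mul ?polyXsubC_eq0 // size_XsubC addn2 /= => size_p.
  by rewrite -ltnS -size_p.
have [L [zs split_q]] := IHn K q lt_qn q0.
exists (baseFieldType L), (x%:A :: zs).
have -> : map_alg (baseFieldType L) p = map_alg L (map_alg K p).
  by rewrite /map_alg -map_poly_comp; apply: eq_map_poly => a; apply: baseField_scaleE.
rewrite def_p [map_alg L _]rmorphM /= big_cons mulrC.
by rewrite rmorphB /= map_polyX map_polyC eqp_mull.
Qed.

Lemma exists_splitting_field (F : fieldType) (p : {poly F}) : p != 0 ->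
  exists L : splittingFieldType F, splittingFieldFor 1 (map_poly (in_alg L) p) {:L}.
Proof.
move=> p0; have [L [ys split_p]] := exists_splitting_extension p0.
(* The iterated extension may be too large; the subfield generated by the roots is the splitting
   field. *)
pose E := <<1 & ys>>%AS; pose K : fieldExtType F := subvs_of E.
pose zs := [seq vsproj E y | y <- ys].
have val_zs : map (vsval : K -> L) zs = ys.
  rewrite -map_comp -[RHS]map_id; apply/eq_in_map => y y_ys.
  by rewrite /= vsprojK // seqv_sub_adjoin.
have splitK : splittingFieldFor 1 (map_alg K p) {:K}.
  exists zs.
    rewrite -(eqp_map (vsval : {rmorphism K -> L})) rmorph_prod -map_poly_comp.
    rewrite (eq_map_poly (g := in_alg L)) => [|a]; last exact: rmorph_alg.
    rewrite -val_zs big_map in split_p; rewrite (eq_bigr (fun z => 'X - (vsval z)%:P)) // => z _.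
    by rewrite rmorphB /= map_polyX map_polyC.
  apply/vspaceP => u; rewrite memvf; pose f := linfun (vsval : K -> L).
  have : f u \in (f @: <<1 & zs>>)%VS.
    rewrite aimg_adjoin_seq aimg1 (eq_map (lfunE _)) val_zs lfunE; exact: valP u.
  by case/memv_imgP => v v_zs; rewrite !lfunE => /val_inj ->.
have axK : SplittingField.axiom K.
  exists (map_alg K p) => //; apply/polyOverP => i.
  by rewrite coef_map /= rpredZ ?mem1v.
by exists (HB.pack K (FieldExt_isSplittingField.Build F K axK) : splittingFieldType F).
Qed.

(** * Identities among 17th roots of unity *)

Section Cyclotomic17.
Variables (R : comNzRingType) (z : R).

Definition Phi17 (x : R) := \sum_(i < 17) x ^+ i.

(* The exponents are the powers of 2 modulo 17. *)
Definition residue_period (x : R) :=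
  x + x ^+ 2 + x ^+ 4 + x ^+ 8 + x ^+ 9 + x ^+ 13 + x ^+ 15 + x ^+ 16.

(* At a 17th root of unity [x], this is (x + 1/x) (x^2 + 1/x^2). *)
Definition cyclotomic_unit (x : R) := (x + x ^+ 16) * (x ^+ 2 + x ^+ 15).
Local Notation u := cyclotomic_unit.

Hypothesis z_root : Phi17 z = 0.

Let Phi_eq0 : 1 + z + z ^+ 2 + z ^+ 3 + z ^+ 4 + z ^+ 5 + z ^+ 6 + z ^+ 7 + z ^+ 8
  + z ^+ 9 + z ^+ 10 + z ^+ 11 + z ^+ 12 + z ^+ 13 + z ^+ 14 + z ^+ 15 + z ^+ 16 = 0.
Proof. by rewrite -[RHS]z_root /Phi17 !big_ord_recr big_ord0 /= add0r expr0 expr1. Qed.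

Lemma Phi17_expr : z ^+ 17 = 1.
Proof. by apply/eqP; rewrite -subr_eq0 subrX1 -/(Phi17 z) z_root mulr0. Qed.

Lemma Phi17_expr_mod m k : z ^+ (17 * m + k) = z ^+ k.
Proof. by rewrite exprD exprM Phi17_expr expr1n mul1r. Qed.

Lemma Phi17_sqr : Phi17 (z ^+ 2) = 0.
Proof.
rewrite /Phi17 !big_ord_recr big_ord0 /= -!exprM.
rewrite (Phi17_expr_mod 1 1 : z ^+ (2 * 9) = _) (Phi17_expr_mod 1 3 : z ^+ (2 * 10) = _)
  (Phi17_expr_mod 1 5 : z ^+ (2 * 11) = _) (Phi17_expr_mod 1 7 : z ^+ (2 * 12) = _)
  (Phi17_expr_mod 1 9 : z ^+ (2 * 13) = _) (Phi17_expr_mod 1 11 : z ^+ (2 * 14) = _)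
  (Phi17_expr_mod 1 13 : z ^+ (2 * 15) = _) (Phi17_expr_mod 1 15 : z ^+ (2 * 16) = _).
by rewrite -[RHS]Phi_eq0; ring.
Qed.

Lemma Phi17_cube : Phi17 (z ^+ 3) = 0.
Proof.
rewrite /Phi17 !big_ord_recr big_ord0 /= -!exprM.
rewrite (Phi17_expr_mod 1 1 : z ^+ (3 * 6) = _) (Phi17_expr_mod 1 4 : z ^+ (3 * 7) = _)
  (Phi17_expr_mod 1 7 : z ^+ (3 * 8) = _) (Phi17_expr_mod 1 10 : z ^+ (3 * 9) = _)
  (Phi17_expr_mod 1 13 : z ^+ (3 * 10) = _) (Phi17_expr_mod 1 16 : z ^+ (3 * 11) = _)
  (Phi17_expr_mod 2 2 : z ^+ (3 * 12) = _) (Phi17_expr_mod 2 5 : z ^+ (3 * 13) = _)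
  (Phi17_expr_mod 2 8 : z ^+ (3 * 14) = _) (Phi17_expr_mod 2 11 : z ^+ (3 * 15) = _)
  (Phi17_expr_mod 2 14 : z ^+ (3 * 16) = _).
by rewrite -[RHS]Phi_eq0; ring.
Qed.

(* Here and below, the polynomial appearing in the proof is the quotient by
   [Phi17] of the difference of both sides. *)
Lemma residue_period_eq : residue_period z ^+ 2 + residue_period z = 4%:R.
Proof.
apply/eqP; rewrite -subr_eq0 -[X in _ == X](mul0r (- 4%:R + 5%:R * z + z ^+ 2 - 2%:R * z ^+ 7
  + 2%:R * z ^+ 8 + z ^+ 9 + z ^+ 10 - 2%:R * z ^+ 11 + z ^+ 13 - z ^+ 14 + z ^+ 15 + z ^+ 16))
  -Phi_eq0.
by apply/eqP; rewrite /residue_period; ring.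
Qed.

Lemma residue_period_sqr : residue_period (z ^+ 2) = residue_period z.
Proof.
rewrite /residue_period -!exprM.
rewrite (Phi17_expr_mod 1 1 : z ^+ (2 * 9) = _) (Phi17_expr_mod 1 9 : z ^+ (2 * 13) = _)
  (Phi17_expr_mod 1 13 : z ^+ (2 * 15) = _) (Phi17_expr_mod 1 15 : z ^+ (2 * 16) = _) expr1.
by ring.
Qed.

(** 3 is not a square modulo 17, so cubing exchanges the two quadratic periods, whose sum is -1. *)
Lemma residue_period_cube : residue_period (z ^+ 3) = - 1 - residue_period z.
Proof.
rewrite /residue_period -!exprM.
rewrite (Phi17_expr_mod 1 7 : z ^+ (3 * 8) = _) (Phi17_expr_mod 1 10 : z ^+ (3 * 9) = _)
  (Phi17_expr_mod 2 5 : z ^+ (3 * 13) = _) (Phi17_expr_mod 2 11 : z ^+ (3 * 15) = _)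
  (Phi17_expr_mod 2 14 : z ^+ (3 * 16) = _).
by apply/eqP; rewrite -subr_eq0 -[X in _ == X]Phi_eq0; apply/eqP; ring.
Qed.

Lemma cyclotomic_unit2 : u (z ^+ 2) = (z ^+ 2 + z ^+ 15) * (z ^+ 4 + z ^+ 13).
Proof.
by rewrite /u -!exprM (Phi17_expr_mod 1 15 : z ^+ (2 * 16) = _)
  (Phi17_expr_mod 1 13 : z ^+ (2 * 15) = _).
Qed.

Lemma cyclotomic_unit4 : u (z ^+ 4) = (z ^+ 4 + z ^+ 13) * (z ^+ 8 + z ^+ 9).
Proof.
by rewrite /u -!exprM (Phi17_expr_mod 3 13 : z ^+ (4 * 16) = _)
  (Phi17_expr_mod 3 9 : z ^+ (4 * 15) = _).
Qed.

Lemma cyclotomic_unit8 : u (z ^+ 8) = (z ^+ 8 + z ^+ 9) * (z ^+ 16 + z).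
Proof.
by rewrite /u -!exprM (Phi17_expr_mod 0 16 : z ^+ (8 * 2) = _)
  (Phi17_expr_mod 7 9 : z ^+ (8 * 16) = _) (Phi17_expr_mod 7 1 : z ^+ (8 * 15) = _) expr1.
Qed.

(** The left side is the product of z^(2^k) + z^(-2^k) for k < 4, which telescopes to (z^16 -
    z^(-16)) / (z - z^(-1)) = -1. *)
Lemma cyclotomic_unit_norm : u z * u (z ^+ 4) = - 1.
Proof.
rewrite cyclotomic_unit4; apply/eqP; rewrite -subr_eq0
  -[X in _ == X](mul0r (1 - z + z ^+ 15 - z ^+ 18 + z ^+ 24 - z ^+ 26 + z ^+ 28 - z ^+ 35
  + z ^+ 37)) -Phi_eq0.
by apply/eqP; rewrite /u; ring.
Qed.

Lemma cyclotomic_unit_sum : u z + u (z ^+ 2) + u (z ^+ 4) + u (z ^+ 8) = - 1.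
Proof.
rewrite cyclotomic_unit2 cyclotomic_unit4 cyclotomic_unit8.
apply/eqP; rewrite -subr_eq0 -[X in _ == X](mul0r (1 - z + z ^+ 3 - z ^+ 4 + z ^+ 6 - z ^+ 7
  + z ^+ 9 - z ^+ 11 + z ^+ 12 - z ^+ 14 + z ^+ 15)) -Phi_eq0.
by apply/eqP; rewrite /u; ring.
Qed.

Lemma cyclotomic_unit_sym2 :
  (u z + u (z ^+ 4)) * (u (z ^+ 2) + u (z ^+ 8)) = - 5%:R - 2%:R * residue_period z.
Proof.
rewrite cyclotomic_unit2 cyclotomic_unit4 cyclotomic_unit8.
apply/eqP; rewrite -subr_eq0 -[X in _ == X](mul0r (5%:R - 3%:R * z - 2%:R * z ^+ 3 + 2%:R
  * z ^+ 4 - 2%:R * z ^+ 5 + 2%:R * z ^+ 8 + z ^+ 9 - 3%:R * z ^+ 10 + z ^+ 12 + 2%:R * z ^+ 13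
  - 3%:R * z ^+ 14 + 2%:R * z ^+ 15 + 3%:R * z ^+ 17 - z ^+ 18 - z ^+ 19 - 3%:R * z ^+ 20 + 3%:R
  * z ^+ 21 + z ^+ 22 - 3%:R * z ^+ 23 + 2%:R * z ^+ 25 + z ^+ 26 - 3%:R * z ^+ 29 + 3%:R
  * z ^+ 30 + z ^+ 31 - z ^+ 32 - z ^+ 33 + 2%:R * z ^+ 34 - z ^+ 38 + z ^+ 40 - z ^+ 42
  + z ^+ 43)) -Phi_eq0.
by apply/eqP; rewrite /u /residue_period; ring.
Qed.

End Cyclotomic17.

Lemma Q2_natr_neq0 n : (0 < n)%N -> (n%:R : Q2) != 0.
Proof.
by move=> n_gt0; rewrite -(rmorph_nat (@tofrac Z2)) tofrac_eq0 padic2_nat_neq0.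
Qed.

Lemma Q2_ext_natr_neq0 (L : splittingFieldType Q2) n : (0 < n)%N -> (n%:R : L) != 0.
Proof.
by move=> n_gt0; rewrite -(rmorph_nat (in_alg L)) fmorph_eq0 Q2_natr_neq0.
Qed.

Lemma Q2_ext_galois (L : splittingFieldType Q2) : galois 1 {:L}.
Proof.
rewrite /galois sub1v normalFieldf andbT /=; apply/separableP => x _.
apply: pcharf0_separable; apply/pcharf0P => n; case: n => [|n]; first by rewrite !eqxx.
by rewrite (negPf (Q2_ext_natr_neq0 L (ltn0Sn n))).
Qed.

Lemma root_of_split_divisor (K : fieldType) (p q : {poly K}) (rs : seq K) :
  p %= \prod_(x <- rs) ('X - x%:P) -> q %| p -> (1 < size q)%N -> exists x, root q x.
Proof.
move=> splitp qp q_gt1.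
have : q %| \prod_(x <- rs) ('X - x%:P) by rewrite -(eqp_dvdr _ splitp).
case/dvdp_prod_XsubC => m; case: (mask m rs) => [|x s] eq_q.
  by move: q_gt1; rewrite (eqp_size eq_q) big_nil size_poly1.
by exists x; rewrite (eqp_root eq_q) root_prod_XsubC mem_head.
Qed.

(** * The splitting field over Q_2 *)

Section Construction.
Variables (w : Z2) (w_eq : w ^+ 2 + w = 4%:R).
Let W : Q2 := @tofrac Z2 w.

(** The quartic with roots u_0, u_1, u_2, u_3, evaluated at X^2. Its only coefficient outside Z is
    given by the period, which is in Q_2 since 17 is a square there. *)
Definition square_poly (K : fieldType) (a : K) : {poly K} :=
  'X^8 + 'X^6 - a *: 'X^4 - 'X^2 + 1.

Definition wang_poly : {poly Q2} :=
  Phi17 ('X : {poly Q2}) * ('X^2 - 2%:R) * ('X^2 + 1) * square_poly (7%:R + 2%:R * W).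

Lemma size_Phi17 (K : fieldType) : size (Phi17 ('X : {poly K})) = 17%N.
Proof.
rewrite -[RHS](size_polyXn K 16) /Phi17 big_ord_recr /= addrC size_polyDl //.
rewrite size_polyXn ltnS; apply/leq_sizeP => j le_16j; rewrite coef_sum big1 // => k _.
by rewrite coefXn gtn_eqF // (leq_trans (ltn_ord k)).
Qed.

Lemma size_X2D (K : fieldType) (a : K) : size ('X^2 + a%:P) = 3%N.
Proof.
by rewrite size_polyDl size_polyXn // (leq_ltn_trans (size_polyC_leq1 _)).
Qed.

Lemma square_poly_neq0 (K : fieldType) (a : K) : square_poly a != 0.
Proof.
apply/eqP => /(congr1 (fun p : {poly K} => p`_8)).
rewrite /square_poly !(coefD, coefN, coefZ, coefXn, coef1) /= coef0 => /eqP.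
by rewrite mulr0 !(addr0, subr0) oner_eq0.
Qed.

Lemma wang_poly_neq0 : wang_poly != 0.
Proof.
rewrite !mulf_neq0 ?square_poly_neq0 //.
- by rewrite -size_poly_eq0 size_Phi17.
- by rewrite -size_poly_eq0 -(rmorph_nat polyC) -polyCN size_X2D.
- by rewrite -size_poly_eq0 -polyC1 size_X2D.
Qed.

Lemma square_poly_factor (K : fieldType) (z : K) : Phi17 z = 0 ->
  square_poly (7%:R + 2%:R * residue_period z) =
  ('X^2 - (cyclotomic_unit z)%:P) * ('X^2 - (cyclotomic_unit (z ^+ 2))%:P) *
  ('X^2 - (cyclotomic_unit (z ^+ 4))%:P) * ('X^2 - (cyclotomic_unit (z ^+ 8))%:P).
Proof.
move=> z0.
have z20 := Phi17_sqr z0.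
have N0 := cyclotomic_unit_norm z0.
have N1 : cyclotomic_unit (z ^+ 2) * cyclotomic_unit (z ^+ 8) = -1.
  by rewrite -(cyclotomic_unit_norm z20) -exprM.
have S1 := cyclotomic_unit_sum z0; have S2 := cyclotomic_unit_sym2 z0.
move: (cyclotomic_unit z) (cyclotomic_unit (z ^+ 2)) (cyclotomic_unit (z ^+ 4))
  (cyclotomic_unit (z ^+ 8)) (residue_period z) N0 N1 S1 S2 => a b c d e N0 N1 S1 S2.
transitivity ('X^8 - (a + b + c + d) *: 'X^6 + ((a + c) * (b + d) + a * c + b * d) *: 'X^4
  - (a * c * (b + d) + b * d * (a + c)) *: 'X^2 + (a * c * (b * d))%:P).
  rewrite N0 N1 S1 S2 /square_poly.
  have -> : -1 * (b + d) + -1 * (a + c) = 1.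
    by transitivity (- (a + b + c + d)); [ring | rewrite S1 opprK].
  have -> : (- 5%:R - 2%:R * e + -1 + -1) = - (7%:R + 2%:R * e) by ring.
  by rewrite mulrNN mulr1 !scaleNr !scale1r opprK.
rewrite -!mul_polyC !(polyCD, polyCM); ring.
Qed.

Lemma wang_local_field : exists (L : splittingFieldType Q2) (z r i s0 s1 : L),
  [/\ Phi17 z = 0, residue_period z = W%:A, r ^+ 2 = 2%:R, i ^+ 2 = -1 &
  [/\ s0 ^+ 2 = cyclotomic_unit z, s1 ^+ 2 = cyclotomic_unit (z ^+ 2) &
  forall g : gal_of {:L},
    g z = z -> g r = r -> g i = i -> g s0 = s0 -> g s1 = s1 -> g = 1%g]].
Proof.
have [L [rs splitL genL]] := exists_splitting_field wang_poly_neq0.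
pose om : L := W%:A; pose S : {poly L} := square_poly (7%:R + 2%:R * om).
have map_p : map_poly (in_alg L) wang_poly =
    Phi17 'X * ('X^2 - 2%:R) * ('X^2 + 1) * S.
  have e1 : map_poly (in_alg L) (Phi17 'X) = Phi17 'X.
    by rewrite rmorph_sum; apply: eq_bigr => k _; rewrite rmorphXn /= map_polyX.
  have e2 : map_poly (in_alg L) ('X^2 - 2%:R) = 'X^2 - 2%:R.
    by rewrite rmorphB /= map_polyXn rmorph_nat.
  have e3 : map_poly (in_alg L) ('X^2 + 1) = 'X^2 + 1.
    by rewrite rmorphD /= map_polyXn rmorph1.
  have e4 : map_poly (in_alg L) (square_poly (7%:R + 2%:R * W)) = S.
    have a_eq : (7%:R + 2%:R * W)%:A = 7%:R + 2%:R * om :> L.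
      by rewrite -[LHS]/(in_alg L _) rmorphD rmorphM !rmorph_nat.
    rewrite /square_poly rmorphD rmorphB rmorphB rmorphD /= map_polyZ /=.
    by rewrite a_eq !map_polyXn rmorph1.
  by rewrite /wang_poly !rmorphM /= e1 e2 e3 e4.
rewrite map_p in splitL.
have rootX2 (a x : L) : root ('X^2 - a%:P) x -> x ^+ 2 = a.
  by rewrite /root !hornerE /= subr_eq0 => /eqP.
have [z0 /rootP z00] : exists x : L, root (Phi17 'X) x.
  apply: root_of_split_divisor splitL _ _; last by rewrite size_Phi17.
  by rewrite -!mulrA dvdp_mulr.
have horner_Phi (x : L) : (Phi17 'X).[x] = Phi17 x.
  by rewrite horner_sum; apply: eq_bigr => k _; rewrite hornerXn.
rewrite horner_Phi in z00.
have om_eq : om ^+ 2 + om = 4%:R.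
  rewrite /om -[_%:A]/(in_alg L W) -rmorphXn -rmorphD /W.
  by rewrite -rmorphXn -rmorphD w_eq !rmorph_nat.
(* The period of a root is one of the two solutions of X^2 + X = 4; cubing the root switches them if
   needed. *)
have [z zP zom] : exists2 z : L, Phi17 z = 0 & residue_period z = om.
  have [E|nE] := eqVneq (residue_period z0) om; first by exists z0.
  exists (z0 ^+ 3); first exact: Phi17_cube.
  rewrite residue_period_cube //.
  have : (residue_period z0 - om) * (residue_period z0 + om + 1) = 0.
    transitivity ((residue_period z0 ^+ 2 + residue_period z0) - (om ^+ 2 + om)); first by ring.
    by rewrite om_eq residue_period_eq // subrr.
  move/eqP; rewrite mulf_eq0 subr_eq0 (negPf nE) /= => /eqP E.
  by apply/eqP; rewrite -subr_eq0 -oppr_eq0 -[X in _ == X]E; apply/eqP; ring.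
have factS := square_poly_factor zP; rewrite zom -/S in factS.
have factor_root (a : L) : 'X^2 - a%:P %| Phi17 'X * ('X^2 - 2%:R) * ('X^2 + 1) * S -> exists x
  : L, x ^+ 2 = a.
  move=> dvd; have [|x /rootX2] := root_of_split_divisor splitL dvd; last by exists x.
  by rewrite -polyCN size_X2D.
have [r r2] : exists x : L, x ^+ 2 = 2%:R.
  by apply: factor_root; rewrite (rmorph_nat polyC) -!mulrA mulrCA dvdp_mulr.
have [i i2] : exists x : L, x ^+ 2 = -1.
  by apply: factor_root; rewrite polyCN opprK polyC1 mulrAC dvdp_mull.
have [s0 s02] : exists x : L, x ^+ 2 = cyclotomic_unit z.
  by apply: factor_root; rewrite factS dvdp_mull // -!mulrA dvdp_mulr.
have [s1 s12] : exists x : L, x ^+ 2 = cyclotomic_unit (z ^+ 2).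
  by apply: factor_root; rewrite factS dvdp_mull // -!mulrA mulrCA dvdp_mulr.
exists L, z, r, i, s0, s1; split=> //; split=> // g gz gr gi gs0 gs1.
apply/eqP/gal_eqP => x _; rewrite gal_id.
suff sL : (<<1 & rs>> <= fixedField [set g])%VS.
  have xL : x \in <<1 & rs>>%VS by rewrite genL memvf.
  by have /mem_fixedFieldP[_ ->] := subvP sL x xL; rewrite ?inE.
apply/Fadjoin_seqP; split=> [|y rs_y]; first exact: sub1v.
suff gy : g y = y by apply/fixedFieldP => [|_ /set1P->] //; apply: memvf.
have sqr_fix (a b : L) : g b = b -> a ^+ 2 = b ^+ 2 -> g a = a.
  by move=> gb /eqP; rewrite eqf_sqr => /orP[]/eqP->; rewrite ?rmorphN /= gb.
have s0_neq0 : s0 != 0.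
  apply/eqP => s00; move/eqP: (cyclotomic_unit_norm zP).
  by rewrite -s02 s00 expr0n mul0r eq_sym oppr_eq0 oner_eq0.
have s1_neq0 : s1 != 0.
  apply/eqP => s10; move/eqP: (cyclotomic_unit_norm (Phi17_sqr zP)).
  by rewrite -s12 s10 expr0n mul0r eq_sym oppr_eq0 oner_eq0.
have : root (Phi17 'X * ('X^2 - 2%:R) * ('X^2 + 1) * S) y.
  by rewrite (eqp_root splitL) root_prod_XsubC.
rewrite factS !rootM -!orbA.
(* The remaining roots, those of u_2 and u_3, are [i / s0] and [i / s1] up to sign, so fixing the
   five chosen elements fixes all roots. *)
have quot (s a b : L) : s != 0 -> s ^+ 2 = a -> a * b = -1 -> (i / s) ^+ 2 = b.
  move=> s_neq0 s2 ab; rewrite expr_div_n i2 s2 -ab mulrAC divff ?mul1r //.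
  by rewrite -s2 expf_neq0.
case/or4P=> [/rootP| | |].
- rewrite horner_Phi => /Phi17_expr y17.
  have z1 : z != 1.
    apply/eqP => z1; move: zP; rewrite z1 /Phi17 (eq_bigr (fun _ => 1)); last by move=> k _;
      rewrite expr1n.
    by rewrite sumr_const card_ord => /eqP; rewrite (negPf (Q2_ext_natr_neq0 L _)).
  have [m zm m17] := prim_order_exists (isT : (0 < 17)%N) (Phi17_expr zP).
  have m_eq : m = 17%N.
    have : m \in divisors 17 by rewrite -dvdn_divisors.
    rewrite !inE => /orP[]/eqP m1 //; rewrite m1 in zm.
    by have := prim_expr_order zm; rewrite expr1 => /eqP; rewrite (negPf z1).
  rewrite m_eq in zm; have [k ->] := prim_rootP zm y17.
  by rewrite rmorphXn /= gz.
- rewrite /root -(rmorph_nat polyC) => /rootX2 y2.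
  by apply: (sqr_fix y r) => //; rewrite y2 r2.
- rewrite -[1]opprK -polyC1 -polyCN => /rootX2 y2.
  by apply: (sqr_fix y i) => //; rewrite y2 i2.
case/or4P=> /rootX2 y2.
- by apply: (sqr_fix y s0) => //; rewrite y2 s02.
- by apply: (sqr_fix y s1) => //; rewrite y2 s12.
- apply: (sqr_fix y (i / s0)); first by rewrite fmorph_div /= gi gs0.
  by rewrite y2 (quot s0 _ _ s0_neq0 s02 (cyclotomic_unit_norm zP)).
- apply: (sqr_fix y (i / s1)); first by rewrite fmorph_div /= gi gs1.
  rewrite y2 (quot s1 _ (cyclotomic_unit (z ^+ 8)) s1_neq0 s12) //.
  by rewrite -(cyclotomic_unit_norm (Phi17_sqr zP)) -exprM.
Qed.

End Construction.

Local Notation padic_alg L := (in_alg L \o (@tofrac Z2 : {rmorphism Z2 -> Q2})).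

Lemma fraction_numden (R : idomainType) (a : {fraction R}) :
  exists n d, d != 0 /\ a = @tofrac R n / @tofrac R d.
Proof.
elim/generic_quotient.quotW: a => x; exists (frac x).1, (frac x).2.
have d0 := denom_ratioP x; split=> //.
apply: (canRL (mulfK _)); first by rewrite tofrac_eq0.
change (FracField.mul (\pi_({fraction R})%qT x) (FracField.tofrac (frac x).2) = FracField.tofrac
  (frac x).1).
rewrite !generic_quotient.piE; apply/generic_quotient.eqmodP.
rewrite /= FracField.equivfE /FracField.mulf !numden_Ratio ?mulf_neq0 ?oner_neq0 //.
by apply/eqP; ring.
Qed.

(** * Primes above 2 and Frobenius for Galois extensions of Q_2 *)

Section PadicExtension.
Variable L : splittingFieldType Q2.
Local Notation iota := (padic_alg L).
Local Notation Gamma := ('Gal({:L} / 1)%G).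

Lemma padic_prime_exists : exists P, prime_above iota 2 P.
Proof.
apply: exists_prime_above; apply: natr_integral_nonunit; last exact: padic2_two_nonunit.
by move=> x y /= /(fmorph_inj (in_alg L))/eqP; rewrite tofrac_eq => /eqP.
Qed.

Lemma Q2_ext_neq0 n : (0 < n)%N -> (n%:R : L) != 0.
Proof. exact: Q2_ext_natr_neq0. Qed.

Variables (P : L -> Prop) (abvP : prime_above iota 2 P).
Local Notation O := (local_ring abvP).
Local Notation M := (local_max abvP).
Local Notation U := (local_unit abvP).

Let two_neq0 : (2%:R : L) != 0 := Q2_ext_neq0 (isT : (0 < 2)%N).

Lemma two_max : (2%:R : L) \in M. Proof. exact: local_max_p abvP. Qed.

Lemma padic_integral (a : Z2) : integralOver iota (iota a).
Proof. exact: integral_id. Qed.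

Lemma scalar_decomposition (a : Q2) : a != 0 ->
  exists (k : int) (e : L), e - 1 \in M /\ a%:A = 2%:R ^ k * e.
Proof.
have unit1 (c : Z2) : c 1%N = 1 -> iota c - 1 \in M.
  move=> c1; have [b ->] := padic2_odd c1.
  rewrite rmorphD rmorph1 rmorphM rmorph_nat addrAC subrr add0r.
  by rewrite local_maxMl ?two_max //; apply/integral_local/padic_integral.
have [n [d [d0 ->]]] := fraction_numden a.
rewrite mulf_eq0 invr_eq0 negb_or !tofrac_eq0 => /andP[n0 _].
have [k [n' [def_n n'1]]] := padic2_decomposition n0.
have [l [d' [def_d d'1]]] := padic2_decomposition d0.
have d'U : iota d' \in U by apply: local_unit_congr (local_unit1 abvP) (unit1 _ d'1).
have d'0 := local_unit_neq0 d'U.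
exists (k%:Z - l%:Z), (iota n' / iota d'); split.
  have -> : iota n' / iota d' - 1 = ((iota n' - 1) - (iota d' - 1)) / iota d' by field.
  by apply: local_maxMl; [apply: local_maxB; exact: unit1 | exact/local_unitO/local_unitV].
transitivity (iota n / iota d); first exact: (fmorph_div (in_alg L)).
rewrite exprzDr ?unitfE // -invr_expz -!exprnP def_n def_d.
by rewrite !rmorphM !rmorphXn !rmorph_nat /= invfM mulrACA.
Qed.

(** An integral scalar is 2^k e with k nonnegative and e = 1 modulo [M], so its residue is 0 or 1.
    This is the hypothesis that [exists_frobenius] requires. *)
Lemma integral_scalar_residue (x : L) : integralOver iota x ->
  {in Gamma, forall g : gal_of {:L}, g x = x} -> P (x ^+ 2 - x).
Proof.
move=> xZ xG; have [a def_x] : exists a, x = a%:A.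
  by apply: fixed_scalar (Q2_ext_galois L) _; apply/fixedP.
have x2Z : integralOver iota (x ^+ 2 - x).
  by apply: integral_sub => //; rewrite expr2; apply: integral_mul.
apply/(integral_local_max abvP x2Z); have xO := integral_local abvP xZ.
have -> : x ^+ 2 - x = x * (x - 1) by ring.
have [a0|a0] := eqVneq a 0; first by rewrite def_x a0 scale0r mul0r local_max0.
have [k [e [e1 def_a]]] := scalar_decomposition a0.
have eU : e \in U by apply: local_unit_congr (local_unit1 abvP) e1.
have [Ok Mk _] := local_unit_expz k two_neq0 two_max eU.
rewrite -def_a -def_x in Ok Mk; move: Ok; rewrite xO => /esym.
rewrite le_eqVlt => /orP[/eqP k0|k0]; last first.
  by rewrite local_maxMl ?Mk // rpredB ?rpred1.
rewrite local_maxM // def_x def_a -k0 expr0z mul1r //.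
Qed.

Lemma padic_frobenius : exists tau : gal_of {:L},
  forall x, integralOver iota x -> P (tau x - x ^+ 2).
Proof.
have [tau _ tauP] := exists_frobenius abvP (isT : prime 2) integral_scalar_residue.
by exists tau.
Qed.

End PadicExtension.

(** * The unramified field Q_2(z) *)

Section UnramifiedPart.
Variable L : splittingFieldType Q2.
Local Notation iota := (padic_alg L).
Local Notation Gamma := ('Gal({:L} / 1)%G).
Variables (P : L -> Prop) (abvP : prime_above iota 2 P).
Local Notation O := (local_ring abvP).
Local Notation M := (local_max abvP).
Local Notation U := (local_unit abvP).
Variables (z : L) (om : Q2).
Hypotheses (z_root : Phi17 z = 0) (z_period : residue_period z = om%:A).

Let two_neq0 : (2%:R : L) != 0 := Q2_ext_neq0 L (isT : (0 < 2)%N).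
Let two_max := two_max abvP.

Lemma integral_expr_inv (x y : L) n : (0 < n)%N -> x ^+ n = y -> integralOver iota y ->
  integralOver iota x.
Proof.
move=> n_gt0 xn yZ; apply: (@integral_root_monic _ _ iota x ('X^n - y%:P)).
- by rewrite monicXnsubC.
- by rewrite /root !hornerE /= xn subrr.
- apply/(integral_poly iota) => i; rewrite coefB coefXn coefC.
  apply: integral_sub; first exact: integral_nat.
  by case: ifP => _ //; apply: integral0.
Qed.

Lemma unity17_integral (x : L) : x ^+ 17 = 1 -> integralOver iota x.
Proof. by move=> x17; apply: (integral_expr_inv _ x17) => //; apply: integral1. Qed.

Lemma z_expr17 : z ^+ 17 = 1. Proof. exact: Phi17_expr. Qed.

(** If x differs from 1, then 0 = [Phi17 x], which is congruent to 17, hence to 1, modulo [M]. Thus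
    17th roots of unity are determined by their residues. *)
Lemma Phi17_not_1 (x : L) : x ^+ 17 = 1 -> x - 1 \in M -> x = 1.
Proof.
move=> x17 x1M; apply/eqP; apply: contraT => x1.
have xO : x \in O by apply/integral_local/unity17_integral.
have Phi0 : Phi17 x = 0.
  have /eqP : (x - 1) * Phi17 x = 0 by rewrite -subrX1 x17 subrr.
  by rewrite mulf_eq0 subr_eq0 (negPf x1) => /eqP.
have powM k : x ^+ k - 1 \in M by rewrite subrX1 local_maxMl // rpred_sum // => j _; rewrite rpredX.
case/negP: (local_max1 abvP).
have -> : 1 = - (\sum_(i < 17) (x ^+ i - 1)) - 16%:R :> L.
  by rewrite sumrB -/(Phi17 x) Phi0 sumr_const card_ord; ring.
apply: local_maxB; last by rewrite (natrM _ 2 8) local_maxMl // rpred_nat.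
by apply: local_maxN; elim/big_ind: _ => //; [apply: local_max0 | apply: local_maxD].
Qed.

Lemma unity17_congr (x y : L) : x ^+ 17 = 1 -> y ^+ 17 = 1 -> x - y \in M -> x = y.
Proof.
move=> x17 y17 xyM; have y0 : y != 0.
  by apply/eqP => y0; move/eqP: y17; rewrite y0 expr0n eq_sym oner_eq0.
have yVO : y^-1 \in O by apply/integral_local/unity17_integral; rewrite exprVn y17 invr1.
have xy1 : x / y = 1.
  apply: Phi17_not_1; first by rewrite expr_div_n x17 y17 divr1.
  by have -> : x / y - 1 = (x - y) * y^-1 by [field]; rewrite local_maxMl.
by rewrite -[x](divfK y0) xy1 mul1r.
Qed.

Lemma z_neq1 : z != 1.
Proof.
apply/eqP => z1; move: z_root; rewrite z1 /Phi17 (eq_bigr (fun _ => 1)); last by move=> k _;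
  rewrite expr1n.
by rewrite sumr_const card_ord => /eqP; rewrite (negPf (Q2_ext_neq0 L _)).
Qed.

Lemma z_prim : 17.-primitive_root z.
Proof.
have [m zm m17] := prim_order_exists (isT : (0 < 17)%N) z_expr17.
have : m \in divisors 17 by rewrite -dvdn_divisors.
rewrite !inE => /orP[]/eqP m1; last by have := zm; rewrite m1.
by have := prim_expr_order zm; rewrite m1 expr1 => /eqP; rewrite (negPf z_neq1).
Qed.

Lemma Phi17_expr2 j : Phi17 (z ^+ (2 ^ j)) = 0 /\ residue_period (z ^+ (2 ^ j)) = residue_period z.
Proof.
elim: j => [|j [IH1 IH2]]; first by rewrite expn0 expr1.
by rewrite expnSr exprM Phi17_sqr // residue_period_sqr.
Qed.

(** The period is a scalar, hence preserved. Nonzero exponents modulo 17 are 2^j or 3 * 2^j, and the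
    latter would turn the period p into -1 - p, forcing (2 p + 1)^2 = 17 to vanish. *)
Lemma gal_z (g : gal_of {:L}) : exists2 j, (j < 8)%N & g z = z ^+ (2 ^ j).
Proof.
have gz17 : (g z) ^+ 17 = 1 by rewrite -rmorphXn z_expr17 rmorph1.
have [k gz] := prim_rootP z_prim gz17.
have per_gz : residue_period (g z) = residue_period z.
  transitivity (g (residue_period z)).
    by rewrite /residue_period !rmorphD !rmorphXn.
  by rewrite z_period linearZ /= rmorph1.
have k0 : (k != 0 :> nat).
  apply: contraNneq z_neq1 => k0; by rewrite -(fmorph_eq1 g) /= gz k0 expr0.
have : (k : nat) \in seq.iota 1 16 by rewrite mem_iota lt0n k0; apply: (ltn_ord k).
have /allP/[apply] : all (fun k => has (fun j => k == 2 ^ j %% 17)%N (seq.iota 0 8)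
    || has (fun j => k == 2 ^ j * 3 %% 17)%N (seq.iota 0 8)) (seq.iota 1 16) by [].
case/orP=> /hasP[j]; rewrite mem_iota => /= j8 /eqP k_eq.
  by exists j => //; rewrite gz k_eq (prim_expr_mod z_prim).
have [Phij perj] := Phi17_expr2 j.
move: per_gz; rewrite gz k_eq (prim_expr_mod z_prim) exprM residue_period_cube // perj => E.
have : residue_period z *+ 2 + 1 = 0.
  by rewrite mulr2n -{1}E; ring.
have := residue_period_eq z_root => E2 E3.
have : (17%:R : L) = 0.
  transitivity (4%:R * 4%:R + 1 : L); first by ring.
  by rewrite -{2}E2 -[RHS](mul0r (residue_period z *+ 2 + 1)) -E3; ring.
by move/eqP; rewrite (negPf (Q2_ext_neq0 L _)).
Qed.

Lemma z_integral : integralOver iota z.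
Proof. exact: unity17_integral z_expr17. Qed.

Lemma pow2_inj17 i j : (i < 8)%N -> (j < 8)%N -> (2 ^ i = 2 ^ j %[mod 17])%N -> i = j.
Proof.
have : all (fun i => all (fun j => (2 ^ i == 2 ^ j %[mod 17])%N ==> (i == j)) (seq.iota 0 8))
  (seq.iota 0 8) by [].
move=> /allP all_ij i8 j8 /eqP ij.
have /all_ij/allP/(_ j) : i \in seq.iota 0 8 by rewrite mem_iota.
by rewrite mem_iota ij => /(_ j8)/eqP.
Qed.

Lemma z_pow2_inj i j : (i < 8)%N -> (j < 8)%N -> z ^+ (2 ^ i) = z ^+ (2 ^ j) -> i = j.
Proof.
by move=> i8 j8 /eqP; rewrite (eq_prim_root_expr z_prim) => /eqP; apply: pow2_inj17.
Qed.

(* The residue of [z] has the 8 distinct conjugates [z ^+ (2 ^ j)], so it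
   satisfies no nonzero polynomial of degree less than 8 over F_2. *)
Lemma residue_indep (n : nat -> bool) j0 : (j0 < 8)%N -> n j0 ->
  ~ P (\sum_(j < 8) (n j)%:R * z ^+ j).
Proof.
move=> j08 nj0 Psum; have [k [pi piP]] := prime_residue abvP.
pose Z := to_intring z_integral.
have chp : 2 \in [pchar k].
  rewrite inE /= -(rmorph_nat pi); apply/eqP/piP.
  by rewrite rmorph_nat; apply: prime_above_p abvP.
pose g : {poly k} := \poly_(j < 8) (n j)%:R.
have g0 : g != 0.
  by apply/eqP => /(congr1 (fun q : {poly k} => q`_j0)) /eqP;
    rewrite coef_poly j08 nj0 coef0 oner_eq0.
have root0 : root g (pi Z).
  apply/rootP; rewrite horner_poly.
  transitivity (pi (\sum_(j < 8) (n j)%:R * Z ^+ j)).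
    by rewrite rmorph_sum; apply: eq_bigr => j _; rewrite rmorphM rmorphXn rmorph_nat.
  apply/piP; rewrite rmorph_sum.
  suff -> : \sum_(j < 8) val ((n j)%:R * Z ^+ j) = \sum_(j < 8) (n j)%:R * z ^+ j by [].
  by apply: eq_bigr => j _; rewrite rmorphM rmorphXn rmorph_nat.
have root_sqr x : root g x -> root g (x ^+ 2).
  move=> /rootP gx; apply/rootP; pose F := pFrobenius_aut chp.
  have gF : map_poly F g = g.
    apply/polyP => i; rewrite coef_map.
    have -> : g`_i = (if (i < 8)%N then n i else false)%:R by rewrite coef_poly; case: ifP.
    exact: (rmorph_nat (pFrobenius_aut chp)).
  by rewrite -[x ^+ 2](pFrobenius_autE chp) -gF horner_map gx rmorph0.
have roots j : root g (pi Z ^+ (2 ^ j)).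
  elim: j => [|j IHj]; first by rewrite expr1.
  by rewrite expnSr exprM root_sqr.
have := max_poly_roots g0 (rs := [seq pi Z ^+ (2 ^ j) | j <- seq.iota 0 8]).
rewrite size_map size_iota => max8; suff : (8 < size g)%N by rewrite ltnNge size_poly.
apply: max8.
- by apply/allP => _ /mapP[j _ ->].
rewrite map_inj_in_uniq ?iota_uniq // => i j; rewrite !mem_iota => /andP[_ i8] /andP[_ j8] /eqP.
rewrite -!rmorphXn -subr_eq0 -rmorphB => /eqP/piP; rewrite rmorphB !rmorphXn /= => Pij.
apply: z_pow2_inj => //; apply: unity17_congr.
- by rewrite exprAC z_expr17 expr1n.
- by rewrite exprAC z_expr17 expr1n.
- apply/integral_local_max => //; apply: integral_sub.
    by apply: unity17_integral; rewrite exprAC z_expr17 expr1n.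
  by apply: unity17_integral; rewrite exprAC z_expr17 expr1n.
Qed.

Lemma adjoin_degree_z : (adjoin_degree 1 z <= 8)%N.
Proof.
have /(galois_factors (sub1v _))/(_ z (memvf z))[r [_ uniq_r minz]] := Q2_ext_galois L.
rewrite -ltnS -size_minPoly minz size_prod_XsubC ltnS size_map.
rewrite -(size_map (fun x : gal_of {:L} => x z)).
rewrite -[8%N](size_map (fun j => z ^+ (2 ^ j)) (seq.iota 0 8)).
apply: uniq_leq_size => // _ /mapP[g _ ->]; have [j j8 ->] := gal_z g.
by apply/mapP; exists j; rewrite ?mem_iota.
Qed.

(** Write x as a combination of z^j, j < 8, and divide by 2^k with k the least exponent of its
    coefficients. Modulo [M] the coefficients become 0 or 1, not all 0, and [residue_indep] shows
    that the result is a unit. *)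
Lemma unramified_decomposition x : x \in <<1; z>>%VS -> x != 0 ->
  exists (k : int) (e : L), e \in U /\ x = 2%:R ^ k * e.
Proof.
move=> xK x0; pose q := Fadjoin_poly 1 z x.
have coef_q j : exists c : Q2, q`_j = c%:A.
  by have /polyOverP/(_ j)/vlineP := Fadjoin_polyOver 1 z x.
have [c def_c] := choice coef_q.
(* For a zero coefficient the pair (0, 0) is a dummy value, guarded by the condition [a != 0]. *)
have dec (a : Q2) : exists ke : int * L, a != 0 -> ke.2 - 1 \in M /\ a%:A = 2%:R ^ ke.1 * ke.2.
  have [->|a0] := eqVneq a 0; first by exists (0, 0).
  by have [k [e ke]] := scalar_decomposition abvP a0; exists (k, e).
have [ke keP] := choice dec.
have def_x : x = \sum_(j < 8) (c j)%:A * z ^+ j.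
  rewrite -[LHS](Fadjoin_poly_eq xK) -/q (@horner_coef_wide _ 8); last first.
    exact: leq_trans (size_Fadjoin_poly _ _ _) adjoin_degree_z.
  by apply: eq_bigr => j _; rewrite def_c.
have [j1 cj1] : exists j1 : 'I_8, c j1 != 0.
  apply: contrapT => nocj; move/eqP: x0; apply; rewrite def_x big1 // => j _.
  have [->|cj] := eqVneq (c j) 0; first by rewrite scale0r mul0r.
  by case: nocj; exists j.
have [j0 cj0 minj0] : exists2 j0 : 'I_8, c j0 != 0 &
    forall j : 'I_8, c j != 0 -> (ke (c j0)).1 <= (ke (c j)).1.
  case: (@arg_minP _ _ _ j1 (fun j : 'I_8 => c j != 0) (fun j : 'I_8 => (ke (c j)).1) cj1) => j0.
  by exists j0.
set k := (ke (c j0)).1 in minj0; pose X := \sum_(j < 8) 2%:R ^ (- k) * (c j)%:A * z ^+ j.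
have zO : z \in O by apply/integral_local/z_integral.
exists k, X; split; last first.
  rewrite def_x /X mulr_sumr; apply: eq_bigr => j _.
  by rewrite !mulrA -exprzDr ?unitfE // addrN expr0z mul1r.
pose n (j : nat) := (c j != 0) && ((ke (c j)).1 == k).
have termP (j : 'I_8) : 2%:R ^ (- k) * (c j)%:A - (n j)%:R \in M.
  rewrite /n; have [->|cj] := eqVneq (c j) 0.
    by rewrite scale0r mulr0 subrr local_max0.
  have [e1 ->] := keP _ cj.
  have eU : (ke (c j)).2 \in U by apply: local_unit_congr (local_unit1 abvP) e1.
  have [eq_k|neq_k] := eqVneq (ke (c j)).1 k.
    by rewrite mulrA -exprzDr ?unitfE // eq_k addNr expr0z mul1r.
  rewrite mulrA -exprzDr ?unitfE // [- k + _]addrC subr0;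
    have [_ -> _] := local_unit_expz ((ke (c j)).1 - k) two_neq0 two_max eU.
  by rewrite subr_gt0 lt_neqAle eq_sym neq_k minj0.
have sumM : X - \sum_(j < 8) (n j)%:R * z ^+ j \in M.
  rewrite /X -sumrB; elim/big_ind: _ => [||j _]; first exact: local_max0.
    exact: local_maxD.
  by rewrite -mulrBl local_maxMl // rpredX.
have sO : \sum_(j < 8) (n j)%:R * z ^+ j \in O.
  by rewrite rpred_sum // => j _; rewrite rpredM ?rpred_nat ?rpredX.
have sZ : integralOver iota (\sum_(j < 8) (n j)%:R * z ^+ j).
  elim/big_ind: _ => [||j _]; first exact: integral0.
    exact: integral_add.
  apply: integral_mul; first exact: integral_nat.
  elim: (nat_of_ord j) => [|m IHm]; first by rewrite expr0; apply: integral1.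
  by rewrite exprS; apply: integral_mul => //; apply: z_integral.
have sU : \sum_(j < 8) (n j)%:R * z ^+ j \in U.
  rewrite inE sO; apply/negP => /(integral_local_max abvP sZ).
  by apply: (residue_indep (ltn_ord j0)); rewrite /n cj0 eqxx.
exact: local_unit_congr sU sumM.
Qed.

End UnramifiedPart.

Section Stabilizer.
Variables (F : fieldType) (L : splittingFieldType F).

Definition gal_stab (x : L) : {set gal_of {:L}} := [set g : gal_of {:L} | g x == x].

Lemma gal_stab_group x : group_set (gal_stab x).
Proof.
apply/group_setP; split=> [|g h]; rewrite !inE ?gal_id //.
by rewrite -gal_comp => /eqP-> /eqP->.
Qed.
Canonical gal_stab_groupType x := Group (gal_stab_group x).

Lemma gal_stabP (x : L) (g : gal_of {:L}) : reflect (g x = x) (g \in gal_stab x).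
Proof. by rewrite inE; apply: eqP. Qed.

Lemma fixedField_stab (x y : L) :
  galois 1 {:L} -> y \in fixedField (gal_stab x) -> y \in <<1; x>>%VS.
Proof.
move=> galL /fixedP yP; have galx : galois <<1; x>> {:L}.
  by apply: galoisS galL; rewrite sub1v subvf.
rewrite -(galois_fixedField galx); apply/fixedP => g gx; apply: yP; apply/gal_stabP.
by apply: fixed_gal gx _; [apply: subvf | apply: memv_adjoin].
Qed.
End Stabilizer.

(** * Ramification of square roots over K *)

Section RamifiedPart.
Variable L : splittingFieldType Q2.
Local Notation iota := (padic_alg L).
Variables (P : L -> Prop) (abvP : prime_above iota 2 P).
Local Notation O := (local_ring abvP).
Local Notation M := (local_max abvP).
Local Notation U := (local_unit abvP).
Variables (z : L) (om : Q2).
Hypotheses (z_root : Phi17 z = 0) (z_period : residue_period z = om%:A).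
Local Notation I := (gal_stab z).
Local Notation K := (fixedField I).
Variables (tau : gal_of {:L}).
Hypothesis tauP : forall x, integralOver iota x -> P (tau x - x ^+ 2).
Local Notation u := (@cyclotomic_unit L).

Let two_neq0 : (2%:R : L) != 0 := Q2_ext_neq0 L (isT : (0 < 2)%N).
Let two_max := two_max abvP.

Lemma tau_z : tau z = z ^+ 2.
Proof.
have z17 := Phi17_expr z_root; apply: (@unity17_congr L P abvP).
- by rewrite -rmorphXn z17 rmorph1.
- by rewrite exprAC z17 expr1n.
have zZ := unity17_integral z17; apply/integral_local_max; last exact: tauP.
by apply: integral_sub; [apply: gal_integral | rewrite expr2; apply: integral_mul].
Qed.

Lemma tau_local : {in O, forall x, tau x \in O}.
Proof.
apply: local_stable => [x|x xZ]; first exact: gal_integral.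
have txM := tauP xZ; have x2Z : integralOver iota (x ^+ 2) by rewrite expr2; apply: integral_mul.
have txZ : integralOver iota (tau x) by apply: gal_integral.
split=> [Ptx|Px].
  have Px2 : P (x * x).
    by rewrite -expr2 -[x ^+ 2](subKr (tau x)); apply: prime_aboveB abvP _ _ _ _.
  by case: (prime_above_prime abvP xZ xZ Px2).
suff: P (tau x - x ^+ 2 + x ^+ 2) by rewrite subrK.
apply: (prime_aboveD abvP) => //.
by rewrite expr2; apply: (prime_aboveM abvP).
Qed.

Lemma norm_stab (g : gal_of {:L}) : g \in 'N(I)%g.
Proof.
rewrite inE; apply/subsetP => _ /imsetP[h /gal_stabP hz ->].
apply/gal_stabP; rewrite conjgE -!gal_comp.
have [j _ gz] := gal_z z_root z_period (g^-1)%g.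
by rewrite gz rmorphXn /= hz -gz gal_comp mulVg gal_id.
Qed.

Lemma tau_fixed x : x \in K -> tau x \in K.
Proof. exact: fixedField_stable (norm_stab tau). Qed.

Lemma z_fixed : z \in K. Proof. by apply/fixedP => g /gal_stabP. Qed.

Lemma z_local : z \in O.
Proof. exact/integral_local/unity17_integral/Phi17_expr. Qed.

Lemma cyclotomic_unit_local x : x \in O -> u x \in O.
Proof. by move=> xO; rewrite /cyclotomic_unit rpredM ?rpredD ?rpredX. Qed.

Lemma cyclotomic_unit_fixed x : x \in K -> u x \in K.
Proof.
move=> /fixedP xK; apply/fixedP => g gI.
by rewrite /cyclotomic_unit rmorphM !rmorphD !rmorphXn /= xK.
Qed.

Lemma tau_cyclotomic_unit j : tau (u (z ^+ j)) = u (z ^+ (2 * j)).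
Proof.
have tau_zj : tau (z ^+ j) = z ^+ (2 * j) by rewrite rmorphXn /= tau_z -exprM.
by rewrite -tau_zj; move: (z ^+ j) => x; rewrite /cyclotomic_unit rmorphM !rmorphD !rmorphXn.
Qed.

(** For a unit of K, this is the classical criterion for its square root to be unramified over K.
    Only the root [c] is asked to lie in K. *)
Definition square_mod4 (x : L) :=
  exists c b, [/\ c \in K, c \in O, b \in O & x = c ^+ 2 + 4%:R * b].

Lemma square_mod4M x y : square_mod4 x -> square_mod4 y -> square_mod4 (x * y).
Proof.
move=> [c [b [cK cO bO ->]]] [c' [b' [cK' cO' bO' ->]]].
exists (c * c'), (c ^+ 2 * b' + b * c' ^+ 2 + 4%:R * b * b').
split; [exact: rpredM | exact: rpredM | | by ring].
have nO : (4%:R : L) \in O by apply: rpred_nat.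
have cO2 : c ^+ 2 \in O by apply: rpredX.
have cO2' : c' ^+ 2 \in O by apply: rpredX.
by do !apply: rpredD; do ?[apply: rpredM => //].
Qed.

Lemma square_mod4_sqr x : x \in K -> x \in O -> square_mod4 (x ^+ 2).
Proof. by move=> xK xO; exists x, 0; rewrite rpred0 mulr0 addr0. Qed.

Lemma square_mod4_tau x : square_mod4 x -> square_mod4 (tau x).
Proof.
move=> [c [b [cK cO bO ->]]]; exists (tau c), (tau b).
by rewrite !tau_local ?tau_fixed // !expr2 rmorphD !rmorphM rmorph_nat.
Qed.

Lemma fixed_decomposition x : x \in K -> x != 0 ->
  exists (k : int) (e : L), [/\ e \in U, e \in K & x = 2%:R ^ k * e].
Proof.
move=> xK x0; have xz := fixedField_stab (Q2_ext_galois L) xK.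
have [k [e [eU def_x]]] := unramified_decomposition abvP z_root z_period xz x0.
exists k, e; split=> //; apply/fixedP => g gI.
have k0 : (2%:R : L) ^ k != 0 by rewrite expfz_neq0.
have := fixedP _ _ xK _ gI; rewrite def_x rmorphM fmorphXz rmorph_nat.
exact: mulfI.
Qed.

(** If -1 = c^2 + 4 b, then (c + 1)^2 = 2 (c - 2 b), so c + 1 is in [M], hence a multiple of 2
    because K is unramified. Substituting back makes c a multiple of 2, against c^2 = -1 modulo
    4. *)
Lemma square_mod4_N1 : ~ square_mod4 (-1).
Proof.
move=> [c [b [cK cO bO eq_c]]].
have c2 : (c + 1) ^+ 2 = 2%:R * (c - 2%:R * b).
  by rewrite sqrrD1 -[c ^+ 2](addrK (4%:R * b)) -eq_c; ring.
have wO : c - 2%:R * b \in O by rewrite rpredB ?rpredM ?rpred_nat.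
have c1O : c + 1 \in O by rewrite rpredD ?rpred1.
have c1M : c + 1 \in M by apply: local_max_sqr => //; rewrite c2 local_maxMl.
have [w w_O def_c1] : exists2 w, w \in O & c + 1 = 2%:R * w.
  have [->|c10] := eqVneq (c + 1) 0; first by exists 0; rewrite ?rpred0 ?mulr0.
  have [k [e [eU _ def_c1]]] := fixed_decomposition (rpredD cK (rpred1 _)) c10.
  move: c1M; rewrite def_c1; have [_ -> _] := local_unit_expz k two_neq0 two_max eU.
  move=> k_gt0; exists (2%:R ^ (k - 1) * e); last first.
    by rewrite mulrA -{2}[2%:R]expr1z -exprzDr ?unitfE // subrKC.
  by have [-> _ _] := local_unit_expz (k - 1) two_neq0 two_max eU; rewrite subr_ge0.
have def_c : c = 2%:R * (w ^+ 2 + b).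
  apply: (mulfI two_neq0); rewrite def_c1 in c2.
  by transitivity ((2%:R * w) ^+ 2 + 4%:R * b); [rewrite c2|]; ring.
have cM : c \in M by rewrite def_c local_maxMl // rpredD ?rpredX.
case/negP: (local_max1 abvP); rewrite -[1]opprK eq_c; apply: local_maxN.
apply: local_maxD; first by rewrite expr2 local_maxMl.
by rewrite local_maxMl // (natrM _ 2 2) local_maxMl ?rpred_nat.
Qed.

Lemma fixed_square_unit (a : bool) b eta : b \in K -> eta \in U ->
  b ^+ 2 * (2%:R ^+ a * eta) \in U -> a = false /\ b \in U.
Proof.
move=> bK etaU wU; have b0 : b != 0.
  by apply: contraTneq wU => ->; rewrite expr0n mul0r inE local_max0 andbF.
have [k [e [eU _ def_b]]] := fixed_decomposition bK b0.
have e2U : e ^+ 2 * eta \in U by rewrite local_unitM ?local_unitX.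
have := wU; have -> : b ^+ 2 * (2%:R ^+ a * eta) = 2%:R ^ (k + k + a%:Z) * (e ^+ 2 * eta).
  by rewrite def_b !exprzDr ?unitfE // -exprnP; ring.
have [_ _ ->] := local_unit_expz (k + k + a%:Z) two_neq0 two_max e2U => /eqP ka.
have a0 : a = false by case: a ka {wU} => // /eqP; rewrite -mulr2n; lia.
split=> //; have [_ _] := local_unit_expz k two_neq0 two_max eU; rewrite -def_b => ->.
by move: ka; rewrite a0; lia.
Qed.

(* An automorphism of K(y)/K moving y lifts to inertia unless the integers x
   of K(y) satisfy sx = x mod P; otherwise x is the root of a quadratic
   polynomial whose unit discriminant b^2 y^2 is a square modulo 4. *)
Lemma inertia_moves_sqrt (a : bool) (y eta : L) : eta \in K -> eta \in U ->
    y ^+ 2 = 2%:R ^+ a * eta -> a \/ ~ square_mod4 eta ->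
  exists2 t : gal_of {:L}, forall x, integralOver iota x -> P (t x - x) & t y != y.
Proof.
move=> etaK etaU def_y2 ramified; apply: contrapT => no_t.
have y2K : y ^+ 2 \in K.
  by rewrite def_y2; apply/fixedP => g gI; rewrite rmorphM rmorphXn rmorph_nat /= (fixedP _ _ etaK).
have y0 : y != 0.
  apply/eqP => y0; move/eqP: def_y2; rewrite y0 expr0n eq_sym mulf_eq0 expf_eq0 (negPf two_neq0)
    andbF.
  by rewrite (negPf (local_unit_neq0 etaU)).
have sgnI g : g \in I -> g y = y \/ g y = - y.
  move=> gI; have /eqP := fixedP _ _ y2K _ gI.
  by rewrite rmorphXn /= eqf_sqr => /orP[]/eqP; [left|right].
have not_sq b c x : b \in K -> c \in K -> c \in O -> x \in O ->
    b ^+ 2 * y ^+ 2 \in U -> b ^+ 2 * y ^+ 2 = c ^+ 2 + 4%:R * x -> False.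
  move=> bK cK cO xO wU def_w; have := wU; rewrite def_y2 => /(fixed_square_unit bK etaU)[a0 bU].
  case: ramified => [|nsq]; [by rewrite a0 | apply: nsq].
  have bVO := local_unitO (local_unitV bU); have b0 := local_unit_neq0 bU.
  exists (c / b), (x / b ^+ 2); split; first by rewrite rpred_div.
  - exact: rpredM.
  - by rewrite -exprVn rpredM ?rpredX.
  have -> : eta = y ^+ 2 by rewrite def_y2 a0 mul1r.
  by apply: (mulfI (expf_neq0 2 b0)); rewrite def_w; field.
have [s sI sy] : exists2 s, s \in I & s y = - y.
  (* If no element of [I] moves [y], then [y] is in K, and b = 1/y makes b^2 y^2 equal to the square
     1. *)
  apply: contrapT => noS; apply: (not_sq y^-1 1 0); rewrite ?rpred1 ?rpred0 //.
  - rewrite rpredV; apply/fixedP => g gI.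
    by case: (sgnI g gI) => // gy; case: noS; exists g.
  - by rewrite -exprMn mulVf // expr1n local_unit1.
  - by rewrite -exprMn mulVf // mulr0 addr0.
pose H := (gal_stab_groupType z :&: gal_stab_groupType y)%G.
have HP g : g \in H -> g \in I /\ g y = y by case/setIP=> gI /gal_stabP.
have inH g : g \in I -> g y = y -> g \in H by move=> gI /gal_stabP gy; apply/setIP.
have [x [xZ xH nPx]] : exists x, [/\ integralOver iota x,
    {in H, forall g : gal_of {:L}, g x = x} & ~ P (s x - x)].
  apply: contrapT => nox; have [x xZ xH|h hH hP] := @gal_lift_inertia _ _ _ _ _ _ abvP H s.
    by apply: contrapT => nPx; apply: nox; exists x.
  case: no_t; exists (h^-1 * s)%g => //; rewrite -gal_comp.
  have [_ ->] := HP _ (groupVr hH); rewrite sy.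
  by rewrite -subr_eq0 -opprD oppr_eq0 -mulr2n -mulr_natr mulf_neq0.
have actI g : g \in I -> [/\ g y = y, g x = x & g (s x) = s x] \/
                         [/\ g y = - y, g x = s x & g (s x) = x].
  move=> gI; have sV_y : (s^-1)%g y = - y.
    have : (s^-1)%g (s y) = y by rewrite gal_comp mulgV gal_id.
    by rewrite sy rmorphN /= => {2}<-; rewrite opprK.
  have [gy|gy] := sgnI g gI; [left|right]; split=> //.
  - exact/xH/inH.
  - have cH : (s * g * s^-1)%g \in H.
      by apply: inH; rewrite ?groupM ?groupV // -!gal_comp sy rmorphN /= gy rmorphN /= sV_y opprK.
    by rewrite gal_comp -[(s * g)%g](mulgKV s) -gal_comp (xH _ cH).
  - have cH : (g * s^-1)%g \in H.
      by apply: inH; rewrite ?groupM ?groupV // -!gal_comp gy rmorphN /= sV_y opprK.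
    by rewrite -[g](mulgKV s) -gal_comp (xH _ cH).
  have cH : (s * g)%g \in H.
    by apply: inH; rewrite ?groupM // -!gal_comp sy rmorphN /= gy opprK.
  by rewrite gal_comp (xH _ cH).
have sxZ : integralOver iota (s x) by apply: gal_integral.
have [xO sxO] : x \in O /\ s x \in O by split; apply/integral_local.
have dU : x - s x \in U.
  rewrite inE rpredB //; apply/negP => dM; apply: nPx.
  by apply/(integral_local_max abvP); [apply: integral_sub | rewrite -opprB local_maxN].
have eq_w : ((x - s x) / y) ^+ 2 * y ^+ 2 = (x - s x) ^+ 2.
  by rewrite -exprMn divfK.
apply: (not_sq ((x - s x) / y) (x + s x) (- (x * s x))).
- apply/fixedP => g gI; rewrite fmorph_div rmorphB /=.
  by case: (actI g gI) => -[-> -> ->] //; rewrite -opprB mulNr invrN mulrN opprK.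
- apply/fixedP => g gI; rewrite rmorphD /=.
  by case: (actI g gI) => -[_ -> ->] //; rewrite addrC.
- exact: rpredD.
- by rewrite rpredN rpredM.
- by rewrite eq_w local_unitX.
- by rewrite eq_w; ring.
Qed.

Lemma inertia_stab (t : gal_of {:L}) :
  (forall x, integralOver iota x -> P (t x - x)) -> t \in I.
Proof.
move=> tP; apply/gal_stabP; have z17 := Phi17_expr z_root.
apply: (@unity17_congr L P abvP) => //; first by rewrite -rmorphXn z17 rmorph1.
have zZ := unity17_integral z17; apply/integral_local_max; last exact: tP.
by apply: integral_sub; [apply: gal_integral|].
Qed.

End RamifiedPart.

(** * Signs and linear functionals over F_2 *)

Lemma F2_natE (a : 'F_2) : a = (a != 0) :> nat.
Proof. by case: a => [[|[|a]] lt_a]. Qed.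

Section SignF2.
Variable L : fieldType.

Definition signF2 (a : 'F_2) : L := (-1) ^+ a.

Lemma signF2D a b : signF2 (a + b) = signF2 a * signF2 b.
Proof.
rewrite /signF2; case: a => [[|[|a]] lt_a] //; case: b => [[|[|b]] lt_b] //;
  by rewrite /= ?expr0 ?expr1 ?mulrNN ?mul1r ?mulr1.
Qed.

Lemma signF2M a b : signF2 (a * b) = signF2 a ^+ b.
Proof.
rewrite /signF2; case: a => [[|[|a]] lt_a] //; case: b => [[|[|b]] lt_b] //;
  by rewrite /= ?expr0 ?expr1.
Qed.

Lemma signF2_sum (n : nat) (F : 'I_n -> 'F_2) : signF2 (\sum_j F j) = \prod_j signF2 (F j).
Proof. by elim/big_rec2: _ => [|j x y _ <-]; rewrite ?signF2D. Qed.
End SignF2.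

(** A subgroup of F_2^n is a row space; some column of its cokernel matrix kills it but not [v]. *)
Lemma F2_annihilator n (A : {set 'rV['F_2]_n}) (v : 'rV['F_2]_n) :
    group_set A -> v \notin A ->
  exists2 c : 'I_n -> 'F_2, (exists j, c j != 0) & {in A, forall w : 'rV['F_2]_n, \sum_j w 0 j
    * c j = 0}.
Proof.
move=> gA nAv; pose B := mxabelem.rowg_mx A.
have memA w : (w \in A) = (w <= B)%MS by rewrite -mxabelem.mem_rowg /B
  (mxabelem.rowg_mxK (Group gA)).
move: nAv; rewrite memA submxE => /rV0Pn[k vk].
pose c j := cokermx B j k; have sumE (w : 'rV_n) : \sum_j w 0 j * c j = (w *m cokermx B) 0 k by
  rewrite mxE.
exists c => [|w]; last by rewrite memA submxE sumE => /eqP->; rewrite mxE.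
apply: contrapT => c0; case/eqP: vk; rewrite -sumE big1 // => j _.
have [->|cj] := eqVneq (c j) 0; first by rewrite mulr0.
by case: c0; exists j.
Qed.

(** * The Galois group over Q_2 as the required semidirect product *)

Section LocalModel.
Variable L : splittingFieldType Q2.
Local Notation iota := (padic_alg L).
Variables (P : L -> Prop) (abvP : prime_above iota 2 P).
Local Notation O := (local_ring abvP).
Local Notation M := (local_max abvP).
Local Notation U := (local_unit abvP).
Variables (z : L) (om : Q2) (r i s0 s1 : L).
Hypotheses (z_root : Phi17 z = 0) (z_period : residue_period z = om%:A).
Local Notation I := (gal_stab z).
Local Notation K := (fixedField I).
Local Notation u := (@cyclotomic_unit L).
Hypotheses (r2 : r ^+ 2 = 2%:R) (i2 : i ^+ 2 = -1).
Hypotheses (s0_2 : s0 ^+ 2 = u z) (s1_2 : s1 ^+ 2 = u (z ^+ 2)).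
Hypothesis faithful : forall g : gal_of {:L},
  g z = z -> g r = r -> g i = i -> g s0 = s0 -> g s1 = s1 -> g = 1%g.
Variables (tau : gal_of {:L}).
Hypothesis tauP : forall x, integralOver iota x -> P (tau x - x ^+ 2).

Let two_neq0 : (2%:R : L) != 0 := Q2_ext_neq0 L (isT : (0 < 2)%N).
Let zK : z \in K := z_fixed z.
Let zO : z \in O := z_local abvP z_root.

Let u_unit (x y : L) : x \in K -> x \in O -> y \in O -> u x * u y = -1 -> u x \in K /\ u x \in U.
Proof.
move=> xK xO yO uxy; split; first exact: cyclotomic_unit_fixed.
have x0 : u x != 0.
  by apply: contra_eq_neq uxy => ->; rewrite mul0r eq_sym oppr_eq0 oner_eq0.
apply/local_unitP; split=> //; first exact: cyclotomic_unit_local.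
have -> : (u x)^-1 = - u y by apply: (mulfI x0); rewrite mulfV // mulrN uxy opprK.
by rewrite rpredN cyclotomic_unit_local.
Qed.

Let u0_norm : u z * u (z ^+ 4) = -1. Proof. exact: cyclotomic_unit_norm. Qed.
Let u1_norm : u (z ^+ 2) * u (z ^+ 8) = -1.
Proof. by have := cyclotomic_unit_norm (Phi17_sqr z_root); rewrite -exprM. Qed.
Let u0P : u z \in K /\ u z \in U.
Proof. by apply: (@u_unit _ (z ^+ 4)); rewrite ?rpredX. Qed.
Let u1P : u (z ^+ 2) \in K /\ u (z ^+ 2) \in U.
Proof. by apply: (@u_unit _ (z ^+ 8)); rewrite ?rpredX. Qed.
Let tau_u j := tau_cyclotomic_unit abvP z_root tauP j.
Let tau_u0 : tau (u z) = u (z ^+ 2). Proof. by have := tau_u 1; rewrite expr1. Qed.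

Definition ramified_unit (c1 c2 c3 : bool) : L := (-1) ^+ c1 * (u z ^+ c2 * u (z ^+ 2) ^+ c3).

Lemma ramified_unitP c1 c2 c3 : ramified_unit c1 c2 c3 \in K /\ ramified_unit c1 c2 c3 \in U.
Proof.
have [[u0K u0U] [u1K u1U]] := (u0P, u1P); rewrite /ramified_unit; split.
  by rewrite !rpredM // rpredX // rpredN1.
by rewrite !local_unitM ?local_unitX ?local_unitN ?local_unit1.
Qed.

(** Squares modulo 4 are stable under products and [tau], so each case reduces to -1. With e the
    sign, (e u_0) tau^2(e u_0) = u_0 u_2 = -1, and likewise u_1 u_3 = -1. When both units occur, (e
    u_0 u_1)(e u_1 u_2) = -u_1^2. *)
Lemma ramified_unit_square c1 c2 c3 : [|| c1, c2 | c3] -> ~ square_mod4 abvP z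
  (ramified_unit c1 c2 c3).
Proof.
have N1 := @square_mod4_N1 _ _ abvP _ _ z_root z_period.
have sqM := @square_mod4M _ _ abvP z; have sqT := @square_mod4_tau _ _ abvP _ _ z_root z_period
  _ tauP.
rewrite /ramified_unit => c_neq0 sq; move: (sq) => /sqT sq1; move: (sq1) => /sqT sq2.
have tau_e x : tau ((-1) ^+ c1 * x) = (-1) ^+ c1 * tau x by rewrite rmorphM rmorph_sign.
have e2 x y : ((-1) ^+ c1 * x) * ((-1) ^+ c1 * y) = x * y :> L by rewrite mulrACA -signr_addb
  addbb mul1r.
case: c2 c3 c_neq0 sq sq1 sq2 => -[] /= c10; rewrite ?expr1 ?expr0 ?mulr1 ?mul1r => sq sq1 sq2.
- have [u1K u1U] := u1P; have u1_neq0 := local_unit_neq0 u1U.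
  have u1VO := local_unitO (local_unitV u1U).
  have sqV : square_mod4 abvP z ((u (z ^+ 2))^-1 ^+ 2) by apply: square_mod4_sqr; rewrite ?rpredV.
  apply: N1; have := sqM _ _ (sqM _ _ sq sq1) sqV.
  rewrite tau_e rmorphM /= tau_u0 tau_u e2 -mulrA.
  have -> // : u z * u (z ^+ 2) * (u (z ^+ 2) * u (z ^+ (2 * 2)) * (u (z ^+ 2))^-1 ^+ 2) = -1.
  by rewrite -u0_norm; field.
- by apply: N1; move: (sqM _ _ sq sq2); rewrite !tau_e tau_u0 tau_u e2 u0_norm.
- by apply: N1; move: (sqM _ _ sq sq2); rewrite !tau_e !tau_u e2 u1_norm.
- by apply: N1; move: sq; rewrite orbF in c10; rewrite c10.
Qed.

Definition kummer_root (j : 'I_4) : L := nth 0 [:: r; i; s0; s1] j.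
Local Notation b := kummer_root.

Definition kummer_sign (g : gal_of {:L}) : 'rV['F_2]_4 := \row_j (g (b j) != b j)%:R.

Lemma kummer_root_sqr j : b j ^+ 2 \in K.
Proof.
have [[u0K _] [u1K _]] := (u0P, u1P).
case: j => [[|[|[|[|j]]]] lt_j] //; rewrite /kummer_root /= ?r2 ?i2 ?s0_2 ?s1_2 ?rpred_nat //.
by rewrite rpredN1.
Qed.

Lemma kummer_root_neq0 j : b j != 0.
Proof.
have [[_ /local_unit_neq0 u0] [_ /local_unit_neq0 u1]] := (u0P, u1P).
suff : b j ^+ 2 != 0 by rewrite expf_eq0.
case: j => [[|[|[|[|j]]]] lt_j] //; rewrite /kummer_root /= ?r2 ?i2 ?s0_2 ?s1_2 //.
by rewrite oppr_eq0 oner_eq0.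
Qed.

Lemma kummer_signP (g : gal_of {:L}) j : g (b j ^+ 2) = b j ^+ 2 -> g (b j) = signF2 L
  (kummer_sign g 0 j) * b j.
Proof.
rewrite rmorphXn => /eqP; rewrite eqf_sqr /kummer_sign mxE /signF2 /=.
by have [->|_] := eqVneq (g (b j)) (b j); [rewrite mul1r | move/eqP=> ->; rewrite mulN1r].
Qed.

Lemma kummer_sign_stab (g : gal_of {:L}) j : g \in I -> g (b j) = signF2 L (kummer_sign g 0 j)
  * b j.
Proof. by move=> gI; apply: kummer_signP; apply: (fixedP _ _ (kummer_root_sqr j)). Qed.

Lemma signF2_inj : injective (signF2 L).
Proof.
have N1 : (-1 : L) != 1 by rewrite -subr_eq0 -opprD oppr_eq0 -[1 + 1]/(2%:R : L).
move=> a c; rewrite /signF2 => /eqP E; apply/val_inj; move: E.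
case: a => [[|[|a]] lt_a] //; case: c => [[|[|c]] lt_c] //= E;
  by case/negP: N1; first [exact: E | rewrite eq_sym; exact: E].
Qed.

Lemma kummer_sign_eq (g : gal_of {:L}) j a : g (b j) = signF2 L a * b j -> kummer_sign g 0 j = a.
Proof.
move=> gb; apply: signF2_inj; apply: (mulIf (kummer_root_neq0 j)); rewrite -gb.
apply/esym/kummer_signP; rewrite rmorphXn /= gb exprMn /signF2 -exprM mulnC exprM.
by rewrite sqrrN !expr1n mul1r.
Qed.

Lemma kummer_signM g h : g \in I -> h \in I -> kummer_sign (g * h)%g = kummer_sign g
  + kummer_sign h.
Proof.
move=> gI hI; apply/rowP => j; rewrite [RHS]mxE; apply: kummer_sign_eq.
rewrite -gal_comp !(kummer_sign_stab, rmorphM) //= rmorph_sign kummer_sign_stab //.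
by rewrite signF2D mulrA.
Qed.

Lemma kummer_sign_inj : {in I &, injective kummer_sign}.
Proof.
move=> g h gI hI eq_gh; have eq_b j : (g * h^-1)%g (b j) = b j.
  have eq_j : g (b j) = h (b j) by rewrite !kummer_sign_stab // eq_gh.
  by rewrite -gal_comp eq_j gal_comp mulgV gal_id.
apply/eqP; rewrite eq_mulgV1; apply/eqP/faithful.
- by apply/gal_stabP; rewrite groupM ?groupV.
- exact: (eq_b (@Ordinal 4 0 isT)).
- exact: (eq_b (@Ordinal 4 1 isT)).
- exact: (eq_b (@Ordinal 4 2 isT)).
- exact: (eq_b (@Ordinal 4 3 isT)).
Qed.

(** The sign vectors of inertia form a subgroup. Were it proper, a nonzero functional [c] would kill
    it, and inertia would fix the product of the b_j^(c_j), contrary to [inertia_moves_sqrt]. *)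
Lemma inertia_kummer_sign v :
  exists2 t : gal_of {:L}, forall x, integralOver iota x -> P (t x - x) & kummer_sign t = v.
Proof.
pose T := [set t : gal_of {:L} | `[< forall x, integralOver iota x -> P (t x - x) >]].
have TP (t : gal_of {:L}) : reflect (forall x, integralOver iota x -> P (t x - x)) (t \in T).
  by rewrite inE; apply: asboolP.
have TI t : t \in T -> t \in I by move/TP/(inertia_stab abvP z_root).
suff /imsetP[t /TP tP ->] : v \in kummer_sign @: T by exists t.
apply: contraT => nAv; have gA : group_set (kummer_sign @: T).
  apply/group_setP; split=> [|_ _ /imsetP[g gT ->] /imsetP[h hT ->]].
    apply/imsetP; exists 1%g.
      by apply/TP => x _; rewrite gal_id subrr; apply: prime_above0 abvP.
    apply: (addrI (kummer_sign 1%g)); rewrite -kummer_signM ?group1 // mulg1; exact: addr0.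
  apply/imsetP; exists (g * h)%g; last by rewrite kummer_signM ?TI.
  apply/TP => x xZ; rewrite -gal_comp -[h _](subrK (g x)) -addrA.
  by apply: (prime_aboveD abvP); [apply: (TP h hT); apply: gal_integral | apply: (TP g gT)].
have [c [j cj] cP] := F2_annihilator gA nAv.
pose y := \prod_j b j ^+ c j.
have y0 : y != 0 by apply/prodf_neq0 => k _; rewrite expf_neq0 ?kummer_root_neq0.
pose d (k : nat) := c (inord k) != 0.
have cE (k : 'I_4) : c k = d k :> nat by rewrite /d inord_val; apply: F2_natE.
have y2 : y ^+ 2 = 2%:R ^+ d 0%N * ramified_unit (d 1%N) (d 2) (d 3).
  rewrite /y -prodrXl; under eq_bigr => k _ do rewrite exprAC cE.
  by rewrite !big_ord_recl big_ord0 /kummer_root /= r2 i2 s0_2 s1_2 mulr1 /ramified_unit.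
have ramified : d 0%N \/ ~ square_mod4 abvP z (ramified_unit (d 1%N) (d 2) (d 3)).
  case d0 : (d 0%N); [by left | right; apply: ramified_unit_square].
  move: cj; rewrite -[j]inord_val -/(d j); case: j => [[|[|[|[|j]]]] lt_j] //= dj.
  - by rewrite d0 in dj.
  - by rewrite dj.
  - by rewrite dj orbT.
  - by rewrite dj !orbT.
have [eK eU] := ramified_unitP (d 1%N) (d 2) (d 3).
have [t tP /eqP[]] := inertia_moves_sqrt z_root z_period eK eU y2 ramified.
have tT : t \in T by apply/TP.
rewrite /y rmorph_prod /= (eq_bigr (fun k => signF2 L (kummer_sign t 0 k * c k) * b k ^+ c k)).
  by rewrite big_split /= -signF2_sum cP ?mul1r // imset_f.
by move=> k _; rewrite rmorphXn /= kummer_sign_stab ?TI // exprMn signF2M.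
Qed.

(** Elements of [I] are determined by their signs, and inertia, contained in [I], already realizes
    all of them. *)
Lemma inertiaP (g : gal_of {:L}) :
  (forall x, integralOver iota x -> P (g x - x)) <-> g \in I.
Proof.
split=> [/(inertia_stab abvP z_root) // | gI].
have [t tP st] := inertia_kummer_sign (kummer_sign g).
by rewrite -(kummer_sign_inj _ gI st) // (inertia_stab abvP z_root).
Qed.

Lemma kummer_sign_surj v : exists2 t, t \in I & kummer_sign t = v.
Proof. by have [t /inertiaP tI tv] := inertia_kummer_sign v; exists t. Qed.

Lemma tau_root (x y : L) : x ^+ 2 = tau y ^+ 2 -> exists e : bool, tau y = (-1) ^+ e * x.
Proof.
move/esym/eqP; rewrite eqf_sqr => /orP[]/eqP->; [exists false | exists true];
  by rewrite ?mul1r ?mulN1r.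
Qed.

Lemma tau_roots : exists e : 4.-tuple bool,
  [/\ tau r = (-1) ^+ tnth e 0 * r, tau i = (-1) ^+ tnth e 1 * i,
      tau s0 = (-1) ^+ tnth e 2 * s1 & tau s1 = (-1) ^+ tnth e 3 * (i / s0)].
Proof.
have [[_ /local_unit_neq0 u0] [_ /local_unit_neq0 u1]] := (u0P, u1P).
have [|er r_eq] := @tau_root r r; first by rewrite -rmorphXn r2 rmorph_nat.
have [|ei i_eq] := @tau_root i i; first by rewrite -rmorphXn i2 rmorphN rmorph1.
have [|e0 s0_eq] := @tau_root s1 s0; first by rewrite -rmorphXn s0_2 s1_2 /= tau_u0.
have [|e1 s1_eq] := @tau_root (i / s0) s1.
  rewrite -rmorphXn s1_2 /= tau_u expr_div_n i2 s0_2.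
  by apply: (mulfI u0); rewrite u0_norm mulrCA mulfV ?mulr1.
by exists [tuple er; ei; e0; e1]; rewrite !(tnth_nth false).
Qed.

Lemma kummer_sign_conj g : g \in I -> let v := kummer_sign g in
  kummer_sign (tau * g * tau^-1)%g =
    \row_j nth 0 [:: v 0 0; v 0 1; v 0 3; v 0 1 + v 0 2] j.
Proof.
move=> gI v; have [e [r_eq i_eq s0_eq s1_eq]] := tau_roots.
have gb := kummer_sign_stab _ gI.
have gr : g r = signF2 L (v 0 0) * r by apply: gb 0.
have gi : g i = signF2 L (v 0 1) * i by apply: gb 1.
have gs0 : g s0 = signF2 L (v 0 2) * s0 by apply: gb 2.
have gs1 : g s1 = signF2 L (v 0 3) * s1 by apply: gb 3.
have s0_neq0 : s0 != 0 := kummer_root_neq0 2.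
have sgnV a : (signF2 L a)^-1 = signF2 L a by rewrite /signF2 invr_sign.
suff conj_sign j : g (tau (b j)) = signF2 L (nth 0 [:: v 0 0; v 0 1; v 0 3; v 0 1 + v 0 2] j)
  * tau (b j).
  apply/rowP => j; rewrite [RHS]mxE; apply: kummer_sign_eq.
  by rewrite -!gal_comp conj_sign rmorphM rmorph_sign /= gal_comp mulgV gal_id.
case: j => [[|[|[|[|j]]]] lt_j] //=; rewrite /kummer_root /=.
- by rewrite r_eq rmorphM rmorph_sign /= gr mulrCA.
- by rewrite i_eq rmorphM rmorph_sign /= gi mulrCA.
- by rewrite s0_eq rmorphM rmorph_sign /= gs1 mulrCA.
rewrite s1_eq rmorphM rmorph_sign fmorph_div /= gi gs0 invfM sgnV signF2D; ring.
Qed.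

Lemma tau_expr_z k : (tau ^+ k)%g z = z ^+ (2 ^ k).
Proof.
elim: k => [|k IHk]; first by rewrite gal_id expr1.
by rewrite expgSr -gal_comp IHk rmorphXn /= (tau_z abvP z_root tauP) -exprM expnS.
Qed.

(** The signs in [tau_roots] depend on the choice of [tau], but tau^2 sends s0 to i / s0 up to a
    sign that cancels when tau^2 is applied again. So tau^4 fixes [s0]; only [z] requires the
    exponent 8, as 2^8 = 1 modulo 17. *)
Lemma tau_expr8 : (tau ^+ 8 = 1)%g.
Proof.
have [e [r_eq i_eq s0_eq s1_eq]] := tau_roots.
have s0_neq0 : s0 != 0 := kummer_root_neq0 2.
have i_neq0 : i != 0 := kummer_root_neq0 1.
have tau2 x (c : bool) : tau x = (-1) ^+ c * x -> tau (tau x) = x.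
  by move=> tx; rewrite tx rmorphM rmorph_sign /= tx mulrA -signr_addb addbb mul1r.
have tau8 x : (tau ^+ 8)%g x = tau (tau (tau (tau (tau (tau (tau (tau x))))))).
  by rewrite !gal_comp !expgS expg0 mulg1.
have s0_8 : tau (tau (tau (tau (tau (tau (tau (tau s0))))))) = s0.
  have t2 : tau (tau s0) = (-1) ^+ (tnth e 2 (+) tnth e 3) * (i / s0).
    by rewrite s0_eq rmorphM rmorph_sign /= s1_eq mulrA signr_addb.
  have t4 : tau (tau (tau (tau s0))) = (-1) ^+ (tnth e 2 (+) tnth e 3)
    * (tau (tau i) / tau (tau s0)).
    rewrite {1}t2 [X in tau X]rmorphM rmorph_sign fmorph_div /=.
    by rewrite rmorphM rmorph_sign fmorph_div.
  have {}t4 : tau (tau (tau (tau s0))) = s0.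
    rewrite t4 (tau2 _ _ i_eq) t2; set c := (-1) ^+ _; have c0 : c != 0 by rewrite signr_eq0.
    by field; rewrite s0_neq0 i_neq0 c0.
  by rewrite !t4.
apply: faithful; rewrite ?tau8.
- rewrite -tau8 tau_expr_z; exact: (Phi17_expr_mod z_root 15 1).
- by do 4!rewrite (tau2 _ _ r_eq).
- by do 4!rewrite (tau2 _ _ i_eq).
- exact: s0_8.
have -> : s1 = (-1) ^+ tnth e 2 * tau s0 by rewrite s0_eq mulrA -signr_addb addbb mul1r.
by rewrite -tau8 rmorphM rmorph_sign /= tau8 s0_8.
Qed.

Lemma tau_order : #[tau]%g = 8%N.
Proof.
have dvd8 : (#[tau]%g %| 8)%N by rewrite order_dvdn tau_expr8.
have : ~~ (#[tau]%g %| 4)%N.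
  rewrite order_dvdn; apply/eqP => tau4; have := tau_expr_z 4.
  rewrite tau4 gal_id => z16.
  by have := @z_pow2_inj _ z z_root 0%N 4%N isT isT; rewrite expr1 => /(_ z16).
by have : #[tau]%g \in divisors 8 by [rewrite -dvdn_divisors]; rewrite !inE => /or4P[]/eqP->.
Qed.

Lemma kummer_sign1 : kummer_sign 1%g = 0.
Proof. by apply: (addrI (kummer_sign 1%g)); rewrite -kummer_signM ?group1 // mulg1 addr0. Qed.

Lemma kummer_signX g n : g \in I -> kummer_sign (g ^+ n)%g = kummer_sign g *+ n.
Proof.
move=> gI; elim: n => [|n IHn]; first exact: kummer_sign1.
by rewrite expgS mulrS kummer_signM ?groupX // IHn.
Qed.

Lemma stab_abelem : 2.-abelem%g I.
Proof.
rewrite abelemE //; apply/andP; split.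
  apply/centsP => g gI h hI; apply: kummer_sign_inj; rewrite ?groupM //.
  by rewrite !kummer_signM // addrC.
apply/exponentP => g gI; apply: kummer_sign_inj; rewrite ?groupX ?group1 //.
rewrite kummer_signX // kummer_sign1; apply/rowP => j; rewrite mulr2n [LHS]mxE [RHS]mxE.
by case: (kummer_sign g 0 j) => [[|[|a]] lt_a] //; apply/val_inj.
Qed.

Lemma card_stab : #|I| = 16%N.
Proof.
rewrite -(card_in_imset kummer_sign_inj).
have -> : kummer_sign @: I = [set: 'rV['F_2]_4].
  by apply/setP => v; rewrite inE; have [t tI <-] := kummer_sign_surj v; rewrite imset_f.
by rewrite cardsT card_mx card_Fp.
Qed.

Lemma stab_sdprod : (I ><| <[tau]> = 'Gal({:L} / 1))%g.
Proof.
rewrite sdprodE.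
- apply/setP => g; rewrite mem_gal1; have [j _ gz] := gal_z z_root z_period g.
  apply/mulsgP; exists (g * (tau ^+ j)^-1)%g (tau ^+ j)%g; rewrite ?mem_cycle ?mulgKV //.
  by apply/gal_stabP; rewrite -gal_comp gz -tau_expr_z gal_comp mulgV gal_id.
- by rewrite cycle_subG (norm_stab z_root z_period).
apply/trivgP/subsetP => g /setIP[/gal_stabP gz /cyclePmin[k]]; rewrite tau_order => k8 def_g.
rewrite inE def_g; move: gz; rewrite def_g tau_expr_z => zk.
have := @z_pow2_inj _ z z_root k 0%N k8 isT; rewrite expr1 => /(_ zk) ->.
by rewrite expg0.
Qed.

Lemma local_wang_model : exists a1 a2 a3 a4,
  wang_model ('Gal({:L} / 1))%G (gal_stab_groupType z) a1 a2 a3 a4 tau.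
Proof.
pose rv (s : seq 'F_2) : 'rV['F_2]_4 := \row_j nth 0 s j.
(* Conjugation acts on sign vectors by (v0, v1, v2, v3) -> (v0, v1, v3, v1 + v2). It fixes the sign
   of [r], and the orbit of (0, 1, 0, 0) gives a2, a3, a4, followed by their sum. *)
have [a1 a1I a1v] := kummer_sign_surj (rv [:: 1; 0; 0; 0]).
have [a2 a2I a2v] := kummer_sign_surj (rv [:: 0; 1; 0; 0]).
have [a3 a3I a3v] := kummer_sign_surj (rv [:: 0; 1; 0; 1]).
have [a4 a4I a4v] := kummer_sign_surj (rv [:: 0; 1; 1; 1]).
have conjI g : g \in I -> (tau * g * tau^-1)%g \in I.
  move=> gI; have -> : (tau * g * tau^-1 = g ^ tau^-1)%g by rewrite conjgE invgK mulgA.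
  by rewrite memJ_norm // (norm_stab z_root z_period).
have conj_eq g h : g \in I -> h \in I -> let v := kummer_sign g in
    kummer_sign h = rv [:: v 0 0; v 0 1; v 0 3; v 0 1 + v 0 2] -> (tau * g * tau^-1)%g = h.
  by move=> gI hI v hv; apply: kummer_sign_inj; rewrite ?conjI // kummer_sign_conj.
exists a1, a2, a3, a4; split.
- exact: stab_abelem.
- exact: card_stab.
- apply/eqP; rewrite eqEsubset gen_subG; apply/andP; split; last first.
    by rewrite !subUset !sub1set a1I a2I a3I a4I.
  apply/subsetP => g gI; pose v := kummer_sign g.
  (* The exponents solve the linear system that expresses [v] in the basis above. *)
  have -> : g = (a1 ^+ v 0 0 * a2 ^+ (v 0 1 + v 0 3)%R * a3 ^+ (v 0 2 + v 0 3)%R * a4 ^+ v 0 2)%g.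
    apply: kummer_sign_inj; rewrite ?groupM ?groupX // !kummer_signM ?groupM ?groupX //.
    rewrite !kummer_signX // a1v a2v a3v a4v -/v.
    clearbody v; apply/rowP => j; rewrite !(mulmxnE, mxE).
    have : [\/ j = 0, j = 1, j = 2 | j = 3].
      by case: j => [[|[|[|[|j]]]] lt_j] //; [constructor 1|constructor 2|constructor
        3|constructor 4];
        apply/val_inj.
    by case=> ->; move: (v 0 0) (v 0 1) (v 0 2) (v 0 3) => x0 x1 x2 x3 /=;
      case: x0 => [[|[|x0]] lt0] //; case: x1 => [[|[|x1]] lt1] //;
      case: x2 => [[|[|x2]] lt2] //; case: x3 => [[|[|x3]] lt3] //; apply/val_inj.
  by rewrite !groupM ?groupX // mem_gen // !inE eqxx ?orbT.
- exact: tau_order.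
- exact: stab_sdprod.
- by apply: conj_eq => //; rewrite a1v; congr rv; rewrite !mxE /= addr0.
- by apply: conj_eq => //; rewrite a2v a3v; congr rv; rewrite !mxE /= addr0.
- by apply: conj_eq => //; rewrite a3v a4v; congr rv; rewrite !mxE /= addr0.
apply: conj_eq; rewrite ?groupM //; rewrite !kummer_signM ?groupM // a2v a3v a4v.
apply/rowP => -[[|[|[|[|j]]]] lt_j] //; rewrite !mxE /=; exact/val_inj.
Qed.

End LocalModel.

Lemma wang_Qp_realizable (gT : finGroupType) (G I : {group gT}) a1 a2 a3 a4 h :
  wang_model G I a1 a2 a3 a4 h -> Qp_realizable (isT : prime 2) G I.
Proof.
move=> mG; have [w w_eq] := padic2_sqrt17.
have [L [z [r [i [s0 [s1 [z_root z_period r2 i2 [s02 s12 faithful]]]]]]]] := wang_local_field w_eq.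
have [P abvP] := padic_prime_exists L; have [tau tauP] := padic_frobenius abvP.
have [b1 [b2 [b3 [b4 mL]]]] :=
  local_wang_model abvP z_root z_period r2 i2 s02 s12 faithful tauP.
have [f isof f_im] := wang_model_isom mL mG.
exists L; split; first exact: Q2_ext_galois; exists P => //; exists f => //.
set T := inertia _ P; suff -> : T = gal_stab z by [].
apply/setP => g; rewrite inE mem_gal1 /=.
apply/asboolP/idP => gP.
  by apply/(inertiaP abvP z_root z_period r2 i2 s02 s12 faithful tauP).
by apply/(inertiaP abvP z_root z_period r2 i2 s02 s12 faithful tauP).
Qed.

Local Open Scope group_scope.

Theorem mainTheorem5 (gT : finGroupType) (G I H : {group gT})
    (a1 a2 a3 a4 h : gT)
    (hIabelem : 2.-abelem I) (hIrank : 'r(I) = 4)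
    (hIgen : I = <<[set a1; a2; a3; a4]>> :> {set gT})
    (hHgen : H = <[h]> :> {set gT}) (hHorder : #[h] = 8)
    (hG : I ><| H = G)
    (ha1 : h * a1 * h^-1 = a1)
    (ha2 : h * a2 * h^-1 = a3)
    (ha3 : h * a3 * h^-1 = a4)
    (ha4 : h * a4 * h^-1 = a2 * a3 * a4) :
  (exists D : {group gT},
      [/\ I \subset D, D \subset G & Qp_realizable (isT : prime 2) D I])
  /\ ~ Q_realizable G I 2.
Proof.
have cardI : #|I| = 16.
  have := hIrank; rewrite (rank_abelem hIabelem) => logI.
  by rewrite (card_pgroup (abelem_pgroup hIabelem)) logI.
have mG : wang_model G I a1 a2 a3 a4 h by split=> //; rewrite -hHgen.
split; last exact: wang_not_Q_realizable mG.
have [/andP[sIG _] _ _ _ _] := sdprod_context hG.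
(* The decomposition group can be taken to be all of [G]. *)
by exists G; split=> //; apply: wang_Qp_realizable mG.
Qed.
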